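(* Let $\alpha\geq 0$, let $g\in\mathcal{C}(\overline{\mathbb{D}})$ and $f^{\ast}\in\mathcal{C}^{1}(\mathbb{T})$ be complex-valued, and suppose that $f\in\mathcal{C}^{2}(\mathbb{D})$ satisfies the Dirichlet boundary value problem $\Delta_{\alpha}(f)=g$ in $\mathbb{D}$, $f=f^{\ast}$ on $\mathbb{T}$, and that $\mathcal{P}_{\alpha}[f^{\ast}](0)=0$. Then for all $z\in\overline{\mathbb{D}}$, $$|f(z)|\leq 2^{\alpha}\left[\frac{4}{\pi}\|f^{\ast}\|_{\infty}\arctan|z|+\|g\|_{\infty}(1-|z|^2)^{\alpha+1}\right].$$ Moreover, the inequality is sharp: if $\alpha=0$, $g(z)\equiv -C$ with $C$ a positive constant, and $f(z)=C(1-|z|^{2})$, then equality holds.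
   Context: $\mathbb{D}=\{z\in\mathbb{C}:|z|<1\}$, $\mathbb{T}=\partial\mathbb{D}$, $\overline{\mathbb{D}}=\mathbb{D}\cup\mathbb{T}$. $\mathcal{C}^m(\Omega)$ denotes the complex-valued $m$-times continuously differentiable functions on $\Omega$, and $\mathcal{C}=\mathcal{C}^0$. With $\partial_z=\frac12(\partial_x-i\partial_y)$ and $\overline{\partial}_z=\frac12(\partial_x+i\partial_y)$, the weighted Laplacian is $$\Delta_{\alpha}(f)(z)=\partial_z\big[(1-|z|^2)^{-\alpha}\,\overline{\partial}_z f\big](z),\quad z\in\mathbb{D},\ \alpha>-1.$$ The boundary condition $f=f^{\ast}$ on $\mathbb{T}$ means $f_r\to f^{\ast}$ in the space of distributions $\mathcal{D}'(\mathbb{T})$ as $r\to1^-$, where $f_r(e^{i\theta})=f(re^{i\theta})$; on $\mathbb{T}$ the values of $f$ are those of $f^{\ast}$. The Poisson type integral is $$\mathcal{P}_{\alpha}[f^{\ast}](z)=\frac{1}{2\pi}\int_0^{2\pi}P_{\alpha}(ze^{-i\theta})f^{\ast}(e^{i\theta})\,d\theta,\qquad P_{\alpha}(z)=\frac{(1-|z|^{2})^{\alpha+1}}{(1-z)(1-\overline{z})^{\alpha+1}},\quad z\in\mathbb{D}.$$ $\|f^{\ast}\|_{\infty}=\sup_{z\in\mathbb{T}}|f^{\ast}(z)|$ and $\|g\|_{\infty}=\sup_{z\in\mathbb{D}}|g(z)|$. *)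

(* Defs.v *)
From Stdlib Require Import Reals.
From Coquelicot Require Import Coquelicot.
Open Scope R_scope.

Definition unit_disc (z : C) : Prop := Cmod z < 1.
Definition unit_circle (z : C) : Prop := Cmod z = 1.
Definition closed_unit_disc (z : C) : Prop := Cmod z <= 1.

(** [cis t] is e^{it}. *)
Definition cis (t : R) : C := (cos t, sin t).

(** Complex-valued functions of z = x + iy are differentiated with respect to
    the real variables x and y, real and imaginary parts separately. *)
Definition ex_dx (f : C -> C) (z : C) : Prop :=
  ex_derive (fun x : R => Re (f (x, Im z))) (Re z) /\
  ex_derive (fun x : R => Im (f (x, Im z))) (Re z).

Definition ex_dy (f : C -> C) (z : C) : Prop :=
  ex_derive (fun y : R => Re (f (Re z, y))) (Im z) /\
  ex_derive (fun y : R => Im (f (Re z, y))) (Im z).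

Definition dx (f : C -> C) (z : C) : C :=
  (Derive (fun x : R => Re (f (x, Im z))) (Re z),
   Derive (fun x : R => Im (f (x, Im z))) (Re z)).

Definition dy (f : C -> C) (z : C) : C :=
  (Derive (fun y : R => Re (f (Re z, y))) (Im z),
   Derive (fun y : R => Im (f (Re z, y))) (Im z)).

Definition d_z (f : C -> C) (z : C) : C :=
  (RtoC (/ 2) * (dx f z - Ci * dy f z))%C.

Definition d_zbar (f : C -> C) (z : C) : C :=
  (RtoC (/ 2) * (dx f z + Ci * dy f z))%C.

Definition weighted_laplacian (alpha : R) (f : C -> C) (z : C) : C :=
  d_z (fun w : C =>
         (RtoC (Rpower (1 - Cmod w ^ 2) (- alpha)) * d_zbar f w)%C) z.

(** C^m on an open set: all iterated partial derivatives of order at most m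
    exist and are continuous there. *)
Fixpoint Cm_on (m : nat) (Omega : C -> Prop) (f : C -> C) : Prop :=
  (forall z : C, Omega z -> continuous f z) /\
  match m with
  | O => True
  | S k =>
      (forall z : C, Omega z -> ex_dx f z /\ ex_dy f z) /\
      Cm_on k Omega (dx f) /\ Cm_on k Omega (dy f)
  end.

(** Continuity for the subspace topology of a set that need not be open. *)
Definition continuous_within (A : C -> Prop) (f : C -> C) : Prop :=
  forall z : C, A z -> filterlim f (within A (locally z)) (locally (f z)).

Definition Cm_R (m : nat) (u : R -> R) : Prop :=
  forall k : nat, (k <= m)%nat ->
  forall t : R, ex_derive_n u k t /\ continuous (Derive_n u k) t.

(** C^m on the circle, in the coordinate t |-> e^{it}. *)
Definition Cm_circle (m : nat) (h : C -> C) : Prop :=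
  Cm_R m (fun t : R => Re (h (cis t))) /\
  Cm_R m (fun t : R => Im (h (cis t))).

Definition Cinfty_circle (h : C -> C) : Prop := forall m : nat, Cm_circle m h.

Definition CInt (u : R -> C) (a b : R) : C :=
  (RInt (fun t : R => Re (u t)) a b, RInt (fun t : R => Im (u t)) a b).

(** The distribution on the circle given by a continuous function h, acting on
    a test function phi. *)
Definition circle_pairing (h phi : C -> C) : C :=
  (RtoC (/ (2 * PI)) *
   CInt (fun t : R => (h (cis t) * phi (cis t))%C) 0 (2 * PI))%C.

(** f = fs on the circle: the dilates f_r converge to fs in the space of
    distributions as r -> 1-, and the values taken by f itself on the circle
    are those of fs. *)
Definition boundary_values (f fs : C -> C) : Prop :=
  (forall phi : C -> C, Cinfty_circle phi ->
     filterlim (fun r : R => circle_pairing (fun w : C => f (RtoC r * w)%C) phi)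
       (at_left 1) (locally (circle_pairing fs phi))) /\
  (forall z : C, unit_circle z -> f z = fs z).

Definition dirichlet_problem (alpha : R) (g fs f : C -> C) : Prop :=
  (forall z : C, unit_disc z -> weighted_laplacian alpha f z = g z) /\
  boundary_values f fs.

(** Principal argument and principal power on C minus (-oo, 0]: the argument is
    given by tan (arg w / 2) = Im w / (|w| + Re w).  Below w ranges over the
    half-plane Re w > 0. *)
Definition Carg (w : C) : R := 2 * atan (Im w / (Cmod w + Re w)).

Definition Cpowr (w : C) (a : R) : C :=
  (RtoC (Rpower (Cmod w) a) * cis (a * Carg w))%C.

Definition poisson_kernel (alpha : R) (z : C) : C :=
  (RtoC (Rpower (1 - Cmod z ^ 2) (alpha + 1)) /
   ((1 - z) * Cpowr (1 - Cconj z) (alpha + 1)))%C.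

Definition poisson_integral (alpha : R) (fs : C -> C) (z : C) : C :=
  (RtoC (/ (2 * PI)) *
   CInt (fun t : R => (poisson_kernel alpha (z * cis (- t)) * fs (cis t))%C)
        0 (2 * PI))%C.

(** sup of |h| over A; only used when h is bounded on A, so that the least
    upper bound is finite. *)
Definition sup_norm (A : C -> Prop) (h : C -> C) : R :=
  real (Lub_Rbar (fun x : R => exists z : C, A z /\ x = Cmod (h z))).

(** x^a for x >= 0 and a > 0.  [Rpower 0 a] is 1 because [ln 0] is 0, so the
    value at x = 0 has to be corrected. *)
Definition Rpow_nonneg (x a : R) : R :=
  if Rlt_dec 0 x then Rpower x a else 0.

(* Main.v *)
Require Import Defs.
From Stdlib Require Import Reals Lra Lia Psatz FunctionalExtensionality.
From Coquelicot Require Import Coquelicot.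
Open Scope R_scope.

(** Write f_z and f_zbar for the Wirtinger derivatives. The equation says that
    H = (1 - |z|^2)^(- alpha) f_zbar has H_z = g. Let z0 = eta r with |eta| = 1 and 0 <= r < 1,
    and let mobius r z = (z + r) / (1 + r z).

    The estimate inside the disc. The operator is covariant under automorphisms of the disc: the
    function F(z) = (1 + r z)^alpha f(eta mobius r z) satisfies an equation of the same form,
    with a right side controlled by g. The mean m(rho) of F over the circle of radius rho has
    the derivative rho m' = 2 int conj z F_zbar = 2 int z F_z; using this twice gives
    |m(rho) - 2 pi f(z0)| <= 2 pi 2^alpha |g| (1 - r^2)^(alpha + 1) for every rho < 1
    ([interior_estimate]). The Green function is never computed; its integral is replaced by a
    comparison with |mobius r|^2.

    Passing to the boundary. If f were continuous up to the circle, m(1) would be the integral of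
    F over the unit circle. The boundary values being distributions, f is first averaged over
    rotations with the kernel ((1 + cos s) / 2)^N. Its translates span a space of finite
    dimension, so the averages of the dilates of f converge uniformly ([trig_moment_uniform]), and
    rho can tend to 1. At the end N tends to infinity ([bound_from_smoothed]); as f is continuous
    inside, this recovers the value f(z0).

    The integral over the circle. The substitution which undoes mobius r turns m(1) into the
    integral of the boundary function against the kernel P_alpha(r e^{- i th}). As P_alpha is 1 at
    the origin, P_alpha[f*](0) = 0 means that f* has mean zero, so any constant c may be
    subtracted from the kernel, and the claim follows from
    int |P_alpha(r e^{- i th}) - c| <= 8 2^alpha atan r for some c ([kernel_L1]). For alpha = 0 this
    is an equality with c = cos (2 atan r), since poisson - c has the sign of cos th. In general the
    kernel is the Poisson kernel times w^alpha, where w runs through the circle of radius r about 1.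
    For alpha >= 1 the inequality |w^alpha - 1| <= r (2^alpha - 1) reduces the claim to alpha = 0.
    For alpha < 1 the deviation is split into that of the modulus, estimated by pairing th with
    th + pi, and an excess caused by the argument; both have explicit bounds, and what remains is
    the inequality [excess_total_bound] between functions of r and alpha.

    For the sharpness, f = C (1 - |z|^2) is substituted. *)

(** * Derivatives along curves and Wirtinger derivatives *)

Definition is_Cderive (u : R -> C) (t : R) (l : C) : Prop :=
  is_derive (fun s => Re (u s)) t (Re l) /\
  is_derive (fun s => Im (u s)) t (Im l).

Lemma is_Cderive_const (c : C) (t : R) : is_Cderive (fun _ => c) t (RtoC 0).
Proof. split; simpl; apply @is_derive_const. Qed.

Lemma is_Cderive_plus (u v : R -> C) (t : R) (a b : C) :
  is_Cderive u t a -> is_Cderive v t b -> is_Cderive (fun s => (u s + v s)%C) t (a + b)%C.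
Proof.
  intros [Hu1 Hu2] [Hv1 Hv2]; split; simpl.
  - exact (is_derive_plus _ _ _ _ _ Hu1 Hv1).
  - exact (is_derive_plus _ _ _ _ _ Hu2 Hv2).
Qed.

Lemma is_Cderive_conj (u : R -> C) (t : R) (a : C) :
  is_Cderive u t a -> is_Cderive (fun s => Cconj (u s)) t (Cconj a).
Proof.
  intros [Hu1 Hu2]; split; simpl.
  - exact Hu1.
  - exact (is_derive_opp _ _ _ Hu2).
Qed.

Lemma is_derive_val (f : R -> R) (x a b : R) : is_derive f x a -> a = b -> is_derive f x b.
Proof. intros H <-; exact H. Qed.

Lemma is_derive_scal_l (k : R) (f : R -> R) (x d : R) :
  is_derive f x d -> is_derive (fun s => k * f s) x (k * d).
Proof. intros H. exact (is_derive_scal f x k d H). Qed.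

Lemma is_Cderive_val (u : R -> C) (x : R) (a b : C) : is_Cderive u x a -> a = b -> is_Cderive u x b.
Proof. intros H <-; exact H. Qed.

Lemma is_Cderive_ext_loc (u v : R -> C) (t : R) (a : C) :
  locally t (fun s => u s = v s) -> is_Cderive u t a -> is_Cderive v t a.
Proof.
  intros He [H1 H2]; split.
  - apply is_derive_ext_loc with (fun s => Re (u s)); [|exact H1].
    revert He; apply filter_imp; intros s ->; reflexivity.
  - apply is_derive_ext_loc with (fun s => Im (u s)); [|exact H2].
    revert He; apply filter_imp; intros s ->; reflexivity.
Qed.

Lemma is_Cderive_ext (u v : R -> C) (t : R) (a : C) :
  (forall s, u s = v s) -> is_Cderive u t a -> is_Cderive v t a.
Proof. intros He; apply is_Cderive_ext_loc; apply filter_forall; exact He. Qed.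

Lemma is_Cderive_mult (u v : R -> C) (t : R) (a b : C) :
  is_Cderive u t a -> is_Cderive v t b ->
  is_Cderive (fun s => (u s * v s)%C) t (a * v t + u t * b)%C.
Proof.
  intros [Hu1 Hu2] [Hv1 Hv2]; split; simpl.
  - eapply is_derive_val.
    + apply @is_derive_minus; apply @is_derive_mult; try eassumption; exact Rmult_comm.
    + unfold minus, plus, opp, mult; simpl; unfold Re, Im; ring.
  - eapply is_derive_val.
    + apply @is_derive_plus; apply @is_derive_mult; try eassumption; exact Rmult_comm.
    + unfold minus, plus, opp, mult; simpl; unfold Re, Im; ring.
Qed.

Lemma is_Cderive_RtoC (g : R -> R) (t l : R) :
  is_derive g t l -> is_Cderive (fun s => RtoC (g s)) t (RtoC l).
Proof. intros H; split; simpl; [exact H|apply @is_derive_const]. Qed.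

Lemma is_Cderive_cis (t : R) : is_Cderive cis t (Ci * cis t)%C.
Proof.
  split; unfold cis; simpl.
  - auto_derive; [trivial|ring].
  - auto_derive; [trivial|ring].
Qed.

Lemma Cnorm2_pos (z : C) : z <> 0%C -> 0 < Re z ^ 2 + Im z ^ 2.
Proof.
  intros Hz. rewrite <- Cmod2_alt. apply pow_lt. now apply Cmod_gt_0.
Qed.

Lemma is_Cderive_inv (u : R -> C) (t : R) (a : C) :
  is_Cderive u t a -> u t <> 0%C -> is_Cderive (fun s => (/ u s)%C) t (- a / (u t * u t))%C.
Proof.
  intros [H1 H2] Hz. pose proof (Cnorm2_pos _ Hz) as Hn.
  assert (HD : is_derive (fun s => fst (u s) * (fst (u s) * 1) + snd (u s) * (snd (u s) * 1)) t
    (2 * (Re a * Re (u t) + Im a * Im (u t)))).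
  { eapply is_derive_val.
    - apply @is_derive_plus; (apply @is_derive_mult; [| |exact Rmult_comm]);
        try eassumption; apply @is_derive_mult; try eassumption; try exact Rmult_comm;
        apply @is_derive_const.
    - unfold plus, mult, zero; simpl; unfold Re, Im; ring. }
  split; unfold Cinv; simpl; (eapply is_derive_val;
    [apply is_derive_div; [first [exact H1|apply @is_derive_opp; exact H2]|exact HD|] |]).
  all: unfold opp, Re, Im in *; simpl in *; try field; nra.
Qed.

(** [a] and [b] are the two Wirtinger derivatives of [F] at [z]. Testing differentiability along
    all curves through [z] reduces the rules of calculus to those for functions of one real
    variable, and it makes sense for compositions without discussing remainders. *)
Definition is_wirtinger (F : C -> C) (z a b : C) : Prop :=
  forall (c : R -> C) (t : R) (l : C), c t = z -> is_Cderive c t l ->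
    is_Cderive (fun s => F (c s)) t (a * l + b * Cconj l)%C.

Lemma wirtinger_const (k z : C) : is_wirtinger (fun _ => k) z (RtoC 0) (RtoC 0).
Proof.
  intros c t l _ _. eapply is_Cderive_val; [apply is_Cderive_const|ring].
Qed.

Lemma wirtinger_id (z : C) : is_wirtinger (fun w => w) z (RtoC 1) (RtoC 0).
Proof.
  intros c t l _ H. eapply is_Cderive_val; [exact H|ring].
Qed.

Lemma wirtinger_val (F : C -> C) (z a b a' b' : C) :
  is_wirtinger F z a b -> a = a' -> b = b' -> is_wirtinger F z a' b'.
Proof. intros H <- <-; exact H. Qed.

Lemma wirtinger_plus (F G : C -> C) (z a b a' b' : C) :
  is_wirtinger F z a b -> is_wirtinger G z a' b' ->
  is_wirtinger (fun w => F w + G w)%C z (a + a')%C (b + b')%C.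
Proof.
  intros HF HG c t l Hc Hd.
  eapply is_Cderive_val; [exact (is_Cderive_plus _ _ _ _ _ (HF c t l Hc Hd) (HG c t l Hc Hd))|].
  ring.
Qed.

Lemma wirtinger_mult (F G : C -> C) (z a b a' b' : C) :
  is_wirtinger F z a b -> is_wirtinger G z a' b' ->
  is_wirtinger (fun w => F w * G w)%C z (a * G z + F z * a')%C (b * G z + F z * b')%C.
Proof.
  intros HF HG c t l Hc Hd.
  eapply is_Cderive_val; [exact (is_Cderive_mult _ _ _ _ _ (HF c t l Hc Hd) (HG c t l Hc Hd))|].
  cbv beta; rewrite Hc. ring.
Qed.

Lemma wirtinger_conj (F : C -> C) (z a b : C) :
  is_wirtinger F z a b -> is_wirtinger (fun w => Cconj (F w)) z (Cconj b) (Cconj a).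
Proof.
  intros HF c t l Hc Hd.
  eapply is_Cderive_val; [exact (is_Cderive_conj _ _ _ (HF c t l Hc Hd))|].
  rewrite Cplus_conj, !Cmult_conj, Cconj_conj. ring.
Qed.

Lemma wirtinger_inv (F : C -> C) (z a b : C) :
  is_wirtinger F z a b -> F z <> 0%C ->
  is_wirtinger (fun w => / F w)%C z (- a / (F z * F z))%C (- b / (F z * F z))%C.
Proof.
  intros HF Hz c t l Hc Hd.
  eapply is_Cderive_val; [apply (is_Cderive_inv _ _ _ (HF c t l Hc Hd))|].
  - cbv beta; rewrite Hc; exact Hz.
  - cbv beta; rewrite Hc. field. exact Hz.
Qed.

Lemma wirtinger_comp_hol (F G : C -> C) (z p a b : C) :
  is_wirtinger G z p (RtoC 0) -> is_wirtinger F (G z) a b ->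
  is_wirtinger (fun w => F (G w)) z (a * p)%C (b * Cconj p)%C.
Proof.
  intros HG HF c t l Hc Hd.
  assert (H : is_Cderive (fun s => G (c s)) t (p * l)%C).
  { eapply is_Cderive_val; [exact (HG c t l Hc Hd)|ring]. }
  eapply is_Cderive_val; [apply (HF (fun s => G (c s)) t (p * l)%C); [cbv beta;
    now rewrite Hc|exact H]|].
  rewrite Cmult_conj. ring.
Qed.

(** * Continuity of explicit expressions *)

Section Cont.
Context {U : UniformSpace}.

Lemma continuous_pairC (u v : U -> R) (x : U) :
  continuous u x -> continuous v x -> continuous (fun y => (u y, v y) : C) x.
Proof.
  intros Hu Hv P [e He].
  assert (H1 := Hu _ (locally_ball (u x) e)). assert (H2 := Hv _ (locally_ball (v x) e)).
  unfold filtermap in *. apply (filter_imp (F := locally x) _ _ (fun y (H : _ /\ _) => He (u y,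
    v y) (conj (proj1 H) (proj2 H))) (filter_and _ _ H1 H2)).
Qed.

Lemma continuous_Re_fun (u : U -> C) (x : U) :
  continuous u x -> continuous (fun y => Re (u y)) x.
Proof.
  intros H P [e He].
  assert (H1 := H _ (locally_ball (u x : C_UniformSpace) e)). unfold filtermap in *.
  apply (filter_imp (F := locally x) _ _ (fun y B => He (Re (u y)) (proj1 B)) H1).
Qed.

Lemma continuous_Im_fun (u : U -> C) (x : U) :
  continuous u x -> continuous (fun y => Im (u y)) x.
Proof.
  intros H P [e He].
  assert (H1 := H _ (locally_ball (u x : C_UniformSpace) e)). unfold filtermap in *.
  apply (filter_imp (F := locally x) _ _ (fun y B => He (Im (u y)) (proj2 B)) H1).
Qed.

Lemma continuous_Rplus_fun (u v : U -> R) (x : U) :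
  continuous u x -> continuous v x -> continuous (fun y => u y + v y) x.
Proof. intros; now apply @continuous_plus. Qed.

Lemma continuous_Rmult_fun (u v : U -> R) (x : U) :
  continuous u x -> continuous v x -> continuous (fun y => u y * v y) x.
Proof. intros; now apply @continuous_mult. Qed.

Lemma continuous_Ropp_fun (u : U -> R) (x : U) :
  continuous u x -> continuous (fun y => - u y) x.
Proof. intros; now apply @continuous_opp. Qed.

Lemma continuous_Rinv_fun (u : U -> R) (x : U) :
  continuous u x -> u x <> 0 -> continuous (fun y => / u y) x.
Proof.
  intros H Hz. apply (continuous_comp u Rinv x H). now apply continuous_Rinv.
Qed.

Lemma continuous_Cplus_fun (u v : U -> C) (x : U) :
  continuous u x -> continuous v x -> continuous (fun y => (u y + v y)%C) x.
Proof.
  intros Hu Hv.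
  exact (continuous_pairC _ _ _
    (continuous_Rplus_fun _ _ _ (continuous_Re_fun _ _ Hu) (continuous_Re_fun _ _ Hv))
    (continuous_Rplus_fun _ _ _ (continuous_Im_fun _ _ Hu) (continuous_Im_fun _ _ Hv))).
Qed.

Lemma continuous_Copp_fun (u : U -> C) (x : U) :
  continuous u x -> continuous (fun y => (- u y)%C) x.
Proof.
  intros Hu.
  exact (continuous_pairC _ _ _
    (continuous_Ropp_fun _ _ (continuous_Re_fun _ _ Hu)) (continuous_Ropp_fun _ _
      (continuous_Im_fun _ _ Hu))).
Qed.

Lemma continuous_Cconj_fun (u : U -> C) (x : U) :
  continuous u x -> continuous (fun y => Cconj (u y)) x.
Proof.
  intros Hu.
  exact (continuous_pairC _ _ _
    (continuous_Re_fun _ _ Hu) (continuous_Ropp_fun _ _ (continuous_Im_fun _ _ Hu))).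
Qed.

Lemma continuous_Cmult_fun (u v : U -> C) (x : U) :
  continuous u x -> continuous v x -> continuous (fun y => (u y * v y)%C) x.
Proof.
  intros Hu Hv.
  assert (U1 := continuous_Re_fun _ _ Hu). assert (U2 := continuous_Im_fun _ _ Hu).
  assert (V1 := continuous_Re_fun _ _ Hv). assert (V2 := continuous_Im_fun _ _ Hv).
  exact (continuous_pairC _ _ _
    (continuous_Rplus_fun _ _ _ (continuous_Rmult_fun _ _ _ U1 V1)
       (continuous_Ropp_fun _ _ (continuous_Rmult_fun _ _ _ U2 V2)))
    (continuous_Rplus_fun _ _ _ (continuous_Rmult_fun _ _ _ U1 V2) (continuous_Rmult_fun _ _ _ U2
      V1))).
Qed.

Lemma continuous_Cinv_fun (u : U -> C) (x : U) :
  continuous u x -> u x <> 0%C -> continuous (fun y => (/ u y)%C) x.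
Proof.
  intros Hu Hz. pose proof (Cnorm2_pos _ Hz) as Hn.
  assert (HR := continuous_Re_fun _ _ Hu). assert (HI := continuous_Im_fun _ _ Hu).
  assert (HD : continuous (fun y => / (Re (u y) ^ 2 + Im (u y) ^ 2)) x).
  { apply continuous_Rinv_fun; [|lra].
    apply continuous_Rplus_fun; apply continuous_Rmult_fun; try assumption;
      (apply continuous_Rmult_fun; [assumption|apply continuous_const]). }
  apply continuous_pairC; unfold Rdiv; apply continuous_Rmult_fun; try assumption.
  now apply continuous_Ropp_fun.
Qed.

Lemma continuous_RtoC_fun (u : U -> R) (x : U) :
  continuous u x -> continuous (fun y => RtoC (u y)) x.
Proof. intros Hu. apply continuous_pairC; [exact Hu|apply continuous_const]. Qed.

Lemma continuous_Cmod_fun (u : U -> C) (x : U) :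
  continuous u x -> continuous (fun y => Cmod (u y)) x.
Proof.
  intros Hu. unfold Cmod.
  apply (continuous_comp (fun y => fst (u y) ^ 2 + snd (u y) ^ 2) sqrt).
  - assert (HR := continuous_Re_fun _ _ Hu). assert (HI := continuous_Im_fun _ _ Hu).
    apply continuous_Rplus_fun; apply continuous_Rmult_fun; try assumption;
      (apply continuous_Rmult_fun; [assumption|apply continuous_const]).
  - apply continuous_sqrt.
Qed.

Lemma continuous_cis_fun (u : U -> R) (x : U) :
  continuous u x -> continuous (fun y => cis (u y)) x.
Proof.
  intros Hu. apply continuous_pairC.
  - apply (continuous_comp u cos _ Hu), continuous_cos.
  - apply (continuous_comp u sin _ Hu), continuous_sin.
Qed.

Lemma continuous_exp_fun (u : U -> R) (x : U) :
  continuous u x -> continuous (fun y => exp (u y)) x.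
Proof. intros Hu. apply (continuous_comp u exp _ Hu), continuous_exp. Qed.

Lemma continuous_ln_fun (u : U -> R) (x : U) :
  continuous u x -> 0 < u x -> continuous (fun y => ln (u y)) x.
Proof.
  intros Hu Hp. apply (continuous_comp u ln _ Hu).
  apply (@ex_derive_continuous R_AbsRing R_NormedModule). eexists. now apply is_derive_ln.
Qed.

End Cont.

Lemma continuous_Rabs_fun {U : UniformSpace} (u : U -> R) (x : U) :
  continuous u x -> continuous (fun y => Rabs (u y)) x.
Proof. intros Hu. apply (continuous_comp u Rabs _ Hu), continuous_Rabs. Qed.

Lemma continuous_pow_fun {U : UniformSpace} (u : U -> R) (n : nat) (x : U) :
  continuous u x -> continuous (fun y => u y ^ n) x.
Proof.
  intros Hu. induction n as [|n IH]; simpl; [apply continuous_const|now apply continuous_Rmult_fun].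
Qed.

Lemma continuous_Rpower_fun {U : UniformSpace} (u : U -> R) (c : R) (x : U) :
  continuous u x -> 0 < u x -> continuous (fun y => Rpower (u y) c) x.
Proof.
  intros Hu Hp. unfold Rpower. apply continuous_exp_fun, continuous_Rmult_fun;
    [apply continuous_const|].
  now apply continuous_ln_fun.
Qed.

Create HintDb cts.
#[export] Hint Resolve continuous_cos continuous_sin continuous_Rabs continuous_sqrt
  continuous_atan continuous_exp : cts.

(** Continuity of an explicit expression, following its syntax; the denominators that must not
    vanish and the functions without a known continuity lemma are left as goals. *)
Ltac cts_step :=
  cbv beta;
  first [match goal with H : continuous ?f ?x |- continuous ?f ?x => exact H end | lazymatch goal
    with
  | |- continuous (fun _ => ?c) _ => apply continuous_const
  | |- continuous (fun x => x) _ => apply continuous_id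
  | |- continuous (fun x => fst x) _ => apply continuous_fst
  | |- continuous (fun x => snd x) _ => apply continuous_snd
  | |- continuous (fun x => Cplus (@?u x) (@?v x)) _ => apply (continuous_Cplus_fun u v)
  | |- continuous (fun x => Cminus (@?u x) (@?v x)) _ =>
      apply (continuous_Cplus_fun u (fun x => Copp (v x)))
  | |- continuous (fun x => Cmult (@?u x) (@?v x)) _ => apply (continuous_Cmult_fun u v)
  | |- continuous (fun x => Cdiv (@?u x) (@?v x)) _ =>
      apply (continuous_Cmult_fun u (fun x => Cinv (v x)))
  | |- continuous (fun x => Copp (@?u x)) _ => apply (continuous_Copp_fun u)
  | |- continuous (fun x => Cconj (@?u x)) _ => apply (continuous_Cconj_fun u)
  | |- continuous (fun x => Cinv (@?u x)) _ => apply (continuous_Cinv_fun u)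
  | |- continuous (fun x => RtoC (@?u x)) _ => apply (continuous_RtoC_fun u)
  | |- continuous (fun x => Cmod (@?u x)) _ => apply (continuous_Cmod_fun u)
  | |- continuous (fun x => Re (@?u x)) _ => apply (continuous_Re_fun u)
  | |- continuous (fun x => Im (@?u x)) _ => apply (continuous_Im_fun u)
  | |- continuous (fun x => cis (@?u x)) _ => apply (continuous_cis_fun u)
  | |- continuous (fun x => Rplus (@?u x) (@?v x)) _ => apply (continuous_Rplus_fun u v)
  | |- continuous (fun x => Rminus (@?u x) (@?v x)) _ =>
      apply (continuous_Rplus_fun u (fun x => Ropp (v x)))
  | |- continuous (fun x => Rmult (@?u x) (@?v x)) _ => apply (continuous_Rmult_fun u v)
  | |- continuous (fun x => Rdiv (@?u x) (@?v x)) _ =>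
      apply (continuous_Rmult_fun u (fun x => Rinv (v x)))
  | |- continuous (fun x => Ropp (@?u x)) _ => apply (continuous_Ropp_fun u)
  | |- continuous (fun x => Rinv (@?u x)) _ => apply (continuous_Rinv_fun u)
  | |- continuous (fun x => Rabs (@?u x)) _ => apply (continuous_Rabs_fun u)
  | |- continuous (fun x => pow (@?u x) ?n) _ => apply (continuous_pow_fun u n)
  | |- continuous (fun x => Rpower (@?u x) ?c) _ => apply (continuous_Rpower_fun u c)
  | |- continuous (fun x => ?f (@?u x)) _ => apply (continuous_comp u f)
  end].
Ltac cts := intros; repeat cts_step; cbv beta; try solve [auto with cts].

Lemma continuous_Cmod_small {U : UniformSpace} (u : U -> C) (x : U) (e : R) :
  continuous u x -> 0 < e -> locally x (fun y => Cmod (u y - u x)%C < e).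
Proof.
  intros Hu He. assert (Hc : continuous (fun y => Cmod (u y - u x)%C) x) by cts.
  apply (Hc (fun v => v < e)). apply (open_lt e).
  replace (u x - u x)%C with (RtoC 0) by ring. now rewrite Cmod_0.
Qed.

Lemma is_Cderive_continuous (u : R -> C) (t : R) (l : C) : is_Cderive u t l -> continuous u t.
Proof.
  intros [H1 H2].
  apply (continuous_ext (fun s => (Re (u s), Im (u s)) : C)).
  - intros s. now destruct (u s).
  - apply continuous_pairC; apply (@ex_derive_continuous R_AbsRing R_NormedModule);
      eexists; eassumption.
Qed.

(** * Powers on the right half-plane *)

(** The principal power, written so that its real and imaginary parts can be differentiated
    wherever the real part of [w] is positive: ln |w| is half the logarithm of |w|^2, and the
    argument is atan (Im w / Re w). *)
Definition Cpow_rhp (a : R) (w : C) : C :=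
  (RtoC (exp (a * (ln (Re w ^ 2 + Im w ^ 2) / 2))) * cis (a * atan (Im w / Re w)))%C.

Lemma Cpow_rhp_wirtinger (a : R) (w : C) : 0 < Re w ->
  is_wirtinger (Cpow_rhp a) w (RtoC a * Cpow_rhp a w / w)%C (RtoC 0).
Proof.
  intros Hw c t l Hc [H1 H2]. subst w. set (w := c t) in *.
  assert (Hn : 0 < Re w ^ 2 + Im w ^ 2) by nra.
  assert (Hw0 : w <> 0%C). { intros E. rewrite E in Hw. simpl in Hw. lra. }
  assert (Hexp : is_derive (fun s => exp (a * (ln (Re (c s) ^ 2 + Im (c s) ^ 2) / 2))) t
     (a * (Re w * Re l + Im w * Im l) / (Re w ^ 2 + Im w ^ 2) *
        exp (a * (ln (Re w ^ 2 + Im w ^ 2) / 2)))).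
  { eapply is_derive_val.
    - apply (is_derive_comp exp (fun s => a * (ln (Re (c s) ^ 2 + Im (c s) ^ 2) / 2))).
      + apply is_derive_exp.
      + apply is_derive_scal_l.
        apply is_derive_ext with (fun s => / 2 * ln (Re (c s) ^ 2 + Im (c s) ^ 2)).
        { intros s. unfold Rdiv. apply Rmult_comm. }
        apply is_derive_scal_l.
        apply (is_derive_comp ln (fun s => Re (c s) ^ 2 + Im (c s) ^ 2)).
        * apply is_derive_ln. exact Hn.
        * apply @is_derive_plus; apply is_derive_pow; eassumption.
    - unfold scal, plus, mult; simpl; unfold mult; simpl. fold w. field.
      apply Rgt_not_eq. nra. }
  assert (Harg : is_derive (fun s => a * atan (Im (c s) / Re (c s))) t
     (a * (Re w * Im l - Im w * Re l) / (Re w ^ 2 + Im w ^ 2))).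
  { eapply is_derive_val.
    - apply is_derive_scal_l.
      apply (is_derive_comp atan (fun s => Im (c s) / Re (c s))).
      + apply is_derive_atan.
      + apply is_derive_div; try eassumption. fold w; lra.
    - unfold scal; simpl; unfold mult; simpl. fold w. unfold Rsqr. field.
      repeat split; try lra; nra. }
  assert (Hcis : is_Cderive (fun s => cis (a * atan (Im (c s) / Re (c s)))) t
     (RtoC (a * (Re w * Im l - Im w * Re l) / (Re w ^ 2 + Im w ^ 2)) *
        (Ci * cis (a * atan (Im w / Re w))))%C).
  { split; unfold cis; simpl.
    - eapply is_derive_val.
      + apply (is_derive_comp cos (fun s => a * atan (Im (c s) / Re (c s)))).
        * apply is_derive_cos.
        * exact Harg.
      + unfold scal; simpl; unfold mult; simpl. fold w. ring.
    - eapply is_derive_val.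
      + apply (is_derive_comp sin (fun s => a * atan (Im (c s) / Re (c s)))).
        * apply is_derive_sin.
        * exact Harg.
      + unfold scal; simpl; unfold mult; simpl. fold w. ring. }
  eapply is_Cderive_val; [exact (is_Cderive_mult _ _ _ _ _ (is_Cderive_RtoC _ _ _ Hexp) Hcis)|].
  unfold Cpow_rhp. fold w.
  set (E := exp _). set (K := cis _).
  rewrite !RtoC_mult.
  transitivity (RtoC E * K * (RtoC a * (l / w)))%C.
  - assert (El : (l / w)%C = (RtoC ((Re w * Re l + Im w * Im l) / (Re w ^ 2 + Im w ^ 2))
        + Ci * RtoC ((Re w * Im l - Im w * Re l) / (Re w ^ 2 + Im w ^ 2)))%C).
    { unfold Cdiv, Cmult, Cinv, Cplus, RtoC, Ci; simpl. unfold Re, Im in *; simpl in *.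
      f_equal; field; nra. }
    rewrite El. unfold Rdiv. rewrite !RtoC_mult. ring.
  - field. exact Hw0.
Qed.

Lemma Cpow_rhp_1 (a : R) : Cpow_rhp a (RtoC 1) = RtoC 1.
Proof.
  unfold Cpow_rhp, RtoC; simpl. replace (0 / 1) with 0 by field.
  replace (1 * (1 * 1) + 0 * (0 * 1)) with 1 by ring. rewrite ln_1, atan_0.
  replace (0 / 2) with 0 by field. rewrite Rmult_0_r, exp_0.
  unfold cis, Cmult. rewrite cos_0, sin_0. simpl. f_equal; ring.
Qed.

Lemma Cpow_rhp_continuous (a : R) (w : C) : 0 < Re w -> continuous (Cpow_rhp a) w.
Proof.
  intros Hw. unfold Cpow_rhp.
  assert (HL : continuous (fun z : C => ln (Re z ^ 2 + Im z ^ 2)) w)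
    by (apply continuous_ln_fun; [cts|nra]).
  cts. lra.
Qed.

Lemma Cmod_cis (t : R) : Cmod (cis t) = 1.
Proof.
  unfold cis, Cmod; simpl. rewrite !Rmult_1_r.
  replace (cos t * cos t + sin t * sin t) with 1; [apply sqrt_1|].
  generalize (sin2_cos2 t); unfold Rsqr; lra.
Qed.

Lemma Cmod_Cpow_rhp (a : R) (w : C) : 0 < Re w -> Cmod (Cpow_rhp a w) = Rpower (Cmod w) a.
Proof.
  intros Hw. assert (Hn : 0 < Re w ^ 2 + Im w ^ 2) by nra.
  assert (HM : 0 < Cmod w). { apply Cmod_gt_0. intros E. rewrite E in Hw. simpl in Hw. lra. }
  unfold Cpow_rhp. rewrite Cmod_mult, Cmod_cis, Rmult_1_r, Cmod_R, Rabs_pos_eq by (left;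
    apply exp_pos).
  unfold Rpower. f_equal. f_equal. rewrite <- Cmod2_alt.
  replace (Cmod w ^ 2) with (Cmod w * Cmod w) by ring. rewrite ln_mult by assumption. field.
Qed.

Lemma Cpow_rhp_neq_0 (a : R) (w : C) : 0 < Re w -> Cpow_rhp a w <> 0%C.
Proof.
  intros Hw E. assert (H := Cmod_Cpow_rhp a w Hw). rewrite E, Cmod_0 in H.
  generalize (exp_pos (a * ln (Cmod w))). unfold Rpower in H. lra.
Qed.

(** * Functions of class C^1 *)

Lemma is_derive_comp_2d (f : R -> R -> R) (x y : R) (fx : R -> R -> R) (fy : R)
    (u v : R -> R) (t du dv : R) :
  locally (x, y) (fun p => is_derive (fun z => f z (snd p)) (fst p) (fx (fst p) (snd p))) ->
  is_derive (fun z => f x z) y fy ->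
  continuous (fun p => fx (fst p) (snd p)) (x, y) ->
  u t = x -> v t = y -> is_derive u t du -> is_derive v t dv ->
  is_derive (fun s => f (u s) (v s)) t (fx x y * du + fy * dv).
Proof.
  intros H1 H2 H3 Hu Hv Du Dv. subst x y.
  assert (H := is_derive_filterdiff f (u t) (v t) fx fy H1 H2 H3).
  apply is_derive_Reals. apply derivable_pt_lim_comp_2d.
  - apply filterdiff_differentiable_pt_lim. exact H.
  - now apply is_derive_Reals.
  - now apply is_derive_Reals.
Qed.

Lemma disc_open (z : C) : unit_disc z -> locally z unit_disc.
Proof.
  intros Hz. unfold unit_disc.
  assert (H := continuous_Cmod_fun (fun w : C => w) z (continuous_id z)).
  apply (H (fun r => r < 1)). apply (open_lt 1). exact Hz.
Qed.

Lemma wirtinger_of_C1 (f : C -> C) (z : C) :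
  unit_disc z ->
  (forall w, unit_disc w -> ex_dx f w /\ ex_dy f w) ->
  continuous (dx f) z ->
  is_wirtinger f z (d_z f z) (d_zbar f z).
Proof.
  intros Hz Hd Hc c t l Ht [Hl1 Hl2].
  assert (K : forall h hx hy : C -> R,
    (forall w, unit_disc w -> is_derive (fun x => h (x, Im w)) (Re w) (hx w) /\
       is_derive (fun y => h (Re w, y)) (Im w) (hy w)) ->
    continuous hx z -> is_derive (fun s => h (c s)) t (hx z * Re l + hy z * Im l)).
  { intros h hx hy Dh Chx.
    apply is_derive_ext with (fun s => h (Re (c s), Im (c s))).
    { intros s. now destruct (c s). }
    destruct z as [x y]. apply (is_derive_comp_2d (fun a b => h (a, b)) x y (fun a b => hx (a, b)));
      try rewrite Ht; try assumption; try reflexivity.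
    - generalize (disc_open _ Hz). apply filter_imp. intros [a b] Hp. exact (proj1 (Dh _ Hp)).
    - exact (proj2 (Dh _ Hz)).
    - apply (continuous_ext hx); [now intros [a b]|exact Chx]. }
  split.
  1: eapply is_derive_val;
    [exact (K (fun w => Re (f w)) (fun w => Re (dx f w)) (fun w => Re (dy f w))
      (fun w Hw => conj (Derive_correct _ _ (proj1 (proj1 (Hd w Hw))))
         (Derive_correct _ _ (proj1 (proj2 (Hd w Hw))))) (continuous_Re_fun _ _ Hc))|].
  2: eapply is_derive_val;
    [exact (K (fun w => Im (f w)) (fun w => Im (dx f w)) (fun w => Im (dy f w))
      (fun w Hw => conj (Derive_correct _ _ (proj2 (proj1 (Hd w Hw))))
         (Derive_correct _ _ (proj2 (proj2 (Hd w Hw))))) (continuous_Im_fun _ _ Hc))|].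
  all: unfold d_z, d_zbar, Cconj; simpl; unfold Re, Im; simpl; field.
Qed.

(** Horizontal and vertical lines are curves, so that the derivatives of a curve-wise
    differentiable function are unique and are given by its partial derivatives. *)
Lemma wirtinger_d_z_d_zbar (f : C -> C) (z a b : C) : is_wirtinger f z a b ->
  d_z f z = a /\ d_zbar f z = b.
Proof.
  intros H. destruct z as [x y].
  assert (Hx := H (fun s => (s, y)) x (RtoC 1) eq_refl).
  assert (Hy := H (fun s => (x, s)) y Ci eq_refl).
  destruct Hx as [Hx1 Hx2].
  { split; simpl; [apply @is_derive_id|apply @is_derive_const]. }
  destruct Hy as [Hy1 Hy2].
  { split; simpl; [apply @is_derive_const|apply @is_derive_id]. }
  assert (Ex : dx f (x, y) = (a + b)%C).
  { apply injective_projections; (etransitivity; [apply is_derive_unique; eassumption|]);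
      destruct a, b; simpl; ring. }
  assert (Ey : dy f (x, y) = (Ci * (a - b))%C).
  { apply injective_projections; (etransitivity; [apply is_derive_unique; eassumption|]);
      destruct a, b; simpl; ring. }
  unfold d_z, d_zbar. rewrite Ex, Ey.
  destruct a, b; unfold Cplus, Cminus, Cmult, Copp, Cplus; simpl; split; f_equal; field.
Qed.

(** * Integrals depending on a parameter *)

Lemma ex_RInt_cont (f : R -> R) (a b : R) : (forall t, continuous f t) -> ex_RInt f a b.
Proof. intros H. apply (@ex_RInt_continuous R_CompleteNormedModule). intros; apply H. Qed.

Lemma continuous_slice {V : UniformSpace} (u : R -> R -> V) (x t : R) :
  continuous (fun p : R * R => u (fst p) (snd p)) (x, t) -> continuous (u x) t.
Proof.
  intros H. apply (continuous_comp_2 (fun _ : R => x) (fun s : R => s) u t).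
  - apply continuous_const.
  - apply continuous_id.
  - exact H.
Qed.

Lemma continuous_slice_l {V : UniformSpace} (u : R -> R -> V) (x t : R) :
  continuous (fun p : R * R => u (fst p) (snd p)) (x, t) -> continuous (fun s => u s t) x.
Proof.
  intros H. apply (continuous_comp_2 (fun s : R => s) (fun _ : R => t) u x).
  - apply continuous_id.
  - apply continuous_const.
  - exact H.
Qed.

Lemma continuous_swap {V : UniformSpace} (u : R -> R -> V) (x y : R) :
  continuous (fun p : R * R => u (snd p) (fst p)) (x, y) ->
  continuous (fun p : R * R => u (fst p) (snd p)) (y, x).
Proof.
  intros H. apply (continuous_comp (fun p : R * R => (snd p, fst p))
    (fun p : R * R => u (snd p) (fst p)) (y, x)).
  - intros P [e He]. exists e. intros q [A B]. apply He. split; assumption.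
  - exact H.
Qed.

(** The integrand is uniformly continuous on the compact set [a, b] x {x}, which bounds the
    change of the integral. *)
Lemma RInt_param_cont (u : R -> R -> R) (a b x : R) : a <= b ->
  locally x (fun y => forall t, continuous (u y) t) ->
  (forall t, continuous (fun p : R * R => u (fst p) (snd p)) (x, t)) ->
  continuous (fun y => RInt (u y) a b) x.
Proof.
  intros Hab Hl Hc.
  assert (HU := uniform_continuity_2d_1d (fun t y => u y t) a b x).
  assert (Hc' : forall t, a <= t <= b -> continuity_2d_pt (fun t y => u y t) t x).
  { intros t _. apply continuity_2d_pt_filterlim.
    apply (continuous_swap (fun t y => u y t)), Hc. }
  specialize (HU Hc').
  intros P [e He].
  assert (He2 : 0 < e / (b - a + 1)) by (apply Rdiv_lt_0_compat; [apply cond_pos|lra]).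
  destruct (HU (mkposreal _ He2)) as [d Hd].
  destruct Hl as [d' Hd'].
  assert (Hm : 0 < Rmin d d') by (apply Rmin_pos; apply cond_pos).
  exists (mkposreal _ Hm). intros y Hy. apply He.
  change (Rabs (y - x) < Rmin d d') in Hy.
  assert (Hy1 : Rabs (y - x) < d) by (eapply Rlt_le_trans; [exact Hy|apply Rmin_l]).
  assert (Hy2 : Rabs (y - x) < d') by (eapply Rlt_le_trans; [exact Hy|apply Rmin_r]).
  change (Rabs (RInt (u y) a b - RInt (u x) a b) < e).
  assert (Ey := ex_RInt_cont _ a b (Hd' y Hy2)).
  assert (Ex : ex_RInt (u x) a b).
  { apply ex_RInt_cont. intros t. apply (continuous_slice u). apply Hc. }
  replace (RInt (u y) a b - RInt (u x) a b) with (RInt (fun t => minus (u y t) (u x t)) a b)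
    by exact (RInt_minus _ _ _ _ Ey Ex).
  apply Rle_lt_trans with ((b - a) * (e / (b - a + 1))).
  - apply abs_RInt_le_const; [exact Hab|now apply @ex_RInt_minus|].
    intros t Ht. apply Rabs_def2 in Hy1.
    assert (Hp := cond_pos d).
    assert (A1 : x - d <= x <= x + d) by lra.
    assert (A2 : x - d <= y <= x + d) by lra.
    assert (A3 : Rabs (t - t) < d) by (rewrite Rminus_diag, Rabs_R0; exact Hp).
    left. exact (Hd t x t y Ht A1 Ht A2 A3).
  - replace ((b - a) * (e / (b - a + 1))) with (e * ((b - a) / (b - a + 1))) by (field; lra).
    rewrite <- (Rmult_1_r e) at 2. apply Rmult_lt_compat_l; [apply cond_pos|].
    apply Rmult_lt_reg_r with (b - a + 1); [lra|]. field_simplify; lra.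
Qed.

Lemma RInt_param_derive (u u' : R -> R -> R) (a b x : R) :
  locally x (fun y => forall t, is_derive (fun z => u z t) y (u' y t)) ->
  locally x (fun y => forall t, continuous (u y) t) ->
  (forall t, continuous (fun p : R * R => u' (fst p) (snd p)) (x, t)) ->
  is_derive (fun y => RInt (u y) a b) x (RInt (u' x) a b).
Proof.
  intros Hd Hc Hc'.
  assert (E : RInt (u' x) a b = RInt (fun t => Derive (fun z => u z t) x) a b).
  { apply RInt_ext. intros t _. symmetry. apply is_derive_unique.
    apply (locally_singleton _ _ Hd). }
  rewrite E. apply is_derive_RInt_param.
  - revert Hd. apply filter_imp. intros y Hy t _. eexists; apply Hy.
  - intros t _. apply continuity_2d_pt_ext_loc with u'.
    + destruct Hd as [d Hd]. exists d. intros y s Hy Hs. symmetry.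
      apply is_derive_unique, Hd. exact Hy.
    + apply continuity_2d_pt_filterlim, Hc'.
  - revert Hc. apply filter_imp. intros y Hy. now apply ex_RInt_cont.
Qed.

(** As functions of [b], both sides vanish at [a] and have the same derivative. *)
Lemma RInt_fubini (f : R -> R -> R) (a b c d : R) : a <= b -> c <= d ->
  (forall x y, continuous (fun p : R * R => f (fst p) (snd p)) (x, y)) ->
  RInt (fun x => RInt (fun y => f x y) c d) a b =
  RInt (fun y => RInt (fun x => f x y) a b) c d.
Proof.
  intros Hab Hcd Hf.
  destruct (Req_dec a b) as [->|Hne].
  { rewrite RInt_point. rewrite (RInt_ext _ (fun _ => 0)).
    - rewrite RInt_const. unfold zero; simpl. unfold scal; simpl; unfold mult; simpl. ring.
    - intros y _. exact (RInt_point b (fun x => f x y)). }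
  assert (C1 : forall x, continuous (fun x => RInt (fun y => f x y) c d) x).
  { intros x. apply RInt_param_cont; [exact Hcd| |].
    - apply filter_forall. intros y t. apply (continuous_slice f), Hf.
    - intros t. apply Hf. }
  assert (C2 : forall y x, continuous (fun s => f s y) x).
  { intros y x. apply (continuous_slice_l f), Hf. }
  set (G := fun x => RInt (fun x => RInt (fun y => f x y) c d) a x
                     - RInt (fun y => RInt (fun x => f x y) a x) c d).
  assert (H : G a = G b).
  { apply (eq_is_derive G a b); [|lra]. intros x _.
    unfold G. eapply is_derive_val.
    - apply @is_derive_minus.
      + apply (is_derive_RInt (fun x => RInt (fun y => f x y) c d)) with (a := a).
        * apply filter_forall. intros z. apply (@RInt_correct R_CompleteNormedModule).
          apply ex_RInt_cont, C1.
        * apply C1.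
      + apply (RInt_param_derive (fun x y => RInt (fun s => f s y) a x) f).
        * apply filter_forall. intros z t.
          apply (is_derive_RInt (fun s => f s t)) with (a := a).
          -- apply filter_forall. intros w. apply (@RInt_correct R_CompleteNormedModule).
             apply ex_RInt_cont, C2.
          -- apply C2.
        * apply filter_forall. intros z t.
          destruct (Rle_dec a z) as [Hz|Hz].
          -- apply (RInt_param_cont (fun y s => f s y)); [exact Hz| |].
             ++ apply filter_forall. intros y s; apply C2.
             ++ intros s. apply (continuous_swap (fun y s => f s y)), Hf.
          -- apply continuous_ext with (fun y => - RInt (fun s => f s y) z a).
             { intros y. apply (@opp_RInt_swap R_CompleteNormedModule). apply ex_RInt_cont, C2. }
             apply continuous_Ropp_fun.
             apply (RInt_param_cont (fun y s => f s y)); [lra| |].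
             ++ apply filter_forall. intros y s; apply C2.
             ++ intros s. apply (continuous_swap (fun y s => f s y)), Hf.
        * intros t. apply Hf.
    - unfold minus, plus, opp, zero; simpl. apply Rplus_opp_r. }
  unfold G in H. rewrite RInt_point in H.
  rewrite (RInt_ext (fun y => RInt (fun x => f x y) a a) (fun _ => 0)) in H
    by (intros y _; exact (RInt_point a (fun x => f x y))).
  rewrite RInt_const in H. unfold zero, scal in H; simpl in H; unfold mult in H; simpl in H.
  rewrite Rmult_0_r in H. lra.
Qed.

Lemma CInt_ext (u v : R -> C) (a b : R) :
  (forall t, u t = v t) -> CInt u a b = CInt v a b.
Proof.
  intros H. unfold CInt. f_equal; apply RInt_ext; intros t _; now rewrite H.
Qed.

Lemma CInt_plus (u v : R -> C) (a b : R) :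
  (forall t, continuous u t) -> (forall t, continuous v t) ->
  CInt (fun t => u t + v t)%C a b = (CInt u a b + CInt v a b)%C.
Proof.
  intros Hu Hv. unfold CInt, Cplus; simpl. f_equal.
  - apply (@RInt_plus R_CompleteNormedModule); apply ex_RInt_cont; intros;
      apply continuous_Re_fun; auto.
  - apply (@RInt_plus R_CompleteNormedModule); apply ex_RInt_cont; intros;
      apply continuous_Im_fun; auto.
Qed.

Lemma CInt_cmul (k : C) (u : R -> C) (a b : R) :
  (forall t, continuous u t) ->
  CInt (fun t => k * u t)%C a b = (k * CInt u a b)%C.
Proof.
  intros Hu.
  assert (E1 : ex_RInt (fun t => Re (u t)) a b)
    by (apply ex_RInt_cont; intros; apply continuous_Re_fun; auto).
  assert (E2 : ex_RInt (fun t => Im (u t)) a b)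
    by (apply ex_RInt_cont; intros; apply continuous_Im_fun; auto).
  unfold CInt, Cmult; simpl. f_equal; apply (@is_RInt_unique R_CompleteNormedModule).
  - apply (@is_RInt_minus R_CompleteNormedModule); apply (@is_RInt_scal R_CompleteNormedModule);
      now apply (@RInt_correct R_CompleteNormedModule).
  - apply (@is_RInt_plus R_CompleteNormedModule); apply (@is_RInt_scal R_CompleteNormedModule);
      now apply (@RInt_correct R_CompleteNormedModule).
Qed.

Lemma CInt_minus (u v : R -> C) (a b : R) :
  (forall t, continuous u t) -> (forall t, continuous v t) ->
  CInt (fun t => u t - v t)%C a b = (CInt u a b - CInt v a b)%C.
Proof.
  intros Hu Hv.
  rewrite (CInt_ext _ (fun t => u t + (RtoC (-1)) * v t)%C) by (intros; ring).
  rewrite CInt_plus, CInt_cmul; auto; [ring|].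
  intros t. apply continuous_Cmult_fun; [apply continuous_const|auto].
Qed.

Lemma CInt_const (k : C) (a b : R) : CInt (fun _ => k) a b = (RtoC (b - a) * k)%C.
Proof.
  unfold CInt. rewrite !RInt_const. destruct k. unfold Cmult, RtoC, scal; simpl.
  unfold mult; simpl. f_equal; ring.
Qed.

(** The choice of [c] that turns [z] into |z| reduces bounds for complex integrals and
    increments to bounds for real ones. *)
Lemma Cmod_le_rot (z : C) (M : R) :
  (forall c : C, Cmod c = 1 -> Re (c * z)%C <= M) -> Cmod z <= M.
Proof.
  intros H. destruct (Req_dec (Cmod z) 0) as [E|E].
  - rewrite E. apply Cmod_eq_0 in E. subst z. specialize (H (RtoC 1) Cmod_1).
    simpl in H. lra.
  - assert (Hz : z <> 0%C) by (intros Z; apply E; rewrite Z; apply Cmod_0).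
    assert (Hp : 0 < Cmod z) by now apply Cmod_gt_0.
    specialize (H (RtoC (/ Cmod z) * Cconj z)%C).
    rewrite Cmod_mult, Cmod_conj, Cmod_R, Rabs_pos_eq in H
      by (left; now apply Rinv_0_lt_compat).
    rewrite Rinv_l in H by exact E. specialize (H eq_refl).
    replace (RtoC (/ Cmod z) * Cconj z * z)%C with (RtoC (Cmod z)) in H; [exact H|].
    transitivity (RtoC (/ Cmod z) * (z * Cconj z))%C; [|ring].
    rewrite <- Cmod2_conj, <- RtoC_mult. f_equal. field. exact E.
Qed.

Lemma Cmod_CInt_le (u : R -> C) (g : R -> R) (a b : R) : a <= b ->
  (forall t, continuous u t) -> ex_RInt g a b ->
  (forall t, a <= t <= b -> Cmod (u t) <= g t) -> Cmod (CInt u a b) <= RInt g a b.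
Proof.
  intros Hab Hu Hg H. apply Cmod_le_rot. intros c Hc.
  rewrite <- CInt_cmul by exact Hu. unfold CInt; simpl.
  assert (Hcu : forall t, continuous (fun t => c * u t)%C t).
  { intros t; apply continuous_Cmult_fun; [apply continuous_const|apply Hu]. }
  apply RInt_le; [exact Hab| |exact Hg|].
  - apply ex_RInt_cont. intros t. apply (continuous_Re_fun _ _ (Hcu t)).
  - intros t Ht. apply Rle_trans with (Cmod (c * u t)%C).
    + exact (Rle_trans _ _ _ (Rle_abs _) (re_le_Cmod (c * u t)%C)).
    + rewrite Cmod_mult, Hc, Rmult_1_l. apply H; lra.
Qed.

Lemma CInt_derive (F u : R -> C) (a b : R) :
  (forall t, is_Cderive F t (u t)) -> (forall t, continuous u t) ->
  CInt u a b = (F b - F a)%C.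
Proof.
  intros HF Hu. unfold CInt. apply injective_projections; simpl;
    apply (@is_RInt_unique R_CompleteNormedModule).
  - apply (is_RInt_derive (fun t => Re (F t))); intros t _; [apply HF|].
    apply (continuous_Re_fun _ _ (Hu t)).
  - apply (is_RInt_derive (fun t => Im (F t))); intros t _; [apply HF|].
    apply (continuous_Im_fun _ _ (Hu t)).
Qed.

Lemma CInt_param_cont (u : R -> R -> C) (a b x : R) : a <= b ->
  locally x (fun y => forall t, continuous (u y) t) ->
  (forall t, continuous (fun p : R * R => u (fst p) (snd p)) (x, t)) ->
  continuous (fun y => CInt (u y) a b) x.
Proof.
  intros Hab Hl Hc. apply continuous_pairC.
  - apply (RInt_param_cont (fun y t => Re (u y t))); [exact Hab| |].
    + revert Hl; apply filter_imp. intros y Hy t. apply continuous_Re_fun, Hy.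
    + intros t. apply (continuous_Re_fun _ _ (Hc t)).
  - apply (RInt_param_cont (fun y t => Im (u y t))); [exact Hab| |].
    + revert Hl; apply filter_imp. intros y Hy t. apply continuous_Im_fun, Hy.
    + intros t. apply (continuous_Im_fun _ _ (Hc t)).
Qed.

Lemma CInt_param_derive (u u' : R -> R -> C) (a b x : R) :
  locally x (fun y => forall t, is_Cderive (fun z => u z t) y (u' y t)) ->
  locally x (fun y => forall t, continuous (u y) t) ->
  (forall t, continuous (fun p : R * R => u' (fst p) (snd p)) (x, t)) ->
  is_Cderive (fun y => CInt (u y) a b) x (CInt (u' x) a b).
Proof.
  intros Hd Hc Hc'. split.
  - apply (RInt_param_derive (fun y t => Re (u y t)) (fun y t => Re (u' y t))).
    + revert Hd; apply filter_imp. intros y Hy t; apply Hy.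
    + revert Hc; apply filter_imp. intros y Hy t. apply continuous_Re_fun, Hy.
    + intros t. apply (continuous_Re_fun _ _ (Hc' t)).
  - apply (RInt_param_derive (fun y t => Im (u y t)) (fun y t => Im (u' y t))).
    + revert Hd; apply filter_imp. intros y Hy t; apply Hy.
    + revert Hc; apply filter_imp. intros y Hy t. apply continuous_Im_fun, Hy.
    + intros t. apply (continuous_Im_fun _ _ (Hc' t)).
Qed.

Lemma CInt_fubini (f : R -> R -> C) (a b c d : R) : a <= b -> c <= d ->
  (forall x y, continuous (fun p : R * R => f (fst p) (snd p)) (x, y)) ->
  CInt (fun x => CInt (fun y => f x y) c d) a b =
  CInt (fun y => CInt (fun x => f x y) a b) c d.
Proof.
  intros Hab Hcd Hf. unfold CInt; simpl. f_equal.
  - apply (RInt_fubini (fun x y => Re (f x y))); auto.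
    intros x y. apply (continuous_Re_fun _ _ (Hf x y)).
  - apply (RInt_fubini (fun x y => Im (f x y))); auto.
    intros x y. apply (continuous_Im_fun _ _ (Hf x y)).
Qed.

Lemma RInt_periodic_shift (u : R -> R) (s : R) :
  (forall t, continuous u t) -> (forall t, u (t + 2 * PI) = u t) ->
  RInt (fun t => u (t + s)) 0 (2 * PI) = RInt u 0 (2 * PI).
Proof.
  intros Hu Hp.
  assert (E : forall a b, ex_RInt u a b) by (intros; now apply ex_RInt_cont).
  assert (L : forall v a b, RInt (fun t => u (t + v)) a b = RInt u (a + v) (b + v)).
  { intros v a b. generalize (RInt_comp_lin u 1 v a b (E _ _)).
    rewrite !Rmult_1_l. intros <-. apply RInt_ext. intros t _.
    unfold scal; simpl; unfold mult; simpl. rewrite !Rmult_1_l. reflexivity. }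
  rewrite L, Rplus_0_l.
  assert (A := RInt_Chasles u s 0 (2 * PI + s) (E _ _) (E _ _)).
  assert (B := RInt_Chasles u 0 (2 * PI) (2 * PI + s) (E _ _) (E _ _)).
  assert (D : RInt u (2 * PI) (2 * PI + s) = RInt u 0 s).
  { transitivity (RInt (fun t => u (t + 2 * PI)) 0 s).
    - rewrite L. f_equal; ring.
    - apply RInt_ext; intros; apply Hp. }
  assert (F := opp_RInt_swap u s 0 (E _ _)).
  unfold plus, opp in *; simpl in *. lra.
Qed.

Lemma CInt_periodic_shift (u : R -> C) (s : R) :
  (forall t, continuous u t) -> (forall t, u (t + 2 * PI) = u t) ->
  CInt (fun t => u (t + s)) 0 (2 * PI) = CInt u 0 (2 * PI).
Proof.
  intros Hu Hp. unfold CInt. f_equal.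
  - apply (RInt_periodic_shift (fun t => Re (u t))).
    + intros; now apply continuous_Re_fun.
    + intros; now rewrite Hp.
  - apply (RInt_periodic_shift (fun t => Im (u t))).
    + intros; now apply continuous_Im_fun.
    + intros; now rewrite Hp.
Qed.

(** By [Cmod_le_rot] it is enough to compare real parts, and Y - Re (c X) has a nonnegative
    derivative. *)
Lemma Cmod_increment_le (X dX : R -> C) (Y dY : R -> R) (a b : R) : a <= b ->
  (forall t, a < t < b -> is_Cderive X t (dX t)) ->
  (forall t, a <= t <= b -> continuous X t) ->
  (forall t, a < t < b -> is_derive Y t (dY t)) ->
  (forall t, a <= t <= b -> continuous Y t) ->
  (forall t, a < t < b -> Cmod (dX t) <= dY t) ->
  Cmod (X b - X a)%C <= Y b - Y a.
Proof.
  intros Hab HX CX HY CY Hdom. apply Cmod_le_rot. intros c Hc.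
  destruct (Req_dec a b) as [->|Hne].
  { replace (c * (X b - X b))%C with (RtoC 0) by ring. simpl; lra. }
  assert (Hlt : a < b) by lra.
  set (f := fun t => Y t - Re (c * X t)%C).
  assert (HcX : forall t, a < t < b -> is_derive (fun s => Re (c * X s)%C) t (Re (c * dX t)%C)).
  { intros t Ht. destruct (is_Cderive_mult _ _ _ _ _ (is_Cderive_const c t) (HX t Ht)) as [H1 _].
    eapply is_derive_val; [exact H1|]. simpl. unfold Re, Im. ring. }
  assert (Hm : f a <= f b).
  (* The intermediate point given by [MVT_gen] may be an end point, where nothing is known about
     the derivatives; the value 0 there is harmless. *)
  { destruct (MVT_gen f a b (fun t => if Rlt_dec a t then if Rlt_dec t b then dY t - Re (c * dX
    t)%C else 0 else 0)) as [t [Ht E]].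
    - rewrite Rmin_left, Rmax_right by lra. intros t Ht.
      destruct (Rlt_dec a t); [|lra]. destruct (Rlt_dec t b); [|lra].
      apply @is_derive_minus; [now apply HY|now apply HcX].
    - rewrite Rmin_left, Rmax_right by lra. intros t Ht.
      apply continuity_pt_filterlim. apply continuous_Rplus_fun; [now apply CY|].
      apply continuous_Ropp_fun. apply continuous_Re_fun, continuous_Cmult_fun;
        [apply continuous_const|now apply CX].
    - assert (0 <= (if Rlt_dec a t then if Rlt_dec t b then dY t - Re (c * dX t)%C else 0 else 0)).
      { destruct (Rlt_dec a t); [|lra]. destruct (Rlt_dec t b); [|lra].
        assert (H1 := Hdom t (conj r r0)).
        assert (H2 : Re (c * dX t)%C <= Cmod (dX t)).
        { rewrite <- (Rmult_1_l (Cmod (dX t))), <- Hc, <- Cmod_mult.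
          eapply Rle_trans; [apply Rle_abs|apply re_le_Cmod]. }
        lra. }
      nra. }
  unfold f in Hm. replace (c * (X b - X a))%C with (c * X b - c * X a)%C by ring.
  simpl in *. lra.
Qed.

(** * Means over circles *)

Definition polar (rho t : R) : C := (RtoC rho * cis t)%C.

Definition circle_mean (F : C -> C) (rho : R) : C :=
  CInt (fun t => F (polar rho t)) 0 (2 * PI).

Lemma Cmod_polar (rho t : R) : Cmod (polar rho t) = Rabs rho.
Proof. unfold polar. rewrite Cmod_mult, Cmod_cis, Cmod_R. ring. Qed.

Lemma cis_2PI (t : R) : cis (t + 2 * PI) = cis t.
Proof. unfold cis. rewrite cos_plus, sin_plus, cos_2PI, sin_2PI. f_equal; ring. Qed.

Lemma polar_continuous_2d (x t : R) :
  continuous (fun p : R * R => polar (fst p) (snd p)) (x, t).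
Proof. unfold polar. cts. Qed.

Lemma polar_continuous (rho t : R) : continuous (polar rho) t.
Proof. unfold polar. cts. Qed.

Lemma polar_derive_radius (rho t : R) : is_Cderive (fun x => polar x t) rho (cis t).
Proof.
  unfold polar. eapply is_Cderive_val.
  - apply is_Cderive_mult; [apply is_Cderive_RtoC, @is_derive_id|apply is_Cderive_const].
  - unfold one; simpl. ring.
Qed.

Lemma polar_derive_angle (rho t : R) : is_Cderive (polar rho) t (Ci * polar rho t)%C.
Proof.
  unfold polar. eapply is_Cderive_val.
  - apply is_Cderive_mult; [apply is_Cderive_const|apply is_Cderive_cis].
  - cbv beta. ring.
Qed.

Lemma Rabs_lt1_locally (rho : R) : Rabs rho < 1 -> locally rho (fun y => Rabs y < 1).
Proof.
  intros H.
  apply (continuous_Rabs rho (fun r => r < 1)). apply (open_lt 1). exact H.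
Qed.

Lemma polar_disc (rho t : R) : Rabs rho < 1 -> unit_disc (polar rho t).
Proof. intros H. unfold unit_disc. now rewrite Cmod_polar. Qed.

#[export] Hint Resolve polar_continuous polar_continuous_2d polar_disc : cts.

Lemma twoPI_pos : 0 <= 2 * PI.
Proof. generalize PI_RGT_0; lra. Qed.

Section CircleMean.
Variables F a b : C -> C.
Hypothesis HF : forall z, unit_disc z -> is_wirtinger F z (a z) (b z).
Hypothesis CF : forall z, unit_disc z -> continuous F z.
Hypothesis Ca : forall z, unit_disc z -> continuous a z.
Hypothesis Cb : forall z, unit_disc z -> continuous b z.

Definition circle_mean_deriv (rho : R) : C :=
  CInt (fun t => a (polar rho t) * cis t + b (polar rho t) * Cconj (cis t))%C 0 (2 * PI).

Lemma circle_mean_derive (rho : R) : Rabs rho < 1 -> is_Cderive (circle_mean F) rho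
  (circle_mean_deriv rho).
Proof.
  intros Hr.
  apply (CInt_param_derive (fun x t => F (polar x t))
    (fun x t => a (polar x t) * cis t + b (polar x t) * Cconj (cis t))%C).
  - generalize (Rabs_lt1_locally _ Hr). apply filter_imp. intros y Hy t.
    exact (HF (polar y t) (polar_disc y t Hy) (fun x => polar x t) y (cis t) eq_refl
      (polar_derive_radius y t)).
  - generalize (Rabs_lt1_locally _ Hr). apply filter_imp. intros y Hy t.
    apply (continuous_comp (polar y) F); auto with cts.
  - intros t. cts.
Qed.

Lemma circle_terms_cont (rho : R) : Rabs rho < 1 ->
  (forall t, continuous (fun t => polar rho t * a (polar rho t))%C t) /\
  (forall t, continuous (fun t => Cconj (polar rho t) * b (polar rho t))%C t).
Proof. intros Hr. split; intros t; cts. Qed.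

(** The derivative of F (rho e^{it}) in t is i (z F_z - conj z F_zbar), and the mean of the
    derivative of a periodic function vanishes. *)
Lemma circle_mean_tangential (rho : R) : Rabs rho < 1 ->
  CInt (fun t => polar rho t * a (polar rho t))%C 0 (2 * PI) =
  CInt (fun t => Cconj (polar rho t) * b (polar rho t))%C 0 (2 * PI).
Proof.
  intros Hr. destruct (circle_terms_cont rho Hr) as [C1 C2].
  assert (E : CInt (fun t => polar rho t * a (polar rho t) - Cconj (polar rho t) * b (polar rho
    t))%C
      0 (2 * PI) = RtoC 0).
  { rewrite (CInt_derive (fun t => (- Ci) * F (polar rho t))%C).
    - assert (Ep : polar rho (2 * PI) = polar rho 0).
      { unfold polar. f_equal. rewrite <- (Rplus_0_l (2 * PI)). apply cis_2PI. }
      rewrite Ep. ring.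
    - intros t. eapply is_Cderive_val.
      + apply is_Cderive_mult; [apply is_Cderive_const|].
        apply (HF (polar rho t) (polar_disc rho t Hr) (polar rho) t _ eq_refl (polar_derive_angle
          rho t)).
      + rewrite Cmult_conj.
        replace (Cconj Ci) with (- Ci)%C
          by (unfold Cconj, Ci, Copp; simpl; f_equal; ring).
        transitivity (- (Ci * Ci) * (polar rho t * a (polar rho t) - Cconj (polar rho t) * b
          (polar rho t)))%C;
          [ring|].
        replace (Ci * Ci)%C with (RtoC (-1)); [ring|].
        unfold Ci, Cmult, RtoC; simpl; f_equal; ring.
    - intros t. apply continuous_Cplus_fun; [apply C1|apply continuous_Copp_fun, C2]. }
  rewrite CInt_minus in E by assumption.
  rewrite <- (Cplus_0_r (CInt (fun t => Cconj _ * _)%C _ _)), <- E. ring.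
Qed.

(** The derivative in the radius involves the sum of the two means of [circle_mean_tangential].
    As they are equal, either of the two Wirtinger derivatives alone determines the derivative
    of the mean. *)
Lemma circle_mean_derive_zbar (rho : R) : Rabs rho < 1 ->
  (RtoC rho * circle_mean_deriv rho)%C =
  CInt (fun t => RtoC 2 * (Cconj (polar rho t) * b (polar rho t)))%C 0 (2 * PI).
Proof.
  intros Hr. destruct (circle_terms_cont rho Hr) as [C1 C2].
  rewrite CInt_cmul by exact C2.
  transitivity (CInt (fun t => polar rho t * a (polar rho t) + Cconj (polar rho t) * b (polar rho
    t))%C
    0 (2 * PI)).
  - unfold circle_mean_deriv. rewrite <- CInt_cmul by (intros t; cts).
    apply CInt_ext. intros t. unfold polar. rewrite Cmult_conj.
    replace (Cconj (RtoC rho)) with (RtoC rho)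
      by (unfold Cconj, RtoC; simpl; f_equal; ring).
    ring.
  - rewrite CInt_plus by assumption. rewrite circle_mean_tangential by exact Hr.
    replace (RtoC 2) with (RtoC 1 + RtoC 1)%C
      by (unfold RtoC, Cplus; simpl; f_equal; ring).
    ring.
Qed.

Lemma circle_mean_derive_z (rho : R) : Rabs rho < 1 ->
  (RtoC rho * circle_mean_deriv rho)%C =
  CInt (fun t => RtoC 2 * (polar rho t * a (polar rho t)))%C 0 (2 * PI).
Proof.
  intros Hr. destruct (circle_terms_cont rho Hr) as [C1 C2].
  rewrite circle_mean_derive_zbar, !CInt_cmul, circle_mean_tangential by assumption. reflexivity.
Qed.

Lemma circle_mean_0 : circle_mean F 0 = (RtoC (2 * PI) * F (RtoC 0))%C.
Proof.
  unfold circle_mean. rewrite (CInt_ext _ (fun _ => F (RtoC 0))).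
  - rewrite CInt_const. f_equal. f_equal. ring.
  - intros t. unfold polar. now rewrite Cmult_0_l.
Qed.
End CircleMean.

(** * Automorphisms of the disc *)

Definition mobius_den (r : R) (z : C) : C := (RtoC 1 + RtoC r * z)%C.
Definition mobius (r : R) (z : C) : C := ((z + RtoC r) / mobius_den r z)%C.
Definition mobius_deriv (r : R) (z : C) : C := (RtoC (1 - r ^ 2) / (mobius_den r z * mobius_den r
  z))%C.

Lemma mobius_den_Re (r : R) (z : C) : 0 <= r < 1 -> Cmod z <= 1 ->
  1 - r * Cmod z <= Re (mobius_den r z).
Proof.
  intros Hr Hz. assert (H := re_le_Cmod z). apply Rabs_le_between in H.
  unfold mobius_den; simpl. unfold Re in *. destruct z as [x y]; simpl in *.
  set (m := Cmod (x, y)) in *. nra.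
Qed.

Lemma mobius_den_pos (r : R) (z : C) : 0 <= r < 1 -> Cmod z <= 1 -> 0 < Re (mobius_den r z).
Proof.
  intros Hr Hz. generalize (mobius_den_Re r z Hr Hz) (Cmod_ge_0 z). nra.
Qed.

Lemma Re_pos_neq_0 (w : C) : 0 < Re w -> w <> 0%C.
Proof. intros H E. rewrite E in H. simpl in H. lra. Qed.

(** This is |1 + r z|^2 - |z + r|^2 = (1 - r^2) (1 - |z|^2). *)
Lemma mobius_pseudo_distance (r : R) (z : C) : 0 <= r < 1 -> Cmod z <= 1 ->
  1 - Cmod (mobius r z) ^ 2 = (1 - r ^ 2) * (1 - Cmod z ^ 2) / Cmod (mobius_den r z) ^ 2.
Proof.
  intros Hr Hz. assert (Hp := mobius_den_pos r z Hr Hz).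
  assert (Hn := Re_pos_neq_0 _ Hp). assert (Hm := proj1 (Cmod_gt_0 _) Hn).
  unfold mobius. rewrite Cmod_div by exact Hn.
  assert (E : Cmod (mobius_den r z) ^ 2 - Cmod (z + RtoC r)%C ^ 2 = (1 - r ^ 2) * (1 - Cmod z ^ 2)).
  { rewrite !Cmod2_alt. unfold mobius_den; simpl. unfold Re, Im; simpl. destruct z; simpl. ring. }
  rewrite <- E. field. lra.
Qed.

Lemma mobius_disc (r : R) (z : C) : 0 <= r < 1 -> unit_disc z -> unit_disc (mobius r z).
Proof.
  intros Hr Hz. unfold unit_disc in *.
  assert (H := mobius_pseudo_distance r z Hr (Rlt_le _ _ Hz)).
  assert (Hp := mobius_den_pos r z Hr (Rlt_le _ _ Hz)).
  assert (Hm := proj1 (Cmod_gt_0 _) (Re_pos_neq_0 _ Hp)).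
  assert (0 < (1 - r ^ 2) * (1 - Cmod z ^ 2) / Cmod (mobius_den r z) ^ 2).
  { generalize (Cmod_ge_0 z). intros. apply Rdiv_lt_0_compat; [|nra].
    apply Rmult_lt_0_compat; nra. }
  generalize (Cmod_ge_0 (mobius r z)). nra.
Qed.

Lemma mobius_den_wirtinger (r : R) (z : C) : is_wirtinger (mobius_den r) z (RtoC r) (RtoC 0).
Proof.
  unfold mobius_den. eapply wirtinger_val.
  - apply wirtinger_plus; [apply wirtinger_const|apply wirtinger_mult;
    [apply wirtinger_const|apply wirtinger_id]].
  - cbv beta; ring.
  - cbv beta; ring.
Qed.

Lemma mobius_wirtinger (r : R) (z : C) : mobius_den r z <> 0%C ->
  is_wirtinger (mobius r) z (mobius_deriv r z) (RtoC 0).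
Proof.
  intros Hz. unfold mobius, Cdiv. eapply wirtinger_val.
  - apply wirtinger_mult; [apply wirtinger_plus; [apply wirtinger_id|apply wirtinger_const]|].
    apply wirtinger_inv; [apply mobius_den_wirtinger|exact Hz].
  - cbv beta; unfold mobius_deriv, mobius_den in *. rewrite RtoC_minus, RtoC_pow. field. exact Hz.
  - cbv beta; field. exact Hz.
Qed.

Lemma mobius_den_cont (r : R) (z : C) : continuous (mobius_den r) z.
Proof. unfold mobius_den. cts. Qed.

#[export] Hint Resolve mobius_den_cont : cts.

Lemma mobius_cont (r : R) (z : C) : mobius_den r z <> 0%C -> continuous (mobius r) z.
Proof. intros Hz. unfold mobius. cts. Qed.

Lemma mobius_deriv_cont (r : R) (z : C) : mobius_den r z <> 0%C -> continuous (mobius_deriv r) z.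
Proof. intros Hz. unfold mobius_deriv. cts. now apply Cmult_neq_0. Qed.

Lemma mobius_deriv_wirtinger (r : R) (z : C) : mobius_den r z <> 0%C ->
  is_wirtinger (mobius_deriv r) z (RtoC (-2) * RtoC r * mobius_deriv r z / mobius_den r z)%C (RtoC
    0).
Proof.
  intros Hz. unfold mobius_deriv, Cdiv. eapply wirtinger_val.
  - apply wirtinger_mult; [apply wirtinger_const|]. apply wirtinger_inv.
    + apply wirtinger_mult; apply mobius_den_wirtinger.
    + now apply Cmult_neq_0.
  - replace (RtoC (-2)) with (- (RtoC 1 + RtoC 1))%C
      by (unfold RtoC, Cplus, Copp; simpl; f_equal; ring).
    cbv beta; field. exact Hz.
  - cbv beta; field. exact Hz.
Qed.

(** * Pulling back by a disc automorphism: the interior estimate *)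

Lemma Cconj_RtoC (x : R) : Cconj (RtoC x) = RtoC x.
Proof. unfold Cconj, RtoC; simpl; f_equal; ring. Qed.

Lemma Rpower_div_distr (x y a : R) : 0 < x -> 0 < y ->
  Rpower (x / y) a = Rpower x a / Rpower y a.
Proof.
  intros Hx Hy. unfold Rpower. rewrite ln_div by assumption.
  replace (a * (ln x - ln y)) with (a * ln x + - (a * ln y)) by ring.
  now rewrite exp_plus, exp_Ropp.
Qed.

Lemma Cmod2_mobius_deriv (r : R) (z : C) : mobius_den r z <> 0%C ->
  (mobius_deriv r z * Cconj (mobius_deriv r z))%C = RtoC (((1 - r ^ 2) / Cmod (mobius_den r z) ^
    2) ^ 2).
Proof.
  intros H. rewrite <- Cmod2_conj. f_equal. unfold mobius_deriv.
  rewrite Cmod_div by now apply Cmult_neq_0.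
  rewrite Cmod_mult, Cmod_R. unfold Rdiv. rewrite !Rpow_mult_distr, pow2_abs.
  f_equal. now replace (Cmod (mobius_den r z) ^ 2) with (Cmod (mobius_den r z) * Cmod (mobius_den
    r z)) by ring.
Qed.

(** Suppose that f_zbar = (1 - |z|^2)^alpha H and H_z = g. Put Z = eta mobius r z and k = (1 + r
    z)^alpha. The pull-back F = k f(Z) satisfies conj z F_zbar = ((1 - r^2) (1 - |z|^2))^alpha P
    with P = conj kap H(Z) and kap = z Z' / k. Since kap is holomorphic, the z-derivative of P
    contains g but no derivative of f. Integrating in the radius twice, first for P and then for
    F, bounds the variation of the mean of F by g. No integral has to be computed: for alpha = 0
    and f = |z|^2 the functions playing the parts of F and P are m0 = |mobius r|^2 and q0, for
    which g = 1, and all densities are compared with theirs. *)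
Section Interior.
Variables (alpha r G : R) (eta : C) (f fz fzb H g Hb : C -> C).
Hypothesis Ha : 0 <= alpha.
Hypothesis Hr : 0 <= r < 1.
Hypothesis Heta : Cmod eta = 1.
Hypothesis HG : 0 <= G.
Hypothesis Wf : forall z, unit_disc z -> is_wirtinger f z (fz z) (fzb z).
Hypothesis EH : forall z, unit_disc z ->
  H z = (RtoC (Rpower (1 - Cmod z ^ 2) (- alpha)) * fzb z)%C.
Hypothesis WH : forall z, unit_disc z -> is_wirtinger H z (g z) (Hb z).
Hypothesis Cf : forall z, unit_disc z -> continuous f z.
Hypothesis Cfz : forall z, unit_disc z -> continuous fz z.
Hypothesis Cfzb : forall z, unit_disc z -> continuous fzb z.
Hypothesis CH : forall z, unit_disc z -> continuous H z.
Hypothesis Cg : forall z, unit_disc z -> continuous g z.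
Hypothesis CHb : forall z, unit_disc z -> continuous Hb z.
Hypothesis Bg : forall z, unit_disc z -> Cmod (g z) <= G.

Let Z (z : C) : C := (eta * mobius r z)%C.
Let Z' (z : C) : C := (eta * mobius_deriv r z)%C.
Let k (z : C) : C := Cpow_rhp alpha (mobius_den r z).
Let kap (z : C) : C := (z * Z' z / k z)%C.

Definition pullback (z : C) : C := (Cpow_rhp alpha (mobius_den r z) * f (eta * mobius r z))%C.

Let Fa (z : C) : C := (RtoC alpha * k z / mobius_den r z * RtoC r * f (Z z) + k z * (fz (Z z) * Z'
  z))%C.
Let Fb (z : C) : C := (k z * (fzb (Z z) * Cconj (Z' z)))%C.
Let P (z : C) : C := (Cconj (kap z) * H (Z z))%C.
Let kap' (z : C) : C :=
  ((Z' z + z * (eta * (RtoC (-2) * RtoC r * mobius_deriv r z / mobius_den r z))) / k z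
   - z * Z' z * (RtoC alpha * k z / mobius_den r z * RtoC r) / (k z * k z))%C.
Let Pa (z : C) : C := (Cconj (kap z) * (g (Z z) * Z' z))%C.
Let Pb (z : C) : C := (Cconj (kap' z) * H (Z z) + Cconj (kap z) * (Hb (Z z) * Cconj (Z' z)))%C.

Lemma mobius_den_disc (z : C) : unit_disc z -> 0 < Re (mobius_den r z).
Proof. intros Hz. apply mobius_den_pos; [exact Hr|left; exact Hz]. Qed.

Lemma mobius_den_nz (z : C) : unit_disc z -> mobius_den r z <> 0%C.
Proof. intros Hz. now apply Re_pos_neq_0, mobius_den_disc. Qed.

Lemma k_nz (z : C) : unit_disc z -> k z <> 0%C.
Proof. intros Hz. now apply Cpow_rhp_neq_0, mobius_den_disc. Qed.

Lemma Z_disc (z : C) : unit_disc z -> unit_disc (Z z).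
Proof.
  intros Hz. unfold unit_disc, Z. rewrite Cmod_mult, Heta, Rmult_1_l. now apply mobius_disc.
Qed.

Lemma Z_wirtinger (z : C) : unit_disc z -> is_wirtinger Z z (Z' z) (RtoC 0).
Proof.
  intros Hz. unfold Z. eapply wirtinger_val.
  - apply wirtinger_mult; [apply wirtinger_const|apply mobius_wirtinger; now apply mobius_den_nz].
  - unfold Z'. ring.
  - ring.
Qed.

Lemma k_wirtinger (z : C) : unit_disc z ->
  is_wirtinger k z (RtoC alpha * k z / mobius_den r z * RtoC r)%C (RtoC 0).
Proof.
  intros Hz. unfold k. eapply wirtinger_val.
  - apply wirtinger_comp_hol with (F := Cpow_rhp alpha); [apply mobius_den_wirtinger|].
    apply Cpow_rhp_wirtinger. now apply mobius_den_disc.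
  - reflexivity.
  - ring.
Qed.

Lemma kap_wirtinger (z : C) : unit_disc z -> is_wirtinger kap z (kap' z) (RtoC 0).
Proof.
  intros Hz. assert (Hk := k_nz _ Hz). assert (Hm := mobius_den_nz _ Hz).
  unfold kap, Cdiv. eapply wirtinger_val.
  - apply wirtinger_mult.
    + apply wirtinger_mult; [apply wirtinger_id|].
      unfold Z'. apply wirtinger_mult; [apply wirtinger_const|now apply mobius_deriv_wirtinger].
    + apply wirtinger_inv; [now apply k_wirtinger|exact Hk].
  - unfold kap', Z'. cbv beta. field. split; [exact Hm|exact Hk].
  - cbv beta. field. exact Hk.
Qed.

Lemma Z_cont (z : C) : unit_disc z -> continuous Z z.
Proof. intros Hz. unfold Z. cts. apply mobius_cont. now apply mobius_den_nz. Qed.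

Lemma Z'_cont (z : C) : unit_disc z -> continuous Z' z.
Proof. intros Hz. unfold Z'. cts. apply mobius_deriv_cont. now apply mobius_den_nz. Qed.

Lemma mobius_cont_disc (z : C) : unit_disc z -> continuous (mobius r) z.
Proof. intros Hz. apply mobius_cont. now apply mobius_den_nz. Qed.

Lemma mobius_deriv_cont_disc (z : C) : unit_disc z -> continuous (mobius_deriv r) z.
Proof. intros Hz. apply mobius_deriv_cont. now apply mobius_den_nz. Qed.

Lemma k_cont (z : C) : unit_disc z -> continuous k z.
Proof. intros Hz. unfold k. cts. apply Cpow_rhp_continuous. now apply mobius_den_disc. Qed.

Hint Resolve mobius_den_nz k_nz Z_disc Z_cont Z'_cont k_cont mobius_cont_disc
  mobius_deriv_cont_disc Cmult_neq_0 : cts.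

Lemma kap_cont (z : C) : unit_disc z -> continuous kap z.
Proof. intros Hz. unfold kap. cts. Qed.

Lemma kap'_cont (z : C) : unit_disc z -> continuous kap' z.
Proof. intros Hz. unfold kap'. cts. Qed.

Hint Resolve kap_cont kap'_cont : cts.

Lemma F_wirtinger (z : C) : unit_disc z -> is_wirtinger pullback z (Fa z) (Fb z).
Proof.
  intros Hz. eapply wirtinger_val.
  - apply (wirtinger_mult k (fun w => f (Z w))); [now apply k_wirtinger|].
    apply (wirtinger_comp_hol f Z); [now apply Z_wirtinger|apply Wf; now apply Z_disc].
  - reflexivity.
  - unfold Fb. ring.
Qed.

Lemma P_wirtinger (z : C) : unit_disc z -> is_wirtinger P z (Pa z) (Pb z).
Proof.
  intros Hz. eapply wirtinger_val.
  - apply (wirtinger_mult (fun w => Cconj (kap w)) (fun w => H (Z w))).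
    + apply wirtinger_conj. now apply kap_wirtinger.
    + apply (wirtinger_comp_hol H Z); [now apply Z_wirtinger|apply WH; now apply Z_disc].
  - unfold Pa. rewrite Cconj_RtoC. ring.
  - unfold Pb. ring.
Qed.

Lemma pullback_cont (z : C) : unit_disc z -> continuous pullback z.
Proof.
  intros Hz. change (continuous (fun w => k w * f (Z w))%C z). cts.
Qed.

Lemma Fa_cont (z : C) : unit_disc z -> continuous Fa z.
Proof. intros Hz. unfold Fa. cts. Qed.

Lemma Fb_cont (z : C) : unit_disc z -> continuous Fb z.
Proof. intros Hz. unfold Fb. cts. Qed.

Lemma P_cont (z : C) : unit_disc z -> continuous P z.
Proof. intros Hz. unfold P. cts. Qed.

Lemma Pa_cont (z : C) : unit_disc z -> continuous Pa z.
Proof. intros Hz. unfold Pa. cts. Qed.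

Lemma Pb_cont (z : C) : unit_disc z -> continuous Pb z.
Proof. intros Hz. unfold Pb. cts. Qed.

Lemma disc_weight_pos (z : C) : unit_disc z -> 0 < 1 - Cmod z ^ 2.
Proof. unfold unit_disc. generalize (Cmod_ge_0 z). intros. nra. Qed.

(** The weight at Z is (1 - r^2) (1 - |z|^2) / |1 + r z|^2. The denominator to the power alpha
    is k conj k: one factor cancels the k of F, the other one is part of kap. *)
Lemma pullback_zbar_flux (z : C) : unit_disc z ->
  (Cconj z * Fb z)%C =
  (RtoC (Rpower ((1 - r ^ 2) * (1 - Cmod z ^ 2)) alpha) * P z)%C.
Proof.
  intros Hz. assert (Hk := k_nz _ Hz). assert (Hm := mobius_den_nz _ Hz).
  assert (HZ := Z_disc _ Hz). assert (Hw := disc_weight_pos _ HZ).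
  assert (Hw0 := disc_weight_pos _ Hz).
  assert (E1 : fzb (Z z) = (RtoC (Rpower (1 - Cmod (Z z) ^ 2) alpha) * H (Z z))%C).
  { rewrite EH by exact HZ. rewrite Cmult_assoc, <- RtoC_mult, <- Rpower_plus.
    rewrite Rplus_opp_r, Rpower_O by exact Hw. ring. }
  assert (E2 : 1 - Cmod (Z z) ^ 2 = (1 - r ^ 2) * (1 - Cmod z ^ 2) / Cmod (mobius_den r z) ^ 2).
  { unfold Z. rewrite Cmod_mult, Heta, Rmult_1_l.
  apply mobius_pseudo_distance; [exact Hr|left; exact Hz]. }
  assert (HX : 0 < (1 - r ^ 2) * (1 - Cmod z ^ 2)) by (apply Rmult_lt_0_compat; nra).
  assert (HM := proj1 (Cmod_gt_0 _) Hm).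
  assert (E3 : (k z * Cconj (k z))%C = RtoC (Rpower (Cmod (mobius_den r z) ^ 2) alpha)).
  { rewrite <- Cmod2_conj. unfold k. rewrite Cmod_Cpow_rhp by now apply mobius_den_disc.
    f_equal. simpl. rewrite !Rmult_1_r. now apply Rpower_mult_distr. }
  assert (Hkc : Cconj (k z) <> 0%C).
  { intros E. apply Hk. rewrite <- (Cconj_conj (k z)), E. apply Cconj_RtoC. }
  unfold Fb, P, kap. rewrite E1, E2, Rpower_div_distr; [|exact HX|now apply pow_lt].
  unfold Cdiv. rewrite !Cmult_conj, Cinv_conj by exact Hk.
  unfold Rdiv. rewrite RtoC_mult, RtoC_inv.
  - rewrite <- E3. field. split; assumption.
  - apply Rgt_not_eq, exp_pos.
Qed.

Let m0 (z : C) : C := (mobius r z * Cconj (mobius r z))%C.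
Let m0a (z : C) : C := (mobius_deriv r z * Cconj (mobius r z))%C.
Let m0b (z : C) : C := (mobius r z * Cconj (mobius_deriv r z))%C.
Let q0 (z : C) : C := (Cconj (z * mobius_deriv r z) * mobius r z)%C.
Let q0a (z : C) : C := (Cconj (z * mobius_deriv r z) * mobius_deriv r z)%C.
Let q0b (z : C) : C :=
  (Cconj (mobius_deriv r z + z * (RtoC (-2) * RtoC r * mobius_deriv r z / mobius_den r z)) *
    mobius r z)%C.

Lemma m0_wirtinger (z : C) : unit_disc z -> is_wirtinger m0 z (m0a z) (m0b z).
Proof.
  intros Hz. assert (Hm := mobius_den_nz _ Hz). unfold m0. eapply wirtinger_val.
  - apply wirtinger_mult; [now apply mobius_wirtinger|].
  apply wirtinger_conj; now apply mobius_wirtinger.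
  - unfold m0a. rewrite Cconj_RtoC. ring.
  - unfold m0b. ring.
Qed.

Lemma q0_wirtinger (z : C) : unit_disc z -> is_wirtinger q0 z (q0a z) (q0b z).
Proof.
  intros Hz. assert (Hm := mobius_den_nz _ Hz). unfold q0. eapply wirtinger_val.
  - apply wirtinger_mult; [|now apply mobius_wirtinger].
    apply wirtinger_conj. apply wirtinger_mult; [apply wirtinger_id|now apply
      mobius_deriv_wirtinger].
  - unfold q0a. cbv beta. rewrite !Cplus_conj, !Cmult_conj, !Cconj_RtoC. ring.
  - unfold q0b. cbv beta. rewrite !Cplus_conj, !Cmult_conj, !Cconj_RtoC. ring.
Qed.

Lemma m0_cont (z : C) : unit_disc z -> continuous m0 z.
Proof. intros Hz. unfold m0. cts. Qed.
Lemma m0a_cont (z : C) : unit_disc z -> continuous m0a z.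
Proof. intros Hz. unfold m0a. cts. Qed.
Lemma m0b_cont (z : C) : unit_disc z -> continuous m0b z.
Proof. intros Hz. unfold m0b. cts. Qed.
Lemma q0_cont (z : C) : unit_disc z -> continuous q0 z.
Proof. intros Hz. unfold q0. cts. Qed.
Lemma q0a_cont (z : C) : unit_disc z -> continuous q0a z.
Proof. intros Hz. unfold q0a. cts. Qed.
Lemma q0b_cont (z : C) : unit_disc z -> continuous q0b z.
Proof. intros Hz. unfold q0b. cts. Qed.

(** Both sides carry the factor |z Z'|^2. What remains on the left is |g(Z)| / |k|, and |1 + r
    z| >= 1 - rho >= (1 - rho^2) / 2. This is the origin of the factor 2^alpha. *)
Lemma flux_density_bound (z : C) (rho : R) : unit_disc z -> Cmod z <= rho < 1 ->
  Rpower (1 - rho ^ 2) alpha * Cmod (z * Pa z)%C <=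
  Rpower 2 alpha * G * Re (z * q0a z)%C.
Proof.
  intros Hz Hrho. assert (Hk := k_nz _ Hz). assert (Hm := mobius_den_nz _ Hz).
  assert (HM := proj1 (Cmod_gt_0 _) Hm). assert (HMk := proj1 (Cmod_gt_0 _) Hk).
  set (S := ((1 - r ^ 2) / Cmod (mobius_den r z) ^ 2) ^ 2).
  assert (HS : 0 <= S) by apply pow2_ge_0.
  assert (Hee : (eta * Cconj eta)%C = RtoC 1).
  { rewrite <- Cmod2_conj, Heta. f_equal; ring. }
  assert (E1 : (z * Pa z)%C = (RtoC (Cmod z ^ 2 * S) * (g (Z z) / Cconj (k z)))%C).
  { unfold Pa, kap, Z', Cdiv. rewrite !Cmult_conj, Cinv_conj by exact Hk.
    rewrite RtoC_mult, Cmod2_conj. unfold S. rewrite <- Cmod2_mobius_deriv by exact Hm.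
    transitivity (eta * Cconj eta * (z * Cconj z * (mobius_deriv r z * Cconj (mobius_deriv r z)) *
      (g (Z z) * / Cconj (k z))))%C; [ring|]. rewrite Hee. ring. }
  assert (E2 : (z * q0a z)%C = RtoC (Cmod z ^ 2 * S)).
  { unfold q0a. rewrite RtoC_mult, Cmod2_conj. unfold S. rewrite <- Cmod2_mobius_deriv by exact Hm.
    rewrite Cmult_conj. ring. }
  assert (Hkc : Cconj (k z) <> 0%C).
  { intros E. apply Hk. rewrite <- (Cconj_conj (k z)), E. apply Cconj_RtoC. }
  rewrite E1, E2. rewrite Cmod_mult, Cmod_R, Rabs_pos_eq
    by (apply Rmult_le_pos; [apply pow2_ge_0|exact HS]).
  rewrite Cmod_div by exact Hkc. rewrite Cmod_conj.
  change (Re (RtoC (Cmod z ^ 2 * S))) with (Cmod z ^ 2 * S).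
  assert (Hkey : Rpower (1 - rho ^ 2) alpha <= Rpower 2 alpha * Cmod (k z)).
  { unfold k. rewrite Cmod_Cpow_rhp by now apply mobius_den_disc.
    rewrite Rpower_mult_distr by lra. apply Rle_Rpower_l; [exact Ha|].
    assert (Hd := mobius_den_Re r z Hr (Rlt_le _ _ Hz)).
    assert (Hd2 := re_le_Cmod (mobius_den r z)). apply Rabs_le_between in Hd2.
    generalize (Cmod_ge_0 z). split; nra. }
  assert (Hg := Bg _ (Z_disc _ Hz)).
  assert (HT : 0 <= Cmod z ^ 2 * S) by (apply Rmult_le_pos; [apply pow2_ge_0|exact HS]).
  set (T := Cmod z ^ 2 * S) in *.
  apply Rle_trans with (Rpower 2 alpha * Cmod (k z) * (T * (G / Cmod (k z)))).
  - apply Rmult_le_compat; [left; apply exp_pos| |exact Hkey|].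
    + apply Rmult_le_pos; [exact HT|].
      apply Rdiv_le_0_compat; [apply Cmod_ge_0|exact HMk].
    + apply Rmult_le_compat_l; [exact HT|].
      apply Rmult_le_compat_r; [left; now apply Rinv_0_lt_compat|exact Hg].
  - right. field. lra.
Qed.

Lemma Cdiv_1_r (z : C) : (z / RtoC 1)%C = z.
Proof. field. Qed.

Lemma Re_scal (x : R) (z : C) : Re (RtoC x * z)%C = x * Re z.
Proof. destruct z; simpl. unfold Re; simpl. ring. Qed.

(** The density bound is integrated over all radii up to rho; at the centre P and q0 vanish. *)
Lemma flux_bound (rho : R) : 0 < rho < 1 ->
  Rpower (1 - rho ^ 2) alpha * Cmod (circle_mean P rho) <=
  Rpower 2 alpha * G * Re (circle_mean q0 rho).
Proof.
  intros Hrho.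
  assert (Hab : forall t, 0 <= t <= rho -> Rabs t < 1).
  { intros t Ht. rewrite Rabs_pos_eq; lra. }
  assert (D1 := circle_mean_derive P Pa Pb P_wirtinger P_cont Pa_cont Pb_cont).
  assert (D2 := circle_mean_derive q0 q0a q0b q0_wirtinger q0_cont q0a_cont q0b_cont).
  assert (A1 := circle_mean_derive_z P Pa Pb P_wirtinger Pa_cont Pb_cont).
  assert (A2 := circle_mean_derive_z q0 q0a q0b q0_wirtinger q0a_cont q0b_cont).
  set (c := Rpower (1 - rho ^ 2) alpha). assert (Hc : 0 < c) by apply exp_pos.
  set (K := Rpower 2 alpha * G).
  assert (HK : 0 <= K) by (apply Rmult_le_pos; [left; apply exp_pos|exact HG]).
  assert (Hmain := Cmod_increment_le (fun t => RtoC c * circle_mean P t)%C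
     (fun t => RtoC c * circle_mean_deriv Pa Pb t)%C
     (fun t => K * Re (circle_mean q0 t)) (fun t => K * Re (circle_mean_deriv q0a q0b t)) 0 rho).
  assert (Z1 : circle_mean P 0 = RtoC 0).
  { rewrite circle_mean_0. unfold P, kap, Cdiv. rewrite !Cmult_0_l, Cconj_RtoC. ring. }
  assert (Z2 : circle_mean q0 0 = RtoC 0).
  { rewrite circle_mean_0. unfold q0. rewrite !Cmult_0_l, Cconj_RtoC. ring. }
  cbv beta in Hmain. rewrite Z1, Z2 in Hmain.
  replace (Re (RtoC 0)) with 0 in Hmain by reflexivity.
  replace (RtoC c * circle_mean P rho - RtoC c * RtoC 0)%C with (RtoC c * circle_mean P rho)%C in
    Hmain by ring.
  rewrite Cmod_mult, Cmod_R, Rabs_pos_eq in Hmain by lra.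
  rewrite Rmult_0_r, Rminus_0_r in Hmain. apply Hmain; clear Hmain.
  - lra.
  - intros t Ht. eapply is_Cderive_val; [apply is_Cderive_mult; [apply is_Cderive_const|]|].
    + exact (D1 t (Hab t ltac:(lra))).
    + cbv beta. ring.
  - intros t Ht. assert (H1 := is_Cderive_continuous _ _ _ (D1 t (Hab t Ht))). cts.
  - intros t Ht. apply is_derive_scal_l. exact (proj1 (D2 t (Hab t ltac:(lra)))).
  - intros t Ht. assert (H2 := is_Cderive_continuous _ _ _ (D2 t (Hab t Ht))). cts.
  - intros t Ht. assert (Ht1 : Rabs t < 1) by (apply Hab; lra).
    apply Rmult_le_reg_l with t; [lra|].
    replace (t * Cmod (RtoC c * circle_mean_deriv Pa Pb t)%C)
      with (Cmod (RtoC c * (RtoC t * circle_mean_deriv Pa Pb t))%C)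
      by (rewrite !Cmod_mult, !Cmod_R, (Rabs_pos_eq t) by lra; ring).
    replace (t * (K * Re (circle_mean_deriv q0a q0b t))) with (K * Re (RtoC t * circle_mean_deriv
      q0a q0b t)%C)
      by (rewrite Re_scal; ring).
    rewrite A1, A2 by exact Ht1.
    assert (CP : forall s, continuous (fun s => RtoC 2 * (polar t s * Pa (polar t s)))%C s).
    { assert (CPa := Pa_cont). intros s. cts. }
    assert (CQ : forall s, continuous (fun s => RtoC 2 * (polar t s * q0a (polar t s)))%C s).
    { assert (Cqa := q0a_cont). intros s. cts. }
    rewrite <- CInt_cmul by exact CP.
    apply Rle_trans with
      (RInt (fun s => K * Re (RtoC 2 * (polar t s * q0a (polar t s)))%C) 0 (2 * PI)).
    + apply Cmod_CInt_le; [exact twoPI_pos| | |].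
      * intros s. apply continuous_Cmult_fun; [apply continuous_const|apply CP].
      * apply ex_RInt_cont. intros s. apply continuous_Rmult_fun; [apply continuous_const|].
        exact (continuous_Re_fun _ _ (CQ s)).
      * intros s _. rewrite !Cmod_mult, !Cmod_R, (Rabs_pos_eq 2), (Rabs_pos_eq c) by lra.
        rewrite <- Cmod_mult, Re_scal.
        assert (Hz := polar_disc t s Ht1).
        assert (E : Cmod (polar t s) = t) by (rewrite Cmod_polar; apply Rabs_pos_eq; lra).
        assert (HQ := flux_density_bound (polar t s) rho Hz). rewrite E in HQ.
        assert (HQ' := HQ ltac:(lra)). fold c K in HQ'. lra.
    + right. unfold CInt; simpl Re.
      apply (@RInt_scal R_CompleteNormedModule).
      apply ex_RInt_cont. intros s. exact (continuous_Re_fun _ _ (CQ s)).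
Qed.

(** The factor (1 - t^2)^alpha of [pullback_zbar_flux] is the one in [flux_bound], so that the
    means of F grow at most as fast as a multiple of those of m0. *)
Lemma circle_mean_growth (rho : R) : 0 <= rho < 1 ->
  Cmod (circle_mean pullback rho - circle_mean pullback 0)%C <=
  Rpower (1 - r ^ 2) alpha * (Rpower 2 alpha * G) * (Re (circle_mean m0 rho) - Re (circle_mean m0
    0)).
Proof.
  intros Hrho.
  assert (Hab : forall t, 0 <= t <= rho -> Rabs t < 1).
  { intros t Ht. rewrite Rabs_pos_eq; lra. }
  assert (D1 := circle_mean_derive pullback Fa Fb F_wirtinger pullback_cont Fa_cont Fb_cont).
  assert (D2 := circle_mean_derive m0 m0a m0b m0_wirtinger m0_cont m0a_cont m0b_cont).
  assert (A1 := circle_mean_derive_zbar pullback Fa Fb F_wirtinger Fa_cont Fb_cont).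
  assert (A2 := circle_mean_derive_zbar m0 m0a m0b m0_wirtinger m0a_cont m0b_cont).
  set (c := Rpower (1 - r ^ 2) alpha). assert (Hc : 0 < c) by apply exp_pos.
  set (K := Rpower 2 alpha * G).
  rewrite Rmult_minus_distr_l.
  apply (Cmod_increment_le (circle_mean pullback) (circle_mean_deriv Fa Fb)
     (fun t => c * K * Re (circle_mean m0 t)) (fun t => c * K * Re (circle_mean_deriv m0a m0b t))).
  - lra.
  - intros t Ht. exact (D1 t (Hab t ltac:(lra))).
  - intros t Ht. exact (is_Cderive_continuous _ _ _ (D1 t (Hab t Ht))).
  - intros t Ht. apply is_derive_scal_l. exact (proj1 (D2 t (Hab t ltac:(lra)))).
  - intros t Ht. assert (H2 := is_Cderive_continuous _ _ _ (D2 t (Hab t Ht))). cts.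
  - intros t Ht. assert (Ht1 : Rabs t < 1) by (apply Hab; lra).
    apply Rmult_le_reg_l with t; [lra|].
    replace (t * Cmod (circle_mean_deriv Fa Fb t))
      with (Cmod (RtoC t * circle_mean_deriv Fa Fb t)%C)
      by (rewrite !Cmod_mult, !Cmod_R, (Rabs_pos_eq t) by lra; ring).
    replace (t * (c * K * Re (circle_mean_deriv m0a m0b t))) with (c * (K * Re (RtoC t *
      circle_mean_deriv m0a m0b t)%C))
      by (rewrite Re_scal; ring).
    rewrite A1, A2 by exact Ht1.
    assert (CP : forall s, continuous (fun s => P (polar t s)) s).
    { assert (HC := P_cont). intros s. cts. }
    assert (CQ : forall s, continuous (fun s => q0 (polar t s)) s).
    { assert (HC := q0_cont). intros s. cts. }
    assert (HX : 0 < 1 - r ^ 2) by nra. assert (HX' : 0 < 1 - t ^ 2) by nra.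
    set (ct := Rpower (1 - t ^ 2) alpha).
    assert (Hct : 0 < ct) by apply exp_pos.
    rewrite (CInt_ext _ (fun s => RtoC (2 * (c * ct)) * P (polar t s))%C).
    2:{ intros s. rewrite pullback_zbar_flux by now apply polar_disc. rewrite Cmod_polar, pow2_abs.
        rewrite <- Rpower_mult_distr by assumption. fold c ct. rewrite !RtoC_mult. ring. }
    rewrite (CInt_ext (fun s => RtoC 2 * (Cconj _ * _))%C (fun s => RtoC 2 * q0 (polar t s))%C).
    2:{ intros s. unfold m0b, q0. rewrite Cmult_conj. ring. }
    rewrite !CInt_cmul by assumption.
    change (CInt (fun t0 => P (polar t t0)) 0 (2 * PI)) with (circle_mean P t).
    change (CInt (fun t0 => q0 (polar t t0)) 0 (2 * PI)) with (circle_mean q0 t).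
    rewrite Cmod_mult, Cmod_R, Rabs_pos_eq by nra. rewrite Re_scal.
    assert (HB := flux_bound t ltac:(lra)). fold ct K in HB. nra.
Qed.

(** At the centre the mean of F is 2 pi f(eta r). The mean of m0 is 2 pi r^2 at the centre and
    at most 2 pi on every circle, which gives the factor 1 - r^2. *)
Lemma interior_estimate (rho : R) : 0 <= rho < 1 ->
  Cmod (circle_mean pullback rho - RtoC (2 * PI) * f (eta * RtoC r))%C <=
  2 * PI * (Rpower 2 alpha * (G * Rpower (1 - r ^ 2) (alpha + 1))).
Proof.
  intros Hrho. assert (H1 := circle_mean_growth rho Hrho).
  assert (HPI := PI_RGT_0).
  assert (E0 : mobius_den r (RtoC 0) = RtoC 1) by (unfold mobius_den; ring).
  assert (E1 : circle_mean pullback 0 = (RtoC (2 * PI) * f (eta * RtoC r))%C).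
  { rewrite circle_mean_0. unfold pullback, mobius. rewrite E0.
    now rewrite Cpow_rhp_1, Cplus_0_l, Cmult_1_l, Cdiv_1_r. }
  assert (E2 : Re (circle_mean m0 0) = 2 * PI * r ^ 2).
  { rewrite circle_mean_0. rewrite Re_scal. f_equal. unfold m0, mobius. rewrite E0.
    rewrite <- Cmod2_conj. simpl Re.
    rewrite Cplus_0_l, Cdiv_1_r, Cmod_R. apply pow2_abs. }
  assert (E3 : Re (circle_mean m0 rho) <= 2 * PI).
  { unfold circle_mean, CInt; simpl Re.
    replace (2 * PI) with (RInt (fun _ => 1) 0 (2 * PI)) at 2.
    2:{ rewrite RInt_const. unfold scal; simpl; unfold mult; simpl. ring. }
    assert (Hd : forall s, unit_disc (polar rho s))
      by (intros; apply polar_disc; rewrite Rabs_pos_eq; lra).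
    assert (CM : forall s, continuous (fun s => m0 (polar rho s)) s).
    { intros s.
      apply (continuous_comp (polar rho) m0); [apply polar_continuous|apply m0_cont, Hd]. }
    apply RInt_le.
    - lra.
    - apply ex_RInt_cont. intros s. exact (continuous_Re_fun _ _ (CM s)).
    - apply ex_RInt_const.
    - intros s _. change (Re (mobius r (polar rho s) * Cconj (mobius r (polar rho s)))%C <= 1).
      rewrite <- Cmod2_conj.
      assert (H2 := disc_weight_pos _ (mobius_disc r _ Hr (Hd s))).
      change (Cmod (mobius r (polar rho s)) ^ 2 <= 1). lra. }
  rewrite E1 in H1. eapply Rle_trans; [exact H1|]. rewrite E2.
  assert (HX : 0 < 1 - r ^ 2) by nra.
  rewrite Rpower_plus, Rpower_1 by exact HX.
  set (c := Rpower (1 - r ^ 2) alpha). assert (Hc : 0 < c) by apply exp_pos.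
  set (K := Rpower 2 alpha). assert (HK : 0 < K) by apply exp_pos.
  replace (2 * PI * (K * (G * (c * (1 - r ^ 2))))) with
    (c * (K * G) * (2 * PI - 2 * PI * r ^ 2)) by ring.
  apply Rmult_le_compat_l; [|lra].
  apply Rmult_le_pos; [lra|]. apply Rmult_le_pos; lra.
Qed.
End Interior.

(** * Elementary inequalities *)

Lemma le_of_derive_nonneg (f df : R -> R) (a b : R) : a <= b ->
  (forall t, a <= t <= b -> is_derive f t (df t)) ->
  (forall t, a <= t <= b -> 0 <= df t) -> f a <= f b.
Proof.
  intros Hab Hd Hp. destruct (MVT_gen f a b df) as [c [Hc E]].
  - rewrite Rmin_left, Rmax_right by exact Hab. intros t Ht; apply Hd; lra.
  - rewrite Rmin_left, Rmax_right by exact Hab. intros t Ht. apply continuity_pt_filterlim.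
    apply (@ex_derive_continuous R_AbsRing R_NormedModule). eexists; now apply Hd.
  - rewrite Rmin_left, Rmax_right in Hc by exact Hab.
    generalize (Hp c Hc). nra.
Qed.

Lemma Rpower_bernoulli (x a : R) : 0 < x -> 0 <= a <= 1 -> Rpower x a <= 1 + a * (x - 1).
Proof.
  intros Hx Ha. unfold Rpower. set (m := a * ln x).
  (* With weights a and 1 - a the arguments ln x - m and - m have mean 0, so the weighted sum of
     the two tangent line bounds is x^a at most the weighted mean of x and 1. *)
  assert (H1 := exp_ineq1_le (ln x - m)). assert (H2 := exp_ineq1_le (- m)).
  assert (E1 : exp (ln x - m) = x * exp (- m)).
  { unfold Rminus. rewrite exp_plus, exp_ln by exact Hx. reflexivity. }
  assert (E2 : exp m * exp (- m) = 1).
  { rewrite <- exp_plus, Rplus_opp_r. apply exp_0. }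
  assert (H3 := exp_pos m). assert (H4 := exp_pos (- m)).
  rewrite E1 in H1.
  assert (H5 : 1 <= (1 + a * (x - 1)) * exp (- m)).
  { assert (1 + a * (ln x - m) - (1 - a) * m <= a * (x * exp (-m)) + (1 - a) * exp (-m)) by nra.
    unfold m in *. nra. }
  apply Rmult_le_reg_r with (exp (- m)); [exact H4|]. rewrite E2. exact H5.
Qed.

Lemma exp_lower2 (t : R) : 0 <= t -> 1 + t + t ^ 2 / 2 <= exp t.
Proof.
  intros Ht.
  assert (H := le_of_derive_nonneg (fun s => exp s - (1 + s + s ^ 2 / 2)) (fun s => exp s - (1 +
    s)) 0 t Ht).
  assert (H' : exp 0 - (1 + 0 + 0 ^ 2 / 2) <= exp t - (1 + t + t ^ 2 / 2)).
  { apply H.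
    - intros s _. auto_derive; [trivial|field].
    - intros s _. generalize (exp_ineq1_le s). lra. }
  rewrite exp_0 in H'. lra.
Qed.

Lemma ln_lower (x : R) : 1 <= x -> 2 * (x - 1) / (x + 1) <= ln x.
Proof.
  intros Hx.
  assert (H := le_of_derive_nonneg (fun s => ln s - 2 * (s - 1) / (s + 1))
     (fun s => (s - 1) ^ 2 / (s * (s + 1) ^ 2)) 1 x Hx).
  assert (H' : ln 1 - 2 * (1 - 1) / (1 + 1) <= ln x - 2 * (x - 1) / (x + 1)).
  { apply H.
    - intros s Hs. auto_derive; [lra|field; lra].
    - intros s Hs. apply Rdiv_le_0_compat; [apply pow2_ge_0|]. nra. }
  rewrite ln_1 in H'. lra.
Qed.

Lemma ln2_lower : 0.685 <= ln 2.
Proof.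
  assert (H1 := ln_lower (4 / 3) ltac:(lra)). assert (H2 := ln_lower (3 / 2) ltac:(lra)).
  (* Near 1 the bound of [ln_lower] is sharp; at 2 itself it would only give 2/3. *)
  replace 2 with (4 / 3 * (3 / 2)) at 1 by field. rewrite ln_mult by lra. lra.
Qed.

Lemma is_derive_atan_pow (x : R) : is_derive atan x (/ (1 + x ^ 2)).
Proof. eapply is_derive_val; [apply is_derive_atan|]. unfold Rsqr. f_equal; ring. Qed.

Lemma atan_le_id (x : R) : 0 <= x -> atan x <= x.
Proof.
  intros Hx.
  assert (H : 0 - atan 0 <= x - atan x).
  { apply (le_of_derive_nonneg (fun s => s - atan s) (fun s => 1 - / (1 + s ^ 2))); [exact Hx| |].
    - intros s _. apply @is_derive_minus; [apply @is_derive_id|apply is_derive_atan_pow].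
    - intros s _. assert (/ (1 + s ^ 2) <= / 1) by (apply Rinv_le_contravar; [lra|nra]). lra. }
  rewrite atan_0 in H. lra.
Qed.

Lemma atan_nonneg (x : R) : 0 <= x -> 0 <= atan x.
Proof.
  intros [Hx| <-]; [|rewrite atan_0; lra].
  apply Rlt_le. rewrite <- atan_0. now apply atan_increasing.
Qed.

Lemma atan_sqr_le (x : R) : atan x ^ 2 <= x ^ 2.
Proof.
  assert (G : forall y, 0 <= y -> atan y ^ 2 <= y ^ 2).
  { intros y Hy. apply pow_incr. split; [now apply atan_nonneg|now apply atan_le_id]. }
  destruct (Rle_dec 0 x) as [Hx|Hx]; [now apply G|].
  assert (H := G (- x) ltac:(lra)). rewrite atan_opp in H. lra.
Qed.

Lemma atan_pade (x : R) : 0 <= x -> 3 * x / (3 + x ^ 2) <= atan x.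
Proof.
  intros Hx.
  assert (H : atan 0 - 3 * 0 / (3 + 0 ^ 2) <= atan x - 3 * x / (3 + x ^ 2)).
  { apply (le_of_derive_nonneg (fun s => atan s - 3 * s / (3 + s ^ 2))
      (fun s => 4 * s ^ 4 / ((1 + s ^ 2) * (3 + s ^ 2) ^ 2))); [exact Hx| |].
    - intros s _. eapply is_derive_val.
      + apply @is_derive_minus; [apply is_derive_atan_pow|].
        instantiate (1 := (9 - 3 * s ^ 2) / (3 + s ^ 2) ^ 2).
        auto_derive; [nra|field; nra].
      + unfold minus, plus, opp; simpl. field. split; nra.
    - intros s _. apply Rdiv_le_0_compat; [nra|]. apply Rmult_lt_0_compat; nra. }
  rewrite atan_0 in H. lra.
Qed.

Lemma atan_upper5 (x : R) : 0 <= x -> atan x <= x - x ^ 3 / 3 + x ^ 5 / 5.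
Proof.
  intros Hx.
  assert (H : 0 - 0 ^ 3 / 3 + 0 ^ 5 / 5 - atan 0 <= x - x ^ 3 / 3 + x ^ 5 / 5 - atan x).
  { apply (le_of_derive_nonneg (fun s => s - s ^ 3 / 3 + s ^ 5 / 5 - atan s)
      (fun s => s ^ 6 / (1 + s ^ 2))); [exact Hx| |].
    - intros s _. eapply is_derive_val.
      + apply @is_derive_minus; [|apply is_derive_atan_pow].
        instantiate (1 := 1 - s ^ 2 + s ^ 4). auto_derive; [trivial|field].
      + unfold minus, plus, opp; simpl. field. nra.
    - intros s _. apply Rdiv_le_0_compat; nra. }
  rewrite atan_0 in H. lra.
Qed.

Lemma PI_upper : PI <= 3.1456.
Proof.
  assert (H := Machin_2_3).
  assert (H1 := atan_upper5 (/ 2) ltac:(lra)). assert (H2 := atan_upper5 (/ 3) ltac:(lra)). lra.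
Qed.

(** atan is concave: its slope stays above PI / 4 up to some point, and from there on below. On
    the first part the comparison starts at 0, on the second it ends at 1. *)
Lemma atan_chord (r : R) : 0 <= r <= 1 -> PI / 4 * r <= atan r.
Proof.
  intros Hr. destruct (Rle_dec (PI / 4) (/ (1 + r ^ 2))) as [Hc|Hc].
  - assert (H : atan 0 - PI / 4 * 0 <= atan r - PI / 4 * r).
    { apply (le_of_derive_nonneg (fun s => atan s - PI / 4 * s) (fun s => / (1 + s ^ 2) - PI / 4));
        [lra| |].
      - intros s _. apply @is_derive_minus; [apply is_derive_atan_pow|].
        auto_derive; [trivial|ring].
      - intros s Hs. assert (/ (1 + r ^ 2) <= / (1 + s ^ 2)); [|lra].
        apply Rinv_le_contravar; nra. }
    rewrite atan_0 in H. lra.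
  - assert (H : PI / 4 * r - atan r <= PI / 4 * 1 - atan 1).
    { apply (le_of_derive_nonneg (fun s => PI / 4 * s - atan s) (fun s => PI / 4 - / (1 + s ^ 2)));
        [lra| |].
      - intros s _. apply @is_derive_minus; [|apply is_derive_atan_pow].
        auto_derive; [trivial|ring].
      - intros s Hs. assert (/ (1 + s ^ 2) <= / (1 + r ^ 2)); [|lra].
        apply Rinv_le_contravar; nra. }
    rewrite atan_1 in H. lra.
Qed.

Lemma atan_tangent_1 (r : R) : 0 <= r <= 1 -> atan r <= PI / 4 - (1 - r) / 2.
Proof.
  intros Hr.
  assert (H : atan r - r / 2 <= atan 1 - 1 / 2).
  { apply (le_of_derive_nonneg (fun s => atan s - s / 2) (fun s => / (1 + s ^ 2) - / 2)); [lra| |].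
    - intros s _. apply @is_derive_minus; [apply is_derive_atan_pow|].
      auto_derive; [trivial|field].
    - intros s Hs. assert (/ 2 <= / (1 + s ^ 2)); [|lra].
      apply Rinv_le_contravar; nra. }
  rewrite atan_1 in H. lra.
Qed.

Lemma atan_sin_lower (r : R) : 0 <= r -> r / sqrt (1 + r ^ 2) <= atan r.
Proof.
  intros Hr. replace (r / sqrt (1 + r ^ 2)) with (sin (atan r)).
  - destruct (atan_nonneg r Hr) as [Ha| <-]; [left; now apply sin_lt_x|]. rewrite sin_0. lra.
  - rewrite sin_atan. unfold Rsqr. do 2 f_equal. ring.
Qed.

(** For small sqrt sg the chord bound for atan is enough. Otherwise the Pade bound leaves an
    inequality between polynomials in y = sqrt sg. The constant 0.37 = 2 (0.685 - 1/2) is the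
    largest one allowed in [excess_total_bound]. *)
Lemma excess_linear_bound (r sg a : R) : 0 <= r < 1 -> sg = (1 - r ^ 2) / (1 + r ^ 2) ->
  a = atan r ->
  PI / 4 * r * (2 + sg) - 2 * a <= 0.37 * sqrt sg * a.
Proof.
  intros Hr Es Ea.
  assert (Ha : 0 <= a) by (subst a; apply atan_nonneg; lra).
  assert (Hs : 0 < sg <= 1).
  { subst sg. split; [apply Rdiv_lt_0_compat; nra|].
    apply Rmult_le_reg_r with (1 + r ^ 2); [nra|]. field_simplify; nra. }
  set (y := sqrt sg). assert (Hy : 0 < y) by (apply sqrt_lt_R0; lra).
  assert (Ey : y * y = sg) by (apply sqrt_sqrt; lra).
  assert (Hy1 : y <= 1) by nra.
  destruct (Rle_dec y 0.37) as [Hc|Hc].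
  - assert (H := atan_chord r ltac:(lra)). rewrite <- Ea in H.
    assert (PI / 4 * r * (2 + sg) <= a * (2 + sg)) by (apply Rmult_le_compat_r; lra).
    assert (sg * a <= 0.37 * y * a) by (apply Rmult_le_compat_r; nra). lra.
  - assert (H := atan_pade r ltac:(lra)). rewrite <- Ea in H.
    assert (E3 : 3 + r ^ 2 = (4 + 2 * sg) / (1 + sg)).
    { subst sg. field. split; nra. }
    assert (H1 : r <= (4 + 2 * sg) / (3 * (1 + sg)) * a).
    { assert (3 * r <= a * (3 + r ^ 2)).
      { apply Rmult_le_reg_r with (/ (3 + r ^ 2)); [apply Rinv_0_lt_compat; nra|].
        field_simplify; [|nra|nra]. field_simplify in H; nra. }
      rewrite E3 in H0. replace ((4 + 2 * sg) / (3 * (1 + sg)) * a)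
        with (a * ((4 + 2 * sg) / (1 + sg)) / 3) by (field; lra). lra. }
    assert (HP := PI_upper). assert (HP0 := PI_RGT_0).
    (* 0.7864 is the upper bound 3.1456 for PI, divided by 4. *)
    assert (H2 : PI / 4 * r * (2 + sg) <=
       0.7864 * ((4 + 2 * sg) / (3 * (1 + sg)) * a) * (2 + sg)).
    { apply Rmult_le_compat_r; [lra|]. apply Rmult_le_compat; lra. }
    assert (H3 : 0.7864 * ((4 + 2 * sg) / (3 * (1 + sg))) * (2 + sg) - 2 <= 0.37 * y).
    { apply Rmult_le_reg_r with (3 * (1 + sg)); [lra|].
      replace ((0.7864 * ((4 + 2 * sg) / (3 * (1 + sg))) * (2 + sg) - 2) * (3 * (1 + sg)))
        with (0.7864 * 2 * (2 + sg) ^ 2 - 6 * (1 + sg)) by (field; lra).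
      rewrite <- Ey.
      assert (y * y * y * y <= y * y * y).
      { rewrite <- (Rmult_1_r (y * y * y)) at 2. apply Rmult_le_compat_l; [|lra].
        apply Rmult_le_pos; nra. }
      assert (0 <= (y - 0.37) * (1 - y)) by nra.
      assert (0 <= (y - 0.37) * (1 - y) * y) by nra.
      nra. }
    assert (H4 := Rmult_le_compat_r a _ _ Ha H3). lra.
Qed.

(** For small r this holds because sg is close to 1. Away from 0 the tangent of atan at 1 bounds
    the left side by (PI / 4 - 1/2) (1 - r), and 1 - r <= sg. The constant 0.93 is at most 4
    (0.685^2 / 2), as needed in [excess_total_bound]. *)
Lemma excess_quadratic_bound (r sg a : R) : 0 <= r < 1 -> sg = (1 - r ^ 2) / (1 + r ^ 2) ->
  a = atan r ->
  a - PI / 4 * r <= 0.93 * sg * a.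
Proof.
  intros Hr Es Ea.
  assert (Ha : 0 <= a) by (subst a; apply atan_nonneg; lra).
  assert (HP := PI_upper).
  assert (HP0 : 3.1 <= PI).
  { assert (H0 := Machin_2_3).
    assert (H2 := atan_pade (/ 2) ltac:(lra)). assert (H3 := atan_pade (/ 3) ltac:(lra)).
    replace (3 * / 2 / (3 + (/ 2) ^ 2)) with (6 / 13) in H2 by field.
    replace (3 * / 3 / (3 + (/ 3) ^ 2)) with (9 / 28) in H3 by field. lra. }
  assert (Hle := atan_le_id r ltac:(lra)). rewrite <- Ea in Hle.
  destruct (Rle_dec r 0.3) as [Hc|Hc].
  - assert (Hs : 0.8 <= sg).
    { subst sg. apply Rmult_le_reg_r with (1 + r ^ 2); [nra|]. field_simplify; nra. }
    nra.
  - assert (H1 := atan_tangent_1 r ltac:(lra)). rewrite <- Ea in H1.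
    assert (H2 := atan_pade r ltac:(lra)). rewrite <- Ea in H2.
    assert (H3 : 0.29 <= a).
    { apply Rle_trans with (3 * r / (3 + r ^ 2)); [|exact H2].
      apply Rmult_le_reg_r with (3 + r ^ 2); [nra|]. field_simplify; nra. }
    assert (H4 : (1 - r) * 1.1 <= sg \/ 0.5 <= a).
    { destruct (Rle_dec 0.5 a); [now right|left].
      assert (r <= 0.6).
      { assert (3 * r <= a * (3 + r ^ 2)).
        { apply Rmult_le_reg_r with (/ (3 + r ^ 2)); [apply Rinv_0_lt_compat; nra|].
          field_simplify; [|nra|nra]. field_simplify in H2; nra. }
        nra. }
      subst sg. apply Rmult_le_reg_r with (1 + r ^ 2); [nra|].
      replace ((1 - r ^ 2) / (1 + r ^ 2) * (1 + r ^ 2)) with ((1 - r) * (1 + r)) by (field; nra).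
      rewrite Rmult_assoc. apply Rmult_le_compat_l; nra. }
    assert (H5 : (1 - r) <= sg).
    { subst sg. apply Rmult_le_reg_r with (1 + r ^ 2); [nra|].
      replace ((1 - r ^ 2) / (1 + r ^ 2) * (1 + r ^ 2)) with ((1 - r) * (1 + r)) by (field; nra).
      apply Rmult_le_compat_l; nra. }
    assert (H6 : a - PI / 4 * r <= (1 - r) * 0.2865) by nra.
    destruct H4 as [H4|H4]; nra.
Qed.

(** The choice of e makes e sqrt sg = alpha / 2, so by the two preceding lemmas the excess is at
    most (0.185 alpha + 0.2325 alpha^2) a. Together with alpha / 2 this stays below the
    expansion of 2^alpha = exp (alpha ln 2) to second order, as ln 2 >= 0.685. *)
Lemma excess_total_bound (alpha r sg a e : R) : 0 <= alpha <= 1 -> 0 <= r < 1 ->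
  sg = (1 - r ^ 2) / (1 + r ^ 2) -> a = atan r -> e = alpha / (2 * sqrt sg) ->
  (1 + alpha / 2) * a + e * (PI / 4 * r * (2 + sg) - 2 * a) + e ^ 2 * (a - PI / 4 * r)
  <= Rpower 2 alpha * a.
Proof.
  intros Hal Hr Es Ea Ee.
  assert (HA := excess_linear_bound r sg a Hr Es Ea).
  assert (HB := excess_quadratic_bound r sg a Hr Es Ea).
  assert (Ha : 0 <= a) by (subst a; apply atan_nonneg; lra).
  assert (Hs : 0 < sg) by (subst sg; apply Rdiv_lt_0_compat; nra).
  assert (Hy : 0 < sqrt sg) by (apply sqrt_lt_R0; lra).
  assert (Ey : sqrt sg * sqrt sg = sg) by (apply sqrt_sqrt; lra).
  assert (He : 0 <= e) by (subst e; apply Rdiv_le_0_compat; lra).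
  assert (H2 := exp_lower2 (alpha * ln 2)). assert (HL := ln2_lower).
  assert (H3 : 1 + alpha * 0.685 + (alpha * 0.685) ^ 2 / 2 <= Rpower 2 alpha).
  { unfold Rpower. eapply Rle_trans; [|apply H2; nra].
    assert (alpha * 0.685 <= alpha * ln 2) by nra. nra. }
  assert (T1 : e * (PI / 4 * r * (2 + sg) - 2 * a) <= alpha * 0.185 * a).
  { apply Rle_trans with (e * (0.37 * sqrt sg * a)); [now apply Rmult_le_compat_l|].
    assert (E : e * sqrt sg = alpha / 2) by (subst e; field; lra).
    replace (e * (0.37 * sqrt sg * a)) with (0.37 * (e * sqrt sg) * a) by ring. rewrite E. lra. }
  assert (T2 : e ^ 2 * (a - PI / 4 * r) <= alpha ^ 2 * 0.2325 * a).
  { apply Rle_trans with (e ^ 2 * (0.93 * sg * a));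
      [apply Rmult_le_compat_l; [apply pow2_ge_0|exact HB]|].
    assert (E : e ^ 2 * sg = alpha ^ 2 / 4) by (rewrite Ee; rewrite <- Ey at 2; field; lra).
    replace (e ^ 2 * (0.93 * sg * a)) with (0.93 * (e ^ 2 * sg) * a) by ring. rewrite E. lra. }
  assert (H4 := Rmult_le_compat_r a _ _ Ha H3). nra.
Qed.

(** A polynomial in k = |cos th| can be integrated against the Poisson kernel in closed form, a
    square root cannot. With l = k + e (1 - k) the root is at most k + e^2 (1 - k) / l: after
    squaring, the difference is itself a square. Then 1 / l is replaced by a bound linear in k;
    again the difference has an explicit sign. *)
Lemma sqrt_le_chord_plus_excess (e k : R) : 0 < e -> 0 <= k <= 1 ->
  sqrt (k ^ 2 + e ^ 2 * (1 - k ^ 2)) <= k + (e ^ 2 * (1 - k) + e * (1 - e) * (1 - k) ^ 2).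
Proof.
  intros He Hk.
  set (l := k + e * (1 - k)).
  assert (Hl : 0 < l) by (unfold l; destruct (Req_dec k 0); nra).
  assert (H1 : sqrt (k ^ 2 + e ^ 2 * (1 - k ^ 2)) <= k + e ^ 2 * (1 - k) / l).
  { assert (H0 : 0 <= e ^ 2 * (1 - k) / l) by (apply Rdiv_le_0_compat; [apply Rmult_le_pos;
    nra|lra]).
    rewrite <- (sqrt_pow2 (k + _)) by lra. apply sqrt_le_1_alt.
    apply Rmult_le_reg_r with (l ^ 2); [nra|].
    replace ((k + e ^ 2 * (1 - k) / l) ^ 2 * l ^ 2) with ((k * l + e ^ 2 * (1 - k)) ^ 2) by
      (field; lra).
    unfold l.
    assert (E2 : (k * (k + e * (1 - k)) + e ^ 2 * (1 - k)) ^ 2 -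
      (k ^ 2 + e ^ 2 * (1 - k ^ 2)) * (k + e * (1 - k)) ^ 2 =
      (e * (1 - k) * k * (1 - e)) ^ 2 ) by ring.
    generalize (pow2_ge_0 (e * (1 - k) * k * (1 - e))). lra. }
  eapply Rle_trans; [exact H1|]. apply Rplus_le_compat_l.
  apply Rmult_le_reg_r with l; [exact Hl|].
  replace (e ^ 2 * (1 - k) / l * l) with (e ^ 2 * (1 - k)) by (field; lra).
  assert (E : (e ^ 2 * (1 - k) + e * (1 - e) * (1 - k) ^ 2) * l - e ^ 2 * (1 - k)
     = e * (1 - k) ^ 2 * k * (1 - e) ^ 2) by (unfold l; ring).
  assert (0 <= e * (1 - k) ^ 2 * k * (1 - e) ^ 2).
  { apply Rmult_le_pos; [|apply pow2_ge_0].
    apply Rmult_le_pos; [|lra]. apply Rmult_le_pos; [lra|apply pow2_ge_0]. }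
  lra.
Qed.

(** In the derivative, Bernoulli's inequality is applied to both powers; the linear terms
    cancel. *)
Lemma power_pair_difference (x b : R) : 0 <= x < 1 -> 0 <= b <= 1 ->
  Rpower (1 + x) (1 + b) - Rpower (1 - x) (1 + b) <= 2 * (1 + b) * x.
Proof.
  intros Hx Hb.
  assert (D : forall s c, 0 < s -> is_derive (fun y => Rpower y c) s (c * Rpower s (c - 1))).
  { intros s c Hs. unfold Rpower. auto_derive; [exact Hs|].
    replace ((c - 1) * ln s) with (c * ln s - ln s) by ring.
    unfold Rminus. rewrite exp_plus, exp_Ropp, exp_ln by exact Hs. ring. }
  assert (H : 2 * (1 + b) * 0 - (Rpower (1 + 0) (1 + b) - Rpower (1 - 0) (1 + b)) <=
     2 * (1 + b) * x - (Rpower (1 + x) (1 + b) - Rpower (1 - x) (1 + b))).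
  { apply (le_of_derive_nonneg
      (fun s => 2 * (1 + b) * s - (Rpower (1 + s) (1 + b) - Rpower (1 - s) (1 + b)))
      (fun s => 2 * (1 + b) - (1 + b) * (Rpower (1 + s) b + Rpower (1 - s) b))); [lra| |].
    - intros s Hs. eapply is_derive_val.
      + apply @is_derive_minus.
        * apply is_derive_scal_l, @is_derive_id.
        * apply @is_derive_minus.
          -- apply (is_derive_comp (fun y => Rpower y (1 + b)) (fun s => 1 + s)).
             ++ apply D. lra.
             ++ instantiate (1 := 1). auto_derive; [trivial|ring].
          -- apply (is_derive_comp (fun y => Rpower y (1 + b)) (fun s => 1 - s)).
             ++ apply D. lra.
             ++ instantiate (1 := -1). auto_derive; [trivial|ring].
      + unfold minus, plus, opp, scal, one; simpl; unfold mult; simpl.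
        replace (1 + b - 1) with b by ring. ring.
    - intros s Hs. assert (H1 := Rpower_bernoulli (1 + s) b ltac:(lra) Hb).
      assert (H2 := Rpower_bernoulli (1 - s) b ltac:(lra) Hb). nra. }
  rewrite Rplus_0_r, Rminus_0_r in H. lra.
Qed.

(** * Integrals of the Poisson kernel *)

Ltac toR := match goal with |- @eq _ ?x ?y => change (@eq R x y) end.

(** This is |1 - r e^{i th}|^2. *)
Definition poisson_den (r th : R) : R := 1 + r ^ 2 - 2 * r * cos th.
Definition poisson (r th : R) : R := (1 - r ^ 2) / poisson_den r th.
(** The angle of the point of the unit circle that [mobius r] sends to e^{i th}. *)
Definition mobius_angle (r th : R) : R := th + 2 * atan (r * sin th / (1 - r * cos th)).
(** This is (1 - r^2) / (1 - r e^{i th}), the value of 1 + r z at the point z of angle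
    [mobius_angle r th]. *)
Definition mobius_factor (r th : R) : C :=
  ((1 - r ^ 2) * (1 - r * cos th) / poisson_den r th, (1 - r ^ 2) * (r * sin th) / poisson_den r
    th).

Lemma poisson_den_pos (r th : R) : 0 <= r < 1 -> 0 < poisson_den r th.
Proof.
  intros Hr. unfold poisson_den. assert (H := COS_bound th).
  assert (0 < (1 - r) ^ 2) by (apply pow_lt; lra). nra.
Qed.

Lemma one_minus_rcos (r th : R) : 0 <= r < 1 -> 0 < 1 - r * cos th.
Proof. intros Hr. assert (H := COS_bound th). nra. Qed.

Lemma sin2_eq (th : R) : sin th ^ 2 = 1 - cos th ^ 2.
Proof. generalize (sin2_cos2 th). unfold Rsqr. lra. Qed.

Lemma mobius_angle_derive (r th : R) : 0 <= r < 1 -> is_derive (mobius_angle r) th (poisson r th).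
Proof.
  intros Hr. assert (H1 := one_minus_rcos r th Hr). assert (H2 := poisson_den_pos r th Hr).
  unfold mobius_angle. eapply is_derive_val.
  - apply @is_derive_plus; [apply @is_derive_id|]. apply is_derive_scal_l.
    apply (is_derive_comp atan (fun s => r * sin s / (1 - r * cos s))); [apply is_derive_atan_pow|].
    apply is_derive_div.
    + apply is_derive_scal_l, is_derive_sin.
    + instantiate (1 := r * sin th). auto_derive; [trivial|ring].
    + lra.
  - unfold plus, scal, one; simpl; unfold mult; simpl.
    assert (E : (1 - r * cos th) ^ 2 + (r * sin th) ^ 2 = poisson_den r th).
    { unfold poisson_den. rewrite Rpow_mult_distr, sin2_eq. ring. }
    unfold poisson. set (A := 1 - r * cos th) in *. set (B := r * sin th) in *.
    transitivity (1 + 2 * (r * cos th * A - B ^ 2) / (A ^ 2 + B ^ 2)).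
    + field. split; lra.
    + rewrite E. apply Rmult_eq_reg_r with (poisson_den r th); [|lra].
      replace ((1 - r ^ 2) / poisson_den r th * poisson_den r th) with (1 - r ^ 2) by (field; lra).
      replace ((1 + 2 * (r * cos th * A - B ^ 2) / poisson_den r th) * poisson_den r th)
        with (poisson_den r th + 2 * (r * cos th * A - B ^ 2)) by (field; lra).
      rewrite <- E. unfold A, B. rewrite Rpow_mult_distr, sin2_eq. ring.
Qed.

Lemma poisson_den_cont (r th : R) : continuous (poisson_den r) th.
Proof. unfold poisson_den. cts. Qed.

Lemma poisson_cont (r th : R) : 0 <= r < 1 -> continuous (poisson r) th.
Proof.
  intros Hr. assert (C := poisson_den_cont r th). unfold poisson. cts.
  apply Rgt_not_eq, poisson_den_pos, Hr.
Qed.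
#[export] Hint Resolve poisson_den_cont poisson_cont : cts.

Lemma cos_3PI2' : cos (3 * PI / 2) = 0.
Proof. replace (3 * PI / 2) with (3 * (PI / 2)) by field. apply cos_3PI2. Qed.
Lemma sin_3PI2' : sin (3 * PI / 2) = -1.
Proof. replace (3 * PI / 2) with (3 * (PI / 2)) by field. apply sin_3PI2. Qed.

Lemma RInt_derive_R (F f : R -> R) (a b : R) :
  (forall t, is_derive F t (f t)) -> (forall t, continuous f t) -> RInt f a b = F b - F a.
Proof.
  intros HF Hf. apply (@is_RInt_unique R_CompleteNormedModule).
  apply (is_RInt_derive F f); intros; auto.
Qed.

Lemma RInt_const_R (c a b : R) : RInt (fun _ => c) a b = (b - a) * c.
Proof. exact (RInt_const a b c). Qed.

Lemma RInt_ext_R (f g : R -> R) (a b : R) :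
  (forall t, Rmin a b < t < Rmax a b -> f t = g t) -> RInt f a b = RInt g a b.
Proof. exact (RInt_ext f g a b). Qed.

(** The sign of the integrand is that of cos, and [F] is a primitive on each of the arcs where
    it is constant. *)
Lemma RInt_abs_cos (F h : R -> R) :
  (forall t, is_derive F t (cos t * h t)) -> (forall t, continuous h t) ->
  (forall t, 0 <= h t) ->
  RInt (fun t => Rabs (cos t * h t)) 0 (2 * PI) =
  2 * F (PI / 2) - 2 * F (3 * PI / 2) + F (2 * PI) - F 0.
Proof.
  intros HF Hh Hp. assert (HPI := PI_RGT_0).
  assert (Cf : forall t, continuous (fun t => cos t * h t) t).
  { cts. }
  assert (Ex : forall a b, ex_RInt (fun t => Rabs (cos t * h t)) a b)
    by (intros; apply ex_RInt_cont; cts).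
  assert (P : forall a b, a <= b -> (forall t, a <= t <= b -> 0 <= cos t) ->
     RInt (fun t => Rabs (cos t * h t)) a b = F b - F a).
  { intros a b Hab Hc. rewrite <- (RInt_derive_R F (fun t => cos t * h t)) by assumption.
    apply RInt_ext_R. intros t Ht. rewrite Rmin_left, Rmax_right in Ht by exact Hab.
    apply Rabs_pos_eq, Rmult_le_pos; [apply Hc; lra|apply Hp]. }
  assert (N : forall a b, a <= b -> (forall t, a <= t <= b -> cos t <= 0) ->
     RInt (fun t => Rabs (cos t * h t)) a b = F a - F b).
  { intros a b Hab Hc.
    rewrite (RInt_ext_R _ (fun t => - (cos t * h t))).
    - rewrite (RInt_derive_R (fun t => - F t)).
      + toR. ring.
      + intros t. apply @is_derive_opp, HF.
      + cts.
    - intros t Ht. rewrite Rmin_left, Rmax_right in Ht by exact Hab.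
      apply Rabs_left1. assert (H1 := Hc t ltac:(lra)). assert (H2 := Hp t). nra. }
  rewrite <- (RInt_Chasles _ 0 (PI / 2) (2 * PI)) by apply Ex.
  rewrite <- (RInt_Chasles _ (PI / 2) (3 * PI / 2) (2 * PI)) by apply Ex.
  unfold plus; simpl. rewrite (P 0), N, (P (3 * PI / 2)); try lra.
  - intros t Ht. replace t with (t - 2 * PI + 2 * PI) by ring. rewrite cos_plus, cos_2PI, sin_2PI.
    assert (0 <= cos (t - 2 * PI)) by (apply cos_ge_0; lra). lra.
  - intros t Ht. apply cos_le_0; lra.
  - intros t Ht. apply cos_ge_0; lra.
Qed.

Lemma RInt_poisson (r : R) : 0 <= r < 1 -> RInt (poisson r) 0 (2 * PI) = 2 * PI.
Proof.
  intros Hr. rewrite (RInt_derive_R (mobius_angle r)).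
  - unfold mobius_angle. rewrite sin_2PI, sin_0. unfold Rdiv.
  rewrite Rmult_0_r, !Rmult_0_l, atan_0. toR. ring.
  - intros t. now apply mobius_angle_derive.
  - intros t. now apply poisson_cont.
Qed.

Definition cos_2atan (r : R) : R := (1 - r ^ 2) / (1 + r ^ 2).

Lemma cos_2atan_pos (r : R) : 0 <= r < 1 -> 0 < cos_2atan r.
Proof. intros Hr. apply Rdiv_lt_0_compat; nra. Qed.

(** Against the constant cos (2 atan r) the deviation of the Poisson kernel changes sign with
    cos, that is, at th = pi / 2 and 3 pi / 2. This makes its mean explicit. *)
Lemma poisson_minus_cos_2atan (r th : R) : 0 <= r < 1 ->
  poisson r th - cos_2atan r = cos th * (2 * r / (1 + r ^ 2) * poisson r th).
Proof.
  intros Hr. assert (H := poisson_den_pos r th Hr). unfold poisson, cos_2atan.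
  unfold poisson_den in *. field. split; nra.
Qed.

Lemma poisson_pos (r th : R) : 0 <= r < 1 -> 0 < poisson r th.
Proof. intros Hr. apply Rdiv_lt_0_compat; [nra|now apply poisson_den_pos]. Qed.

(** This is 2 pi (4 / pi) atan r, the constant of the Schwarz lemma for harmonic functions
    vanishing at 0. *)
Lemma RInt_abs_poisson_deviation (r : R) : 0 <= r < 1 ->
  RInt (fun t => Rabs (poisson r t - cos_2atan r)) 0 (2 * PI) = 8 * atan r.
Proof.
  intros Hr.
  rewrite (RInt_ext_R _ (fun t => Rabs (cos t * (2 * r / (1 + r ^ 2) * poisson r t)))).
  2:{ intros t _. f_equal. now apply poisson_minus_cos_2atan. }
  rewrite (RInt_abs_cos (fun t => mobius_angle r t - cos_2atan r * t)).
  - unfold mobius_angle. rewrite sin_2PI, sin_0, sin_PI2, cos_PI2, cos_3PI2', sin_3PI2'.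
    unfold Rdiv. rewrite !Rmult_0_r, !Rmult_0_l, atan_0.
    rewrite Rminus_0_r, Rinv_1, !Rmult_1_r.
    replace (r * -1) with (- r) by ring. rewrite atan_opp. toR. field.
  - intros t. eapply is_derive_val.
    + apply @is_derive_minus; [now apply mobius_angle_derive|apply is_derive_scal_l, @is_derive_id].
    + rewrite <- poisson_minus_cos_2atan by exact Hr. unfold minus, plus, opp, one; simpl. ring.
  - cts.
  - intros t. apply Rmult_le_pos; [|left; now apply poisson_pos].
    apply Rdiv_le_0_compat; nra.
Qed.

Definition sin_2atan (r : R) : R := 2 * r / (1 + r ^ 2).
(** The product of 1 - s cos th and 1 + s cos th, s = sin (2 atan r): the denominators of
    [poisson_ratio] at th and th + pi. *)
Definition pair_den (r th : R) : R := 1 - (sin_2atan r) ^ 2 * cos th ^ 2.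

Lemma sin_cos_2atan (r : R) : (sin_2atan r) ^ 2 + (cos_2atan r) ^ 2 = 1.
Proof. unfold sin_2atan, cos_2atan. field. nra. Qed.

Lemma sin_2atan_bounds (r : R) : 0 <= r < 1 -> 0 <= sin_2atan r < 1.
Proof.
  intros Hr. assert (H := sin_cos_2atan r). assert (H1 := cos_2atan_pos r Hr).
  assert (0 <= sin_2atan r) by (apply Rdiv_le_0_compat; nra). split; [assumption|nra].
Qed.

Lemma pair_den_pos (r th : R) : 0 <= r < 1 -> 0 < pair_den r th.
Proof.
  intros Hr. assert (H := sin_2atan_bounds r Hr). assert (Hc := COS_bound th).
  unfold pair_den. assert (cos th ^ 2 <= 1) by nra. assert (0 <= cos th ^ 2) by apply pow2_ge_0.
  assert (sin_2atan r ^ 2 < 1) by nra. nra.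
Qed.

Lemma pair_den_cont (r th : R) : continuous (pair_den r) th.
Proof. unfold pair_den. cts. Qed.
#[export] Hint Resolve pair_den_cont : cts.

Lemma RInt_abs_cos_pair_den (r : R) : 0 <= r < 1 ->
  RInt (fun t => Rabs (cos t * / (pair_den r t * sqrt (pair_den r t)))) 0 (2 * PI) =
    4 / (cos_2atan r) ^ 2.
Proof.
  intros Hr. assert (Hs := cos_2atan_pos r Hr).
  rewrite (RInt_abs_cos (fun t => sin t / sqrt (pair_den r t) / (cos_2atan r) ^ 2)).
  - assert (E : forall t, cos t = 0 -> pair_den r t = 1) by (intros t Ht; unfold pair_den;
    rewrite Ht; ring).
    rewrite (E (PI / 2)) by apply cos_PI2. rewrite (E (3 * PI / 2)) by apply cos_3PI2'.
    rewrite sin_2PI, sin_0, sin_PI2, sin_3PI2', sqrt_1. toR. field.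
    split; [lra|]. split; apply Rgt_not_eq, sqrt_lt_R0, pair_den_pos, Hr.
  - intros t. assert (HE := pair_den_pos r t Hr). assert (Hq := sqrt_lt_R0 _ HE).
    assert (Hqq := sqrt_sqrt _ (Rlt_le _ _ HE)).
    eapply is_derive_val.
    + unfold Rdiv at 1. apply is_derive_ext with (fun t => / cos_2atan r ^ 2 * (sin t / sqrt
      (pair_den r t))).
      { intros y. toR. unfold Rdiv. ring. }
      apply is_derive_scal_l. apply is_derive_div.
      * apply is_derive_sin.
      * apply (is_derive_sqrt (pair_den r)); [|exact HE].
        instantiate (1 := 2 * sin_2atan r ^ 2 * cos t * sin t). unfold pair_den.
        auto_derive; [trivial|ring].
      * lra.
    + unfold scal; simpl; unfold mult; simpl.
      set (q := sqrt (pair_den r t)) in *.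
      assert (Eq : q * q = 1 - sin_2atan r ^ 2 * cos t ^ 2) by exact Hqq.
      assert (Es := sin2_eq t). assert (ESS := sin_cos_2atan r).
      rewrite <- Hqq.
      assert (Hne : cos_2atan r ^ 2 * (q * q * q) <> 0).
      { apply Rgt_not_eq, Rmult_lt_0_compat; [now apply pow_lt|].
        repeat apply Rmult_lt_0_compat; assumption. }
      toR. transitivity (cos t * (q * q - sin t ^ 2 * sin_2atan r ^ 2) / (cos_2atan r ^ 2 * (q * q
        * q))).
      * field. lra.
      * rewrite Eq, Es. replace (1 - sin_2atan r ^ 2 * cos t ^ 2 - (1 - cos t ^ 2) * sin_2atan r ^
        2)
          with (cos_2atan r ^ 2) by (ring_simplify; lra).
        rewrite <- Eq. field. lra.
  - intros t. assert (HE := pair_den_pos r t Hr). assert (Hq := sqrt_lt_R0 _ HE).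
    assert (CE := pair_den_cont r t). cts. apply Rgt_not_eq, Rmult_lt_0_compat; assumption.
  - intros t. assert (HE := pair_den_pos r t Hr). assert (Hq := sqrt_lt_R0 _ HE).
    left. apply Rinv_0_lt_compat, Rmult_lt_0_compat; assumption.
Qed.

(** * The radial deviation of the weighted kernel *)

(** One of the two powers is above 1 and the other below, so the absolute values add up to a
    difference of powers. *)
Lemma power_pair_deviation (x b : R) : -1 < x < 1 -> 0 <= b <= 1 ->
  Rabs (Rpower (/ (1 - x)) (1 + b) - 1) + Rabs (Rpower (/ (1 + x)) (1 + b) - 1) <=
  2 * (1 + b) * Rabs x * Rpower (/ (1 - x ^ 2)) (1 + b).
Proof.
  intros Hx Hb.
  assert (Hmain : forall y, 0 <= y < 1 ->
    Rabs (Rpower (/ (1 - y)) (1 + b) - 1) + Rabs (Rpower (/ (1 + y)) (1 + b) - 1) <=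
    2 * (1 + b) * y * Rpower (/ (1 - y ^ 2)) (1 + b)).
  { clear x Hx. intros y Hy. set (W := / (1 - y ^ 2)).
    assert (HW : 0 < W) by (apply Rinv_0_lt_compat; nra).
    assert (E1 : / (1 - y) = W * (1 + y)) by (unfold W; field; nra).
    assert (E2 : / (1 + y) = W * (1 - y)) by (unfold W; field; nra).
    assert (L1 : 1 <= / (1 - y)).
    { rewrite <- Rinv_1 at 1. apply Rinv_le_contravar; lra. }
    assert (L2 : / (1 + y) <= 1).
    { rewrite <- Rinv_1 at 2. apply Rinv_le_contravar; lra. }
    assert (L3 : 0 < / (1 + y)) by (apply Rinv_0_lt_compat; lra).
    assert (M1 : 1 <= Rpower (/ (1 - y)) (1 + b)).
    { rewrite <- (Rpower_O (/ (1 - y))) at 1 by lra. apply Rle_Rpower; lra. }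
    assert (M2 : Rpower (/ (1 + y)) (1 + b) <= 1).
    { apply Rle_trans with (Rpower 1 (1 + b)).
      - apply Rle_Rpower_l; lra.
      - right. unfold Rpower. rewrite ln_1, Rmult_0_r. apply exp_0. }
    rewrite (Rabs_pos_eq (Rpower (/ (1 - y)) _ - 1)) by lra.
    rewrite (Rabs_left1 (Rpower (/ (1 + y)) _ - 1)) by lra.
    rewrite E1, E2, <- !Rpower_mult_distr by lra.
    assert (H := power_pair_difference y b Hy Hb).
    assert (HP : 0 < Rpower W (1 + b)) by apply exp_pos.
    assert (H' := Rmult_le_compat_l _ _ _ (Rlt_le _ _ HP) H). lra. }
  destruct (Rle_dec 0 x) as [H0|H0].
  - rewrite (Rabs_pos_eq x) by lra. apply Hmain; lra.
  - rewrite (Rabs_left1 x) by lra. assert (H := Hmain (- x) ltac:(lra)).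
    replace (1 - - x) with (1 + x) in H by ring.
    replace (1 + - x) with (1 - x) in H by ring.
    replace ((- x) ^ 2) with (x ^ 2) in H by ring. lra.
Qed.

(** The inverse of |mobius_factor r th| at th = pi / 2. *)
Definition kernel_scale (r : R) : R := sqrt (1 + r ^ 2) / (1 - r ^ 2).

Lemma kernel_scale_pos (r : R) : 0 <= r < 1 -> 0 < kernel_scale r.
Proof. intros Hr. apply Rdiv_lt_0_compat; [apply sqrt_lt_R0; nra|nra]. Qed.

(** The quotient of the Poisson kernel by its value cos (2 atan r) at th = pi / 2. *)
Definition poisson_ratio (r th : R) : R := / (1 - sin_2atan r * cos th).

Lemma sin_2atan_cos_bounds (r th : R) : 0 <= r < 1 -> -1 < sin_2atan r * cos th < 1.
Proof.
  intros Hr. assert (H := sin_2atan_bounds r Hr). assert (Hc := COS_bound th). nra.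
Qed.

Lemma poisson_ratio_pos (r th : R) : 0 <= r < 1 -> 0 < poisson_ratio r th.
Proof. intros Hr. apply Rinv_0_lt_compat. generalize (sin_2atan_cos_bounds r th Hr). lra. Qed.

Lemma poisson_eq_ratio (r th : R) : 0 <= r < 1 -> poisson r th = cos_2atan r * poisson_ratio r th.
Proof.
  intros Hr. assert (H := sin_2atan_cos_bounds r th Hr). assert (H1 := poisson_den_pos r th Hr).
  unfold poisson_ratio, poisson, cos_2atan.
  assert (E : poisson_den r th = (1 + r ^ 2) * (1 - sin_2atan r * cos th)) by (unfold poisson_den,
    sin_2atan; field; nra).
  rewrite E. field. split; nra.
Qed.

Lemma poisson_ratio_cont (r th : R) : 0 <= r < 1 -> continuous (poisson_ratio r) th.
Proof.
  intros Hr. assert (H := sin_2atan_cos_bounds r th Hr). unfold poisson_ratio. cts. lra.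
Qed.
#[export] Hint Resolve poisson_ratio_pos poisson_ratio_cont : cts.

Lemma Rabs_poisson_ratio (r th : R) : 0 <= r < 1 ->
  Rabs (poisson_ratio r th - 1) = / cos_2atan r * Rabs (poisson r th - cos_2atan r).
Proof.
  intros Hr. assert (Hs := cos_2atan_pos r Hr). rewrite poisson_eq_ratio by exact Hr.
  replace (cos_2atan r * poisson_ratio r th - cos_2atan r) with (cos_2atan r * (poisson_ratio r th
    - 1)) by ring.
  rewrite Rabs_mult, (Rabs_pos_eq (cos_2atan r)) by lra. field. lra.
Qed.

Lemma RInt_Rplus (f g : R -> R) (a b : R) :
  (forall t, continuous f t) -> (forall t, continuous g t) ->
  RInt (fun t => f t + g t) a b = RInt f a b + RInt g a b.
Proof.
  intros Hf Hg. apply (@RInt_plus R_CompleteNormedModule); now apply ex_RInt_cont.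
Qed.

Lemma RInt_Rmult (k : R) (f : R -> R) (a b : R) :
  (forall t, continuous f t) -> RInt (fun t => k * f t) a b = k * RInt f a b.
Proof.
  intros Hf. apply (@RInt_scal R_CompleteNormedModule); now apply ex_RInt_cont.
Qed.

Lemma RInt_pi_average (f : R -> R) :
  (forall t, continuous f t) -> (forall t, f (t + 2 * PI) = f t) ->
  2 * RInt f 0 (2 * PI) = RInt (fun t => f t + f (t + PI)) 0 (2 * PI).
Proof.
  intros Hf Hp. rewrite RInt_Rplus; [|exact Hf|cts].
  rewrite (RInt_periodic_shift f PI Hf Hp). ring.
Qed.

Lemma poisson_ratio_periodic (r t : R) : poisson_ratio r (t + 2 * PI) = poisson_ratio r t.
Proof. unfold poisson_ratio. now rewrite cos_plus, cos_2PI, sin_2PI, Rmult_1_r, Rmult_0_r,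
  Rminus_0_r. Qed.

(** Averaging the values at th and th + pi brings in [power_pair_deviation]. The remaining power
    of [pair_den] is made linear by Bernoulli's inequality at the scale [kernel_scale r]: that
    leaves the integrals of [RInt_abs_poisson_deviation] and [RInt_abs_cos_pair_den]. The second
    is bounded by the first because sin (atan r) <= atan r. *)
Lemma RInt_radial_deviation (alpha r : R) : 0 <= alpha <= 1 -> 0 <= r < 1 ->
  RInt (fun t => Rabs (Rpower (poisson_ratio r t) (1 + alpha / 2) - 1)) 0 (2 * PI) <=
  (1 + alpha / 2) * Rpower (kernel_scale r) alpha * (8 * atan r / cos_2atan r).
Proof.
  intros Hal Hr. set (b := alpha / 2).
  assert (HPI := PI_RGT_0). assert (Hs := cos_2atan_pos r Hr). assert (HK := kernel_scale_pos r Hr).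
  assert (Hsr := sin_2atan_bounds r Hr).
  set (A := fun t => Rabs (Rpower (poisson_ratio r t) (1 + b) - 1)).
  set (B := fun t => Rabs (poisson r t - cos_2atan r)).
  set (J := fun t => Rabs (cos t * / (pair_den r t * sqrt (pair_den r t)))).
  assert (CA : forall t, continuous A t).
  { unfold A. cts. }
  assert (CB : forall t, continuous B t).
  { unfold B. cts. }
  assert (CJ : forall t, continuous J t).
  { intros t. assert (HE := pair_den_pos r t Hr). assert (Hq := sqrt_lt_R0 _ HE).
    assert (CE := pair_den_cont r t). unfold J. cts.
    apply Rgt_not_eq, Rmult_lt_0_compat; assumption. }
  assert (PB : forall t, B (t + 2 * PI) = B t).
  { intros t. unfold B. rewrite !poisson_eq_ratio, poisson_ratio_periodic by exact Hr.
  reflexivity. }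
  assert (IA := RInt_pi_average A CA). assert (IB := RInt_pi_average B CB PB).
  specialize (IA ltac:(intros t; unfold A; now rewrite poisson_ratio_periodic)).
  set (Ka := Rpower (kernel_scale r) alpha). assert (HKa : 0 < Ka) by apply exp_pos.
  assert (Hb : 0 <= b <= 1) by (unfold b; lra).
  assert (Hpt : forall t, A t + A (t + PI) <=
     (1 + b) * Ka * (1 - alpha) / cos_2atan r * (B t + B (t + PI))
     + (1 + b) * Ka * alpha / kernel_scale r * (2 * sin_2atan r) * J t).
  { intros t. set (x := sin_2atan r * cos t).
    assert (Hx : -1 < x < 1) by apply (sin_2atan_cos_bounds r t Hr).
    assert (HE := pair_den_pos r t Hr). assert (Hq := sqrt_lt_R0 _ HE).
    assert (EE : pair_den r t = 1 - x ^ 2) by (unfold pair_den, x; ring).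
    assert (Q1 : poisson_ratio r t = / (1 - x)) by reflexivity.
    assert (Q2 : poisson_ratio r (t + PI) = / (1 + x)).
    { unfold poisson_ratio, x. rewrite neg_cos. f_equal. ring. }
    assert (H1 := power_pair_deviation x b Hx Hb).
    unfold A. rewrite Q1, Q2. eapply Rle_trans; [exact H1|].
    assert (HW : 0 < / (1 - x ^ 2)) by (apply Rinv_0_lt_compat; nra).
    assert (EB : (B t + B (t + PI)) = cos_2atan r * (2 * Rabs x * / (1 - x ^ 2))).
    { assert (R1 : forall th, B th = cos_2atan r * Rabs (poisson_ratio r th - 1)).
      { intros th. rewrite Rabs_poisson_ratio by exact Hr. unfold B. field. lra. }
      rewrite !R1, Q1, Q2.
      replace (/ (1 - x) - 1) with (x * / (1 - x)) by (field; lra).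
      replace (/ (1 + x) - 1) with (- (x * / (1 + x))) by (field; lra).
      rewrite Rabs_Ropp, !Rabs_mult, !(Rabs_pos_eq (/ _)) by (left; apply Rinv_0_lt_compat; lra).
      field. split; [nra|]. split; lra. }
    set (q := sqrt (pair_den r t)) in *.
    assert (Eqq : q * q = pair_den r t) by (apply sqrt_sqrt; lra).
    assert (EJ : 2 * sin_2atan r * J t = 2 * Rabs x * / (1 - x ^ 2) * / q).
    { unfold J. fold q. rewrite Rabs_mult, (Rabs_pos_eq (/ _))
        by (left; apply Rinv_0_lt_compat, Rmult_lt_0_compat; assumption).
      unfold x. rewrite Rabs_mult, (Rabs_pos_eq (sin_2atan r)) by lra. fold x. rewrite EE.
      field. split; [lra|]. nra. }
    assert (HP : Rpower (/ (1 - x ^ 2)) (1 + b) <=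
       / (1 - x ^ 2) * (Ka * (1 - alpha) + Ka * alpha / kernel_scale r * / q)).
    { rewrite Rpower_plus, Rpower_1 by exact HW. apply Rmult_le_compat_l; [lra|].
      assert (E1 : Rpower (/ (1 - x ^ 2)) b = Rpower (/ q) alpha).
      { rewrite <- EE, <- Eqq, Rinv_mult.
        rewrite <- Rpower_mult_distr by (apply Rinv_0_lt_compat; exact Hq).
        rewrite <- Rpower_plus. f_equal. unfold b. field. }
      rewrite E1. replace (/ q) with (kernel_scale r * (/ q / kernel_scale r)) at 1 by (field; lra).
      assert (Hqk : 0 < / q / kernel_scale r) by (apply Rdiv_lt_0_compat;
        [now apply Rinv_0_lt_compat|exact HK]).
      rewrite <- Rpower_mult_distr by assumption. fold Ka.
      assert (HB := Rpower_bernoulli (/ q / kernel_scale r) alpha Hqk Hal).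
      apply Rle_trans with (Ka * (1 + alpha * (/ q / kernel_scale r - 1)));
        [apply Rmult_le_compat_l; lra|].
      right. field. lra. }
    assert (HX : 0 <= 2 * (1 + b) * Rabs x) by (generalize (Rabs_pos x); nra).
    eapply Rle_trans; [apply Rmult_le_compat_l; [exact HX|exact HP]|].
    rewrite EB. right.
    replace ((1 + b) * Ka * alpha / kernel_scale r * (2 * sin_2atan r) * J t) with
       ((1 + b) * Ka * alpha / kernel_scale r * (2 * sin_2atan r * J t)) by ring.
    rewrite EJ. field. repeat split; try lra; nra. }
  assert (Hint : RInt (fun t => A t + A (t + PI)) 0 (2 * PI) <=
     (1 + b) * Ka * (1 - alpha) / cos_2atan r * (2 * (8 * atan r))
     + (1 + b) * Ka * alpha / kernel_scale r * (2 * sin_2atan r) * (4 / cos_2atan r ^ 2)).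
  { rewrite <- (RInt_abs_cos_pair_den r Hr), <- (RInt_abs_poisson_deviation r Hr). fold B J.
  rewrite IB.
    rewrite <- !RInt_Rmult; [|exact CJ|].
    rewrite <- RInt_Rplus.
    - apply RInt_le; [lra| | |].
      + apply ex_RInt_cont. clearbody A. cts.
      + apply ex_RInt_cont. clearbody B J. cts.
      + intros t _. apply Hpt.
    - clearbody B. cts.
    - clearbody J. cts.
    - clearbody B. cts. }
  rewrite <- IA in Hint.
  assert (Hat := atan_sin_lower r ltac:(lra)).
  assert (Hkey : / kernel_scale r * (2 * sin_2atan r) * (4 / cos_2atan r ^ 2) <=
    16 * atan r / cos_2atan r).
  { unfold kernel_scale, sin_2atan, cos_2atan in *.
    assert (Hq : 0 < sqrt (1 + r ^ 2)) by (apply sqrt_lt_R0; nra).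
    assert (Hqq : sqrt (1 + r ^ 2) * sqrt (1 + r ^ 2) = 1 + r ^ 2) by (apply sqrt_sqrt; nra).
    set (q := sqrt (1 + r ^ 2)) in *.
    apply Rle_trans with (16 * (r / q) / ((1 - r ^ 2) / (1 + r ^ 2))).
    - right. rewrite <- Hqq. field. repeat split; nra.
    - unfold Rdiv. rewrite !Rmult_assoc. apply Rmult_le_compat_l; [lra|].
      rewrite <- !Rmult_assoc. apply Rmult_le_compat_r; [|exact Hat].
      left. apply Rinv_0_lt_compat. apply Rmult_lt_0_compat; [nra|apply Rinv_0_lt_compat; nra]. }
  assert (HC : 0 <= (1 + b) * Ka * alpha).
  { apply Rmult_le_pos; [|lra]. apply Rmult_le_pos; lra. }
  assert (H3 := Rmult_le_compat_l _ _ _ HC Hkey).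
  change (RInt A 0 (2 * PI) <= (1 + b) * Ka * (8 * atan r / cos_2atan r)).
  replace ((1 + b) * Ka * alpha * (/ kernel_scale r * (2 * sin_2atan r) * (4 / cos_2atan r ^ 2)))
    with
    ((1 + b) * Ka * alpha / kernel_scale r * (2 * sin_2atan r) * (4 / cos_2atan r ^ 2)) in H3 by
      (field; lra).
  apply Rmult_le_reg_l with 2; [lra|].
  eapply Rle_trans; [exact Hint|]. eapply Rle_trans; [apply Rplus_le_compat_l; exact H3|].
  right. field. lra.
Qed.

(** * The weighted kernel against a constant, pointwise *)

(** The kernel P_alpha at the point r e^{- i th}. *)
Definition boundary_kernel (alpha r th : R) : C := (RtoC (poisson r th) * Cpow_rhp alpha
  (mobius_factor r th))%C.

Lemma mobius_factor_Re_pos (r th : R) : 0 <= r < 1 -> 0 < Re (mobius_factor r th).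
Proof.
  intros Hr. unfold mobius_factor; simpl. apply Rdiv_lt_0_compat; [|now apply poisson_den_pos].
  apply Rmult_lt_0_compat; [nra|now apply one_minus_rcos].
Qed.

Lemma boundary_kernel_cont (alpha r th : R) : 0 <= r < 1 -> continuous (boundary_kernel alpha r) th.
Proof.
  intros Hr. assert (H := Rgt_not_eq _ _ (poisson_den_pos r th Hr)).
  assert (C : continuous (mobius_factor r) th) by (apply continuous_pairC; cts).
  unfold boundary_kernel. cts. now apply Cpow_rhp_continuous, mobius_factor_Re_pos.
Qed.
#[export] Hint Resolve boundary_kernel_cont : cts.

Lemma one_minus_cos_le (x : R) : 1 - cos x <= x ^ 2 / 2.
Proof.
  assert (E : 1 - cos x = 2 * sin (x / 2) ^ 2).
  { replace x with (2 * (x / 2)) at 1 by field. rewrite cos_2a_sin. ring. }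
  assert (H : sin (x / 2) ^ 2 <= (x / 2) ^ 2).
  { assert (G : forall y, 0 <= y -> sin y ^ 2 <= y ^ 2).
    { intros y [Hy| <-]; [|rewrite sin_0; lra].
      destruct (Rle_dec y 1).
      - assert (H1 := sin_lt_x y Hy). assert (H2 : 0 <= sin y).
        { apply sin_ge_0; [lra|]. generalize PI2_3_2; lra. }
        nra.
      - assert (H1 := SIN_bound y). nra. }
    destruct (Rle_dec 0 (x / 2)); [now apply G|].
    assert (H := G (- (x / 2)) ltac:(lra)). rewrite sin_neg in H. lra. }
  rewrite E. lra.
Qed.

Lemma le_of_sqr_le (x y : R) : 0 <= y -> x ^ 2 <= y ^ 2 -> x <= y.
Proof. intros Hy H. destruct (Rle_dec x y); [assumption|]. nra. Qed.

Lemma Cmod2_polar_minus_1 (x t : R) :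
  Cmod (RtoC x * cis t - RtoC 1)%C ^ 2 = (x - 1) ^ 2 + 2 * x * (1 - cos t).
Proof.
  rewrite Cmod2_alt. unfold cis; simpl. unfold Re, Im; simpl.
  assert (H := sin2_cos2 t). unfold Rsqr in H.
  transitivity (x * x * (sin t * sin t + cos t * cos t) - 2 * x * cos t + 1); [ring|].
  rewrite H. ring.
Qed.

Lemma boundary_kernel_polar (alpha r th : R) : 0 <= r < 1 ->
  boundary_kernel alpha r th =
  (RtoC (cos_2atan r * / Rpower (kernel_scale r) alpha * Rpower (poisson_ratio r th) (1 + alpha /
    2)) *
   cis (alpha * atan (r * sin th / (1 - r * cos th))))%C.
Proof.
  intros Hr. assert (HD := poisson_den_pos r th Hr). assert (Hc := one_minus_rcos r th Hr).
  assert (Hq := poisson_ratio_pos r th Hr). assert (HK := kernel_scale_pos r Hr).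
  assert (Hs := cos_2atan_pos r Hr).
  unfold boundary_kernel, Cpow_rhp.
  replace (Im (mobius_factor r th) / Re (mobius_factor r th)) with (r * sin th / (1 - r * cos th)).
  2:{ unfold mobius_factor; simpl. field. repeat split; try lra; nra. }
  rewrite Cmult_assoc, <- RtoC_mult. do 2 f_equal.
  assert (Hn : 0 < 1 + r ^ 2) by nra. assert (Hr2 : 0 < 1 - r ^ 2) by nra.
  assert (Hqq : sqrt (1 + r ^ 2) * sqrt (1 + r ^ 2) = 1 + r ^ 2) by (apply sqrt_sqrt; lra).
  assert (Hsq : 0 < sqrt (1 + r ^ 2)) by (now apply sqrt_lt_R0).
  assert (EQ : poisson_den r th * poisson_ratio r th = 1 + r ^ 2).
  { assert (H := sin_2atan_cos_bounds r th Hr). unfold poisson_ratio.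
    replace (poisson_den r th) with ((1 + r ^ 2) * (1 - sin_2atan r * cos th)) by (unfold
      poisson_den, sin_2atan; field; lra).
    field. lra. }
  assert (EM : Re (mobius_factor r th) ^ 2 + Im (mobius_factor r th) ^ 2 =
    poisson_ratio r th * (/ kernel_scale r * / kernel_scale r)).
  { transitivity ((1 - r ^ 2) ^ 2 / poisson_den r th).
    - unfold mobius_factor; simpl.
      assert (E2 : (1 - r * cos th) ^ 2 + (r * sin th) ^ 2 = poisson_den r th).
      { unfold poisson_den. rewrite Rpow_mult_distr, sin2_eq. ring. }
      transitivity ((1 - r ^ 2) ^ 2 * ((1 - r * cos th) ^ 2 + (r * sin th) ^ 2) / poisson_den r th
        ^ 2);
        [field; lra|]. rewrite E2. field. lra.
    - unfold kernel_scale. transitivity (poisson_ratio r th * (1 - r ^ 2) ^ 2 / (sqrt (1 + r ^ 2)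
      * sqrt (1 + r ^ 2))).
      + rewrite Hqq, <- EQ. field. split; lra.
      + field. repeat split; lra. }
  rewrite EM, poisson_eq_ratio by exact Hr.
  assert (HKi : 0 < / kernel_scale r) by now apply Rinv_0_lt_compat.
  replace (exp (alpha * (ln (poisson_ratio r th * (/ kernel_scale r * / kernel_scale r)) / 2))) with
    (Rpower (poisson_ratio r th) (alpha / 2) * / Rpower (kernel_scale r) alpha).
  - rewrite Rpower_plus, Rpower_1 by exact Hq. ring.
  - rewrite !ln_mult by (try apply Rmult_lt_0_compat; assumption).
    rewrite ln_Rinv by exact HK. unfold Rpower. rewrite <- exp_Ropp, <- exp_plus. f_equal. field.
Qed.

(** The argument of the kernel adds at most e^2 (1 - k^2) to k^2, k = |cos th|, where e is this
    slope; see [boundary_kernel_pointwise]. *)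
Definition excess_slope (alpha r : R) : R := alpha / (2 * sqrt (cos_2atan r)).
(** The excess over k in [sqrt_le_chord_plus_excess]. *)
Definition excess_poly (e k : R) : R := e ^ 2 * (1 - k) + e * (1 - e) * (1 - k) ^ 2.

(** Up to a constant the kernel is Q e^{i eta} with Q = q^(1 + alpha / 2), q = [poisson_ratio r
    th]. Replacing Q by q costs |Q - q|, and nothing is lost because Q - q and q - 1 have the
    same sign. For q the effect of the argument eta is explicit: |q e^{i eta} - 1|^2 = (q - 1)^2
    + 2 q (1 - cos eta), where (q - 1)^2 = (q s k)^2 and eta^2 <= q (s e)^2 (1 - k^2), s = sin
    (2 atan r). *)
Lemma boundary_kernel_pointwise (alpha r th : R) : 0 < alpha <= 1 -> 0 <= r < 1 ->
  Cmod (boundary_kernel alpha r th - RtoC (cos_2atan r * / Rpower (kernel_scale r) alpha))%C <=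
  / Rpower (kernel_scale r) alpha *
   (cos_2atan r * Rabs (Rpower (poisson_ratio r th) (1 + alpha / 2) - 1)
     + poisson r th * sin_2atan r * excess_poly (excess_slope alpha r) (Rabs (cos th))).
Proof.
  intros Hal Hr. assert (Hs := cos_2atan_pos r Hr). assert (Hq := poisson_ratio_pos r th Hr).
  assert (Hsr := sin_2atan_bounds r Hr).
  set (kap := / Rpower (kernel_scale r) alpha).
  assert (Hkap : 0 < kap) by (apply Rinv_0_lt_compat, exp_pos).
  rewrite boundary_kernel_polar by exact Hr. fold kap.
  set (eta := alpha * atan _). set (Q := Rpower (poisson_ratio r th) (1 + alpha / 2)).
  set (q := poisson_ratio r th) in *. set (e := excess_slope alpha r). set (k := Rabs (cos th)).
  assert (Hy : 0 < sqrt (cos_2atan r)) by (apply sqrt_lt_R0; lra).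
  assert (He : 0 < e) by (apply Rdiv_lt_0_compat; lra).
  assert (Hk : 0 <= k <= 1).
  { split; [apply Rabs_pos|]. apply Rabs_le. apply COS_bound. }
  assert (Ek2 : k ^ 2 = cos th ^ 2) by apply pow2_abs.
  assert (E1 : Cmod (RtoC (cos_2atan r * kap * Q) * cis eta - RtoC (cos_2atan r * kap))%C
     = cos_2atan r * kap * Cmod (RtoC Q * cis eta - RtoC 1)%C).
  { rewrite <- (Rabs_pos_eq (cos_2atan r * kap)) at 3 by nra. rewrite <- Cmod_R, <- Cmod_mult.
    f_equal. rewrite !RtoC_mult. ring. }
  rewrite E1.
  assert (E2 : Cmod (RtoC Q * cis eta - RtoC 1)%C <= Rabs (Q - q) + Cmod (RtoC q * cis eta - RtoC
    1)%C).
  { replace (RtoC Q * cis eta - RtoC 1)%C with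
      (RtoC (Q - q) * cis eta + (RtoC q * cis eta - RtoC 1))%C by (rewrite RtoC_minus; ring).
    eapply Rle_trans; [apply Cmod_triangle|]. rewrite Cmod_mult, Cmod_cis, Cmod_R. lra. }
  assert (Ex : q - 1 = q * (sin_2atan r * cos th)).
  { unfold q, poisson_ratio. field. generalize (sin_2atan_cos_bounds r th Hr); lra. }
  assert (Exa : Rabs (q - 1) = q * sin_2atan r * k).
  { rewrite Ex, !Rabs_mult, (Rabs_pos_eq q), (Rabs_pos_eq (sin_2atan r)) by lra. fold k. ring. }
  assert (E3 : Cmod (RtoC q * cis eta - RtoC 1)%C <= q * sin_2atan r * (k + excess_poly e k)).
  { apply Rle_trans with (q * sin_2atan r * sqrt (k ^ 2 + e ^ 2 * (1 - k ^ 2))).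
    2:{ apply Rmult_le_compat_l; [apply Rmult_le_pos; lra|].
        assert (H := sqrt_le_chord_plus_excess e k He Hk). unfold excess_poly. lra. }
    assert (HR : 0 <= k ^ 2 + e ^ 2 * (1 - k ^ 2)).
    { apply Rplus_le_le_0_compat; [apply pow2_ge_0|]. apply Rmult_le_pos; [apply pow2_ge_0|nra]. }
    apply le_of_sqr_le; [apply Rmult_le_pos; [apply Rmult_le_pos; lra|apply sqrt_pos]|].
    rewrite Cmod2_polar_minus_1.
    replace ((q * sin_2atan r * sqrt (k ^ 2 + e ^ 2 * (1 - k ^ 2))) ^ 2) with
      (q ^ 2 * sin_2atan r ^ 2 * (sqrt (k ^ 2 + e ^ 2 * (1 - k ^ 2)) * sqrt (k ^ 2 + e ^ 2 * (1 -
        k ^ 2)))) by ring.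
    rewrite sqrt_sqrt by exact HR.
    assert (H1 := one_minus_cos_le eta).
    assert (H2 : eta ^ 2 <= q * (sin_2atan r ^ 2 * e ^ 2 * (1 - k ^ 2))).
    { unfold eta. rewrite Rpow_mult_distr.
      assert (Hc := one_minus_rcos r th Hr). assert (HD := poisson_den_pos r th Hr).
      assert (HA := atan_sqr_le (r * sin th / (1 - r * cos th))).
      apply Rle_trans with (alpha ^ 2 * (r * sin th / (1 - r * cos th)) ^ 2).
      { apply Rmult_le_compat_l; [apply pow2_ge_0|exact HA]. }
      assert (EQ : q * (sin_2atan r ^ 2 * e ^ 2 * (1 - k ^ 2)) =
         alpha ^ 2 * ((r * sin th) ^ 2 / ((1 - r ^ 2) * poisson_den r th))).
      { assert (Ee : e ^ 2 = alpha ^ 2 / (4 * cos_2atan r)).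
        { unfold e, excess_slope. rewrite <- (sqrt_sqrt (cos_2atan r)) at 2 by lra. field. lra. }
        assert (Eq : q = poisson r th / cos_2atan r) by (rewrite poisson_eq_ratio by exact Hr;
          unfold q; field; lra).
        rewrite Ee, Eq, Ek2. rewrite <- sin2_eq. unfold poisson, sin_2atan, cos_2atan. field.
        repeat split; nra. }
      rewrite EQ. apply Rmult_le_compat_l; [apply pow2_ge_0|].
      unfold Rdiv. rewrite Rpow_mult_distr. apply Rmult_le_compat_l; [apply pow2_ge_0|].
      rewrite pow_inv.
      apply Rinv_le_contravar; [apply Rmult_lt_0_compat; nra|].
      assert ((1 - r * cos th) ^ 2 - (1 - r ^ 2) * poisson_den r th = r ^ 2 * (cos th - r) ^ 2)
        by (unfold poisson_den; ring).
      assert (0 <= r ^ 2 * (cos th - r) ^ 2) by (apply Rmult_le_pos; apply pow2_ge_0). lra. }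
    assert (H3 : (q - 1) ^ 2 = q ^ 2 * sin_2atan r ^ 2 * k ^ 2) by (rewrite Ex, Ek2; ring).
    rewrite H3.
    assert (2 * q * (1 - cos eta) <= 2 * q * (q * (sin_2atan r ^ 2 * e ^ 2 * (1 - k ^ 2)) / 2)).
    { apply Rmult_le_compat_l; lra. }
    lra. }
  assert (E4 : Rabs (Q - q) + Rabs (q - 1) = Rabs (Q - 1)).
  { destruct (Rle_dec 1 q) as [H|H].
    - assert (HQ : q <= Q).
      { unfold Q. rewrite <- (Rpower_1 q) at 1 by lra. apply Rle_Rpower; lra. }
      rewrite !Rabs_pos_eq by lra. ring.
    - assert (HQ : Q <= q).
      { unfold Q. rewrite Rpower_plus, Rpower_1 by lra.
        assert (Rpower q (alpha / 2) <= 1).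
        { apply Rle_trans with (Rpower 1 (alpha / 2)).
          - apply Rle_Rpower_l; lra.
          - right. unfold Rpower. rewrite ln_1, Rmult_0_r. apply exp_0. }
        nra. }
      rewrite !Rabs_left1 by lra. ring. }
  assert (Hb : Cmod (RtoC Q * cis eta - RtoC 1)%C <= Rabs (Q - 1) + q * sin_2atan r * excess_poly
    e k) by lra.
  assert (HX : 0 <= cos_2atan r * kap) by nra.
  eapply Rle_trans; [apply Rmult_le_compat_l; [exact HX|exact Hb]|].
  right. rewrite poisson_eq_ratio by exact Hr. fold q. ring.
Qed.

(** * The distance of the weighted kernel to the constants in the mean *)

Lemma RInt_cos_circle : RInt cos 0 (2 * PI) = 0.
Proof.
  rewrite (RInt_derive_R sin).
  - rewrite sin_2PI, sin_0. toR. ring.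
  - intros t. apply is_derive_sin.
  - cts.
Qed.

(** Since poisson - cos (2 atan r) = s poisson cos th, the powers of cos th up to the second
    times the Poisson kernel are combinations of the kernel, of the deviation in
    [RInt_abs_poisson_deviation], of cos th and of constants. *)
Lemma RInt_excess (r e : R) : 0 < r < 1 ->
  RInt (fun t => poisson r t * sin_2atan r * excess_poly e (Rabs (cos t))) 0 (2 * PI) =
  2 * PI * e * (sin_2atan r + r) - 16 * atan r * e + e ^ 2 * (8 * atan r - 2 * PI * r).
Proof.
  intros Hr0. assert (Hr : 0 <= r < 1) by lra. assert (Hs := cos_2atan_pos r Hr).
  assert (Hsr : 0 < sin_2atan r) by (apply Rdiv_lt_0_compat; nra).
  assert (Ck : forall t, continuous (poisson r) t) by (intros; now apply poisson_cont).
  assert (CB : forall t, continuous (fun t => Rabs (poisson r t - cos_2atan r)) t).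
  { cts. }
  rewrite (RInt_ext_R _ (fun t => ((e * sin_2atan r + e * (1 - e) / sin_2atan r) * poisson r t +
     (- (2 * e - e ^ 2)) * Rabs (poisson r t - cos_2atan r)) +
     (- (e * (1 - e) * cos_2atan r) * cos t + - (e * (1 - e) / sin_2atan r * cos_2atan r)))).
  2:{ intros t _.
      assert (E1 : Rabs (poisson r t - cos_2atan r) = poisson r t * sin_2atan r * Rabs (cos t)).
      { rewrite poisson_minus_cos_2atan by exact Hr.
        replace (cos t * (2 * r / (1 + r ^ 2) * poisson r t)) with (poisson r t * sin_2atan r *
          cos t) by (unfold sin_2atan; ring).
        assert (Hp := poisson_pos r t Hr).
        rewrite !Rabs_mult, (Rabs_pos_eq (poisson r t)), (Rabs_pos_eq (sin_2atan r)) by lra. ring. }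
      assert (E2 : poisson r t - cos_2atan r = poisson r t * sin_2atan r * cos t).
      { rewrite poisson_minus_cos_2atan by exact Hr. unfold sin_2atan. ring. }
      rewrite E1. unfold excess_poly.
      transitivity (poisson r t * sin_2atan r * (e - (2 * e - e ^ 2) * Rabs (cos t) + e * (1 - e)
        * (Rabs (cos t)) ^ 2));
        [toR; ring|].
      rewrite pow2_abs.
      assert (E3 : poisson r t * sin_2atan r * cos t ^ 2 =
        (poisson r t - cos_2atan r) / sin_2atan r - cos_2atan r * cos t).
      { apply Rmult_eq_reg_r with (sin_2atan r); [|lra].
        replace (((poisson r t - cos_2atan r) / sin_2atan r - cos_2atan r * cos t) * sin_2atan r)
          with
          ((poisson r t - cos_2atan r) - cos_2atan r * cos t * sin_2atan r) by (field; lra).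
        rewrite E2.
        replace (poisson r t * sin_2atan r * cos t - cos_2atan r * cos t * sin_2atan r) with
          ((poisson r t - cos_2atan r) * (cos t * sin_2atan r)) by ring.
        rewrite E2. ring. }
      transitivity (poisson r t * sin_2atan r * e - (2 * e - e ^ 2) * (poisson r t * sin_2atan r *
        Rabs (cos t))
        + e * (1 - e) * (poisson r t * sin_2atan r * cos t ^ 2)); [toR; ring|].
      rewrite E3. toR. field. lra. }
  rewrite RInt_Rplus, RInt_Rplus, RInt_Rplus, !RInt_Rmult.
  - rewrite RInt_poisson, RInt_abs_poisson_deviation, RInt_cos_circle, RInt_const_R by exact Hr.
    assert (E : (1 - cos_2atan r) / sin_2atan r = r) by (unfold cos_2atan, sin_2atan; field;
      split; nra).
    toR. transitivity (2 * PI * e * sin_2atan r + 2 * PI * e * (1 - e) * ((1 - cos_2atan r) /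
      sin_2atan r)
      - (2 * e - e ^ 2) * (8 * atan r)); [field; lra|].
    rewrite E. ring.
  all: cts.
Qed.

Lemma kernel_scale_ge_1 (r : R) : 0 <= r < 1 -> 1 <= kernel_scale r.
Proof.
  intros Hr. unfold kernel_scale. apply Rmult_le_reg_r with (1 - r ^ 2); [nra|].
  replace (sqrt (1 + r ^ 2) / (1 - r ^ 2) * (1 - r ^ 2)) with (sqrt (1 + r ^ 2)) by (field; nra).
  rewrite Rmult_1_l. apply Rle_trans with 1; [nra|].
  rewrite <- sqrt_1 at 1. apply sqrt_le_1_alt. nra.
Qed.

(** The three parts are [RInt_radial_deviation], [RInt_excess] and the inequality
    [excess_total_bound]. The factor kernel_scale^(- alpha) of the radial part cancels; in front
    of the excess it is at most 1. *)
Lemma kernel_L1_small (alpha r : R) : 0 < alpha <= 1 -> 0 < r < 1 ->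
  RInt (fun t => Cmod (boundary_kernel alpha r t - RtoC (cos_2atan r * / Rpower (kernel_scale r)
    alpha))%C) 0 (2 * PI)
  <= 8 * (Rpower 2 alpha * atan r).
Proof.
  intros Hal Hr0. assert (Hr : 0 <= r < 1) by lra. assert (Hs := cos_2atan_pos r Hr).
  assert (HPI := PI_RGT_0).
  set (kap := / Rpower (kernel_scale r) alpha).
  assert (HKa : 0 < Rpower (kernel_scale r) alpha) by apply exp_pos.
  assert (Hkap : 0 < kap) by (now apply Rinv_0_lt_compat).
  assert (Hkap1 : kap <= 1).
  { unfold kap. rewrite <- Rinv_1. apply Rinv_le_contravar; [lra|].
    rewrite <- (Rpower_O (kernel_scale r)) by (now apply kernel_scale_pos).
    apply Rle_Rpower; [|lra].
    now apply kernel_scale_ge_1. }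
  set (e := excess_slope alpha r).
  assert (Ck : forall t, continuous (poisson r) t) by (intros; now apply poisson_cont).
  assert (CX : forall t, continuous (fun t => poisson r t * sin_2atan r * excess_poly e (Rabs (cos
    t))) t).
  { unfold excess_poly. cts. }
  apply Rle_trans with
    (RInt (fun t => kap * cos_2atan r * Rabs (Rpower (poisson_ratio r t) (1 + alpha / 2) - 1)
       + kap * (poisson r t * sin_2atan r * excess_poly e (Rabs (cos t)))) 0 (2 * PI)).
  - apply RInt_le; [lra| | |].
    + apply ex_RInt_cont. cts.
    + apply ex_RInt_cont. unfold excess_poly. cts.
    + intros t _. assert (H := boundary_kernel_pointwise alpha r t Hal Hr). fold kap e in H. lra.
  - rewrite RInt_Rplus, !RInt_Rmult; [|exact CX| | |]; try (unfold excess_poly; cts; fail).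
    assert (H1 := RInt_radial_deviation alpha r ltac:(lra) Hr).
    rewrite RInt_excess by exact Hr0.
    set (a := atan r) in *.
    assert (HF := excess_total_bound alpha r (cos_2atan r) a e ltac:(lra) Hr eq_refl eq_refl
      eq_refl).
    assert (HX : 0 <= kap * cos_2atan r) by nra.
    assert (H2 := Rmult_le_compat_l _ _ _ HX H1).
    replace (kap * cos_2atan r * ((1 + alpha / 2) * Rpower (kernel_scale r) alpha * (8 * a /
      cos_2atan r))) with
      (8 * ((1 + alpha / 2) * a)) in H2 by (unfold kap; field; lra).
    set (X := 2 * PI * e * (sin_2atan r + r) - 16 * a * e + e ^ 2 * (8 * a - 2 * PI * r)).
    assert (EX : X = 8 * (e * (PI / 4 * r * (2 + cos_2atan r) - 2 * a) + e ^ 2 * (a - PI / 4 * r))).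
    { unfold X. assert (E : sin_2atan r + r = r * (2 + cos_2atan r)) by (unfold sin_2atan,
      cos_2atan; field; nra).
      rewrite E. field. }
    assert (HX0 : 0 <= X).
    { unfold X, a. rewrite <- RInt_excess by exact Hr0.
    apply RInt_ge_0; [lra|now apply ex_RInt_cont|].
      intros t _. assert (Hk : 0 <= Rabs (cos t) <= 1).
      { split; [apply Rabs_pos|]. apply Rabs_le, COS_bound. }
      assert (He : 0 < e).
      { apply Rdiv_lt_0_compat; [lra|]. apply Rmult_lt_0_compat; [lra|now apply sqrt_lt_R0]. }
      assert (Hp := poisson_pos r t Hr). assert (Hsr := sin_2atan_bounds r Hr).
      apply Rmult_le_pos; [apply Rmult_le_pos; lra|].
      assert (H := sqrt_le_chord_plus_excess e _ He Hk). fold (excess_poly e (Rabs (cos t))) in H.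
      assert (Rabs (cos t) <= sqrt (Rabs (cos t) ^ 2 + e ^ 2 * (1 - Rabs (cos t) ^ 2))).
      { rewrite <- (sqrt_pow2 (Rabs (cos t))) at 1 by lra. apply sqrt_le_1_alt.
        assert (0 <= e ^ 2 * (1 - Rabs (cos t) ^ 2)) by (apply Rmult_le_pos; [apply pow2_ge_0|nra]).
        lra. }
      lra. }
    assert (kap * X <= X) by nra. lra.
Qed.

(** On the segment c s = 1 + s (w - 1) the derivative of the power is dominated by the one of r
    (1 + s)^alpha, since |c s| <= 1 + s and alpha >= 1. *)
Lemma Cpow_rhp_near_1 (alpha r : R) (w : C) : 1 <= alpha -> 0 <= r < 1 ->
  Cmod (w - RtoC 1)%C = r -> Cmod (Cpow_rhp alpha w - RtoC 1)%C <= r * (Rpower 2 alpha - 1).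
Proof.
  intros Hal Hr Hw.
  set (c := fun s : R => (RtoC 1 + RtoC s * (w - RtoC 1))%C).
  assert (Hc : forall s, 0 <= s <= 1 -> 0 < Re (c s) /\ Cmod (c s) <= 1 + s).
  { intros s Hs. assert (Hre := re_le_Cmod (w - RtoC 1)%C). rewrite Hw in Hre.
    apply Rabs_le_between in Hre. unfold c. split.
    - simpl. simpl in Hre. unfold Re in Hre. destruct w as [x y]; simpl in *. nra.
    - eapply Rle_trans; [apply Cmod_triangle|].
      rewrite Cmod_1, Cmod_mult, Hw, Cmod_R, Rabs_pos_eq by lra. nra. }
  assert (Dc : forall s, is_Cderive c s (w - RtoC 1)%C).
  { intros s. unfold c. eapply is_Cderive_val.
    - apply is_Cderive_plus; [apply is_Cderive_const|].
    apply is_Cderive_mult; [|apply is_Cderive_const].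
      apply is_Cderive_RtoC, @is_derive_id.
    - cbv beta. unfold one; simpl. ring. }
  assert (DP : forall s, 0 <= s <= 1 -> is_Cderive (fun s => Cpow_rhp alpha (c s)) s
     (RtoC alpha * Cpow_rhp alpha (c s) / c s * (w - RtoC 1))%C).
  { intros s Hs. eapply is_Cderive_val.
    - apply (Cpow_rhp_wirtinger alpha (c s) (proj1 (Hc s Hs)) c s _ eq_refl (Dc s)).
    - ring. }
  assert (DY : forall s, 0 <= s <= 1 -> is_derive (fun s => r * Rpower (1 + s) alpha) s
     (r * (alpha * Rpower (1 + s) (alpha - 1)))).
  { intros s Hs. apply is_derive_scal_l. unfold Rpower. auto_derive; [lra|].
    replace ((alpha - 1) * ln (1 + s)) with (alpha * ln (1 + s) - ln (1 + s)) by ring.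
    unfold Rminus. rewrite exp_plus, exp_Ropp, exp_ln by lra. ring. }
  assert (H := Cmod_increment_le (fun s => Cpow_rhp alpha (c s))
    (fun s => RtoC alpha * Cpow_rhp alpha (c s) / c s * (w - RtoC 1))%C
    (fun s => r * Rpower (1 + s) alpha) (fun s => r * (alpha * Rpower (1 + s) (alpha - 1))) 0 1).
  cbv beta in H.
  assert (E1 : c 1 = w) by (unfold c; ring).
  assert (E0 : c 0 = RtoC 1) by (unfold c; ring).
  rewrite E1, E0, Cpow_rhp_1 in H.
  replace (r * (Rpower 2 alpha - 1)) with (r * Rpower (1 + 1) alpha - r * Rpower (1 + 0) alpha).
  2:{ rewrite Rplus_0_r. replace (Rpower 1 alpha) with 1
        by (unfold Rpower; rewrite ln_1, Rmult_0_r, exp_0; reflexivity).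
      replace (1 + 1) with 2 by ring. ring. }
  apply H; clear H.
  - lra.
  - intros s Hs. apply DP. lra.
  - intros s Hs. exact (is_Cderive_continuous _ _ _ (DP s Hs)).
  - intros s Hs. apply DY. lra.
  - intros s Hs. apply (@ex_derive_continuous R_AbsRing R_NormedModule). eexists. now apply DY.
  - intros s Hs. destruct (Hc s ltac:(lra)) as [Hp Hm].
    assert (Hnz := Re_pos_neq_0 _ Hp). assert (HM := proj1 (Cmod_gt_0 _) Hnz).
    rewrite Cmod_mult, Hw, Cmod_div, Cmod_mult, Cmod_R, Rabs_pos_eq by (assumption || lra).
    rewrite Cmod_Cpow_rhp by exact Hp.
    replace (alpha * Rpower (Cmod (c s)) alpha / Cmod (c s)) with
      (alpha * Rpower (Cmod (c s)) (alpha - 1)).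
    2:{ unfold Rminus. rewrite Rpower_plus, Rpower_Ropp, Rpower_1 by exact HM. field. lra. }
    rewrite Rmult_comm. apply Rmult_le_compat_l; [lra|]. apply Rmult_le_compat_l; [lra|].
    apply Rle_Rpower_l; lra.
Qed.

Lemma mobius_factor_minus_1 (r th : R) : 0 <= r < 1 -> Cmod (mobius_factor r th - RtoC 1)%C = r.
Proof.
  intros Hr. assert (HD := poisson_den_pos r th Hr).
  assert (E : Cmod (mobius_factor r th - RtoC 1)%C ^ 2 = r ^ 2).
  { rewrite Cmod2_alt. unfold mobius_factor; simpl. unfold Re, Im; simpl.
    assert (Es := sin2_eq th).
    transitivity (((((1 - r ^ 2) * (1 - r * cos th) - poisson_den r th) ^ 2
       + (1 - r ^ 2) ^ 2 * r ^ 2 * sin th ^ 2)) / poisson_den r th ^ 2); [field; lra|].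
    rewrite Es.
    replace (((1 - r ^ 2) * (1 - r * cos th) - poisson_den r th) ^ 2
       + (1 - r ^ 2) ^ 2 * r ^ 2 * (1 - cos th ^ 2)) with (r ^ 2 * poisson_den r th ^ 2)
      by (unfold poisson_den; ring).
    field. lra. }
  assert (H := Cmod_ge_0 (mobius_factor r th - RtoC 1)%C).
  apply Rle_antisym; apply le_of_sqr_le; lra.
Qed.

(** The factor w^alpha is 1 up to an error r (2^alpha - 1), by [Cpow_rhp_near_1]. After
    integration this error is paid for by r <= (4 / pi) atan r. *)
Lemma kernel_L1_large (alpha r : R) : 1 <= alpha -> 0 <= r < 1 ->
  RInt (fun t => Cmod (boundary_kernel alpha r t - RtoC (cos_2atan r))%C) 0 (2 * PI)
  <= 8 * (Rpower 2 alpha * atan r).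
Proof.
  intros Hal Hr. assert (HPI := PI_RGT_0).
  set (M := r * (Rpower 2 alpha - 1)).
  assert (Ck : forall t, continuous (poisson r) t) by (intros; now apply poisson_cont).
  apply Rle_trans with (RInt (fun t => Rabs (poisson r t - cos_2atan r) + M * poisson r t) 0 (2 *
    PI)).
  - apply RInt_le; [lra| | |].
    + apply ex_RInt_cont. cts.
    + apply ex_RInt_cont. cts.
    + intros t _. unfold boundary_kernel. assert (Hp := poisson_pos r t Hr).
      replace (RtoC (poisson r t) * Cpow_rhp alpha (mobius_factor r t) - RtoC (cos_2atan r))%C with
        (RtoC (poisson r t - cos_2atan r) + RtoC (poisson r t) * (Cpow_rhp alpha (mobius_factor r
          t) - RtoC 1))%C
        by (rewrite RtoC_minus; ring).
      eapply Rle_trans; [apply Cmod_triangle|].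
      rewrite Cmod_mult, !Cmod_R, (Rabs_pos_eq (poisson r t)) by lra.
      apply Rplus_le_compat_l. rewrite (Rmult_comm M). apply Rmult_le_compat_l; [lra|].
      apply Cpow_rhp_near_1; [exact Hal|exact Hr|now apply mobius_factor_minus_1].
  - rewrite RInt_Rplus, RInt_Rmult, RInt_abs_poisson_deviation, RInt_poisson by (assumption || cts).
    assert (Hc := atan_chord r ltac:(lra)). unfold M.
    assert (H2 : 1 <= Rpower 2 alpha).
    { rewrite <- (Rpower_O 2) by lra. apply Rle_Rpower; lra. }
    assert (H3 := Rmult_le_compat_l (Rpower 2 alpha - 1) _ _ ltac:(lra) Hc). lra.
Qed.

(** As the boundary function has mean zero, any constant may be subtracted from the kernel. The
    bound is 2 pi 2^alpha (4 / pi) atan r. For 0 < alpha < 1 the inequality |w^alpha - 1| <= r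
    (2^alpha - 1) used for large alpha is wrong at w = 1 - r, which is why this range is treated
    separately. *)
Theorem kernel_L1 (alpha r : R) : 0 <= alpha -> 0 <= r < 1 -> exists c : R,
  RInt (fun t => Cmod (boundary_kernel alpha r t - RtoC c)%C) 0 (2 * PI)
  <= 8 * (Rpower 2 alpha * atan r).
Proof.
  intros Hal Hr.
  destruct (Req_dec r 0) as [E|E].
  { exists 1. subst r. rewrite (RInt_ext_R _ (fun _ => 0)).
    - rewrite RInt_const_R, atan_0. lra.
    - intros t _. unfold boundary_kernel, poisson, mobius_factor, poisson_den.
      replace ((1 - 0 ^ 2) / (1 + 0 ^ 2 - 2 * 0 * cos t)) with 1 by field.
      replace ((1 - 0 ^ 2) * (1 - 0 * cos t) / (1 + 0 ^ 2 - 2 * 0 * cos t)) with 1 by field.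
      replace ((1 - 0 ^ 2) * (0 * sin t) / (1 + 0 ^ 2 - 2 * 0 * cos t)) with 0 by field.
      change (1, 0) with (RtoC 1). rewrite Cpow_rhp_1.
      replace (RtoC 1 * RtoC 1 - RtoC 1)%C with (RtoC 0) by ring. apply Cmod_0. }
  destruct (Rle_dec 1 alpha) as [H1|H1].
  { exists (cos_2atan r). now apply kernel_L1_large. }
  destruct (Req_dec alpha 0) as [E0|E0].
  { exists (cos_2atan r). subst alpha.
    rewrite (RInt_ext_R _ (fun t => Rabs (poisson r t - cos_2atan r))).
    - rewrite RInt_abs_poisson_deviation by exact Hr. rewrite Rpower_O by lra. lra.
    - intros t _. unfold boundary_kernel, Cpow_rhp. rewrite !Rmult_0_l, exp_0.
      replace (cis 0) with (RtoC 1) by (unfold cis; now rewrite cos_0, sin_0).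
      rewrite <- Cmod_R. f_equal. rewrite RtoC_minus. ring. }
  eexists. apply kernel_L1_small; lra.
Qed.

(** * Trigonometric moments and smoothing by rotations *)

Lemma Cmod_minus_le (x y : C) : Cmod (x - y)%C <= Cmod x + Cmod y.
Proof. unfold Cminus. rewrite <- (Cmod_opp y). apply Cmod_triangle. Qed.

(** A class of functions closed under differentiation, so that smoothness of all orders needs a
    single differentiation. *)
Inductive trig : (R -> R) -> Prop :=
| trig_const c : trig (fun _ => c)
| trig_cos : trig cos
| trig_sin : trig sin
| trig_plus u v : trig u -> trig v -> trig (fun t => u t + v t)
| trig_mult u v : trig u -> trig v -> trig (fun t => u t * v t).

Lemma trig_derive (u : R -> R) : trig u ->
  exists v, trig v /\ forall t, is_derive u t (v t).
Proof.
  induction 1 as [c| | |u v _ [u' [Tu Du]] _ [v' [Tv Dv]]|u v Tu0 [u' [Tu Du]] Tv0 [v' [Tv Dv]]].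
  - exists (fun _ => 0). split; [constructor|]. intros t. apply @is_derive_const.
  - exists (fun t => -1 * sin t). split; [repeat constructor|].
    intros t. eapply is_derive_val; [apply is_derive_cos|ring].
  - exists cos. split; [constructor|]. intros t. apply is_derive_sin.
  - exists (fun t => u' t + v' t). split; [now constructor|].
    intros t. now apply @is_derive_plus.
  - exists (fun t => u' t * v t + u t * v' t). split; [repeat constructor; assumption|].
    intros t. apply @is_derive_mult; auto. exact Rmult_comm.
Qed.

Lemma trig_derive_n (u : R -> R) (n : nat) : trig u ->
  exists v, trig v /\ forall t, Derive_n u n t = v t.
Proof.
  intros Hu. induction n as [|n [v [Tv Ev]]].
  - exists u. split; [exact Hu|reflexivity].
  - destruct (trig_derive v Tv) as [v' [Tv' Dv]]. exists v'. split; [exact Tv'|].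
    intros t. simpl. rewrite (Derive_ext _ v) by exact Ev. now apply is_derive_unique.
Qed.

Lemma trig_Cm (u : R -> R) (m : nat) : trig u -> Cm_R m u.
Proof.
  intros Hu k _ t. split.
  - destruct k as [|k]; [exact I|]. simpl.
    destruct (trig_derive_n u k Hu) as [v [Tv Ev]].
    destruct (trig_derive v Tv) as [v' [_ Dv]].
    apply ex_derive_ext with v; [intros; symmetry; apply Ev|]. eexists; apply Dv.
  - destruct (trig_derive_n u k Hu) as [v [Tv Ev]].
    destruct (trig_derive v Tv) as [v' [_ Dv]].
    apply continuous_ext with v; [intros; symmetry; apply Ev|].
    apply (@ex_derive_continuous R_AbsRing R_NormedModule). eexists; apply Dv.
Qed.

Lemma trig_pow (u : R -> R) (n : nat) : trig u -> trig (fun t => u t ^ n).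
Proof.
  intros Hu. induction n as [|n IH]; simpl; [constructor|now constructor].
Qed.

Lemma trig_monomial (a b : nat) : trig (fun t => cos t ^ a * sin t ^ b).
Proof. apply trig_mult; apply trig_pow; constructor. Qed.

Definition monomial (a b : nat) (w : C) : C := RtoC (Re w ^ a * Im w ^ b).

Lemma monomial_Cinfty (a b : nat) : Cinfty_circle (monomial a b).
Proof.
  intros m. split; apply trig_Cm.
  - apply trig_monomial.
  - exact (trig_const 0).
Qed.

(** If w = e^{i tau}, the last factor is ((1 + cos (s - tau)) / 2)^N. In this form it is a
    polynomial in Re w and Im w, defined on the whole plane. *)
Definition trig_weight (a b N : nat) (w : C) (s : R) : R :=
  cos s ^ a * sin s ^ b * ((1 + (Re w * cos s + Im w * sin s)) / 2) ^ N.

Definition trig_moment (a b N : nat) (w : C) (u : R -> C) : C :=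
  CInt (fun s => RtoC (trig_weight a b N w s) * u s)%C 0 (2 * PI).

Lemma trig_weight_cont (a b N : nat) (w : C) (t : R) : continuous (trig_weight a b N w) t.
Proof. unfold trig_weight. cts. Qed.
#[export] Hint Resolve trig_weight_cont : cts.

(** By this recursion every moment is a polynomial in Re w and Im w whose coefficients are the
    integrals of [u] against finitely many monomials in cos and sin. *)
Lemma trig_moment_S (a b N : nat) (w : C) (u : R -> C) : (forall t, continuous u t) ->
  trig_moment a b (S N) w u =
  (RtoC (/ 2) * trig_moment a b N w u +
   (RtoC (Re w / 2) * trig_moment (S a) b N w u + RtoC (Im w / 2) * trig_moment a (S b) N w u))%C.
Proof.
  intros Hu. unfold trig_moment.
  rewrite <- !CInt_cmul by cts. rewrite <- !CInt_plus by cts.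
  apply CInt_ext. intros s. unfold trig_weight. simpl. rewrite !RtoC_mult. unfold Rdiv.
    rewrite !RtoC_mult, !RtoC_plus, !RtoC_mult. ring.
Qed.

Lemma trig_moment_0 (a b : nat) (w : C) (u : R -> C) :
  trig_moment a b 0 w u = CInt (fun s => u s * monomial a b (cis s))%C 0 (2 * PI).
Proof.
  unfold trig_moment. apply CInt_ext. intros s. unfold trig_weight, monomial. simpl.
  rewrite Rmult_1_r. ring.
Qed.

Lemma trig_moment_cont (N : nat) : forall (a b : nat) (u : R -> C) (w : C),
  (forall t, continuous u t) -> continuous (fun w => trig_moment a b N w u) w.
Proof.
  induction N as [|N IH]; intros a b u w Hu.
  - apply continuous_ext with (fun _ : C => CInt (fun s => u s * monomial a b (cis s))%C 0 (2 *
    PI)).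
    + intros v. symmetry. apply trig_moment_0.
    + apply continuous_const.
  - eapply continuous_ext.
    + intros v. symmetry. apply trig_moment_S. exact Hu.
    + assert (I1 := IH a b u w Hu). assert (I2 := IH (S a) b u w Hu).
    assert (I3 := IH a (S b) u w Hu).
      cts; lra.
Qed.

Lemma Cmod_proj_bounds (z : C) : Rabs (Re z) <= Cmod z /\ Rabs (Im z) <= Cmod z.
Proof.
  split; [apply re_le_Cmod|].
  assert (E := Cmod2_alt z). apply le_of_sqr_le; [apply Cmod_ge_0|].
  rewrite pow2_abs, E. generalize (pow2_ge_0 (Re z)). lra.
Qed.

Lemma near_1_and (P Q : R -> Prop) :
  (exists d, 0 < d /\ forall R, 1 - d < R < 1 -> P R) ->
  (exists d, 0 < d /\ forall R, 1 - d < R < 1 -> Q R) ->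
  (exists d, 0 < d /\ forall R, 1 - d < R < 1 -> P R /\ Q R).
Proof.
  intros [d1 [H1 A]] [d2 [H2 B]]. exists (Rmin d1 d2). split; [now apply Rmin_pos|].
  intros R HR. generalize (Rmin_l d1 d2) (Rmin_r d1 d2). intros.
  split; [apply A|apply B]; lra.
Qed.

(** The coefficients of the moments converge because the dilates converge as distributions.
    There are finitely many of them, hence the convergence is uniform in w. *)
Lemma trig_moment_uniform (f fs : C -> C) :
  (forall z, unit_disc z -> continuous f z) ->
  (forall t, continuous (fun s => fs (cis s)) t) ->
  boundary_values f fs ->
  forall (N a b : nat) (e : R), 0 < e -> exists d, 0 < d /\
    forall R, 1 - d < R < 1 -> (0 < R -> forall w, Cmod w <= 1 ->
      Cmod (trig_moment a b N w (fun s => f (polar R s)) - trig_moment a b N w (fun s => fs (cis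
        s)))%C <= e).
Proof.
  intros Cf Cfs [Hbv _]. induction N as [|N IH]; intros a b e He.
  - assert (HL := Hbv _ (monomial_Cinfty a b)).
    assert (HPI := PI_RGT_0).
    set (L := circle_pairing fs (monomial a b)) in *.
    assert (HP : locally L (fun z => Cmod (z - L)%C < e / (2 * PI))).
    { apply (continuous_Cmod_small (fun z => z) L); [apply continuous_id|].
      apply Rdiv_lt_0_compat; lra. }
    destruct (HL _ HP) as [d Hd]. exists d. split; [apply cond_pos|].
    intros R HR _ w _.
    assert (Hb : ball 1 d R).
    { change (Rabs (R - 1) < d). apply Rabs_def1; lra. }
    specialize (Hd R Hb ltac:(lra)). rewrite !trig_moment_0.
    unfold L, circle_pairing in Hd.
    match type of Hd with Cmod (?k * ?A - ?k * ?B)%C < _ =>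
      replace (k * A - k * B)%C with (k * (A - B))%C in Hd by ring end.
    rewrite Cmod_mult, Cmod_R, Rabs_pos_eq in Hd by (left; apply Rinv_0_lt_compat; lra).
    left. apply Rmult_lt_reg_l with (/ (2 * PI)); [apply Rinv_0_lt_compat; lra|].
    eapply Rlt_le_trans; [exact Hd|]. right. field. lra.
  - destruct (near_1_and _ _ (IH a b e He) (near_1_and _ _ (IH (S a) b (e / 2) ltac:(lra))
      (IH a (S b) (e / 2) ltac:(lra)))) as [d [Hd H]].
    exists d. split; [exact Hd|]. intros R HR HR0 w Hw.
    destruct (H R HR) as [H1 [H2 H3]].
    specialize (H1 HR0 w Hw). specialize (H2 HR0 w Hw). specialize (H3 HR0 w Hw).
    assert (Cu : forall t, continuous (fun s => f (polar R s)) t).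
    { cts. apply Cf, polar_disc. rewrite Rabs_pos_eq; lra. }
    rewrite !trig_moment_S by assumption.
    match goal with |- Cmod (?p * ?A1 + (?q * ?A2 + ?r * ?A3) - (?p * ?B1 + (?q * ?B2 + ?r *
      ?B3)))%C <= _ =>
      replace (p * A1 + (q * A2 + r * A3) - (p * B1 + (q * B2 + r * B3)))%C with
        (p * (A1 - B1) + (q * (A2 - B2) + r * (A3 - B3)))%C by ring end.
    eapply Rle_trans; [apply Cmod_triangle|].
    destruct (Cmod_proj_bounds w) as [HR1 HI1].
    eapply Rle_trans; [apply Rplus_le_compat_l, Cmod_triangle|].
    rewrite !Cmod_mult, !Cmod_R.
    assert (A1 : Rabs (/ 2) = / 2) by (apply Rabs_pos_eq; lra).
    assert (A2 : Rabs (Re w / 2) <= / 2).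
    { unfold Rdiv. rewrite Rabs_mult, A1. lra. }
    assert (A3 : Rabs (Im w / 2) <= / 2).
    { unfold Rdiv. rewrite Rabs_mult, A1. lra. }
    rewrite A1.
    assert (T2 := Rmult_le_compat _ _ _ _ (Rabs_pos (Re w / 2)) (Cmod_ge_0 _) A2 H2).
    assert (T3 := Rmult_le_compat _ _ _ _ (Rabs_pos (Im w / 2)) (Cmod_ge_0 _) A3 H3).
    lra.
Qed.

(** Being a trigonometric polynomial, this kernel tests the boundary distribution through
    finitely many numbers only; as [N] grows, its mass concentrates at 0. *)
Definition smoothing_kernel (N : nat) (s : R) : R := ((1 + cos s) / 2) ^ N.
Definition smoothing_mass (N : nat) : R := RInt (smoothing_kernel N) 0 (2 * PI).
Definition smoothed (N : nat) (u : R -> C) (tau : R) : C :=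
  CInt (fun s => RtoC (smoothing_kernel N s) * u (s + tau)%R)%C 0 (2 * PI).

Lemma smoothing_kernel_cont (N : nat) (t : R) : continuous (smoothing_kernel N) t.
Proof. unfold smoothing_kernel. cts. Qed.
#[export] Hint Resolve smoothing_kernel_cont : cts.

Lemma smoothing_kernel_nonneg (N : nat) (t : R) : 0 <= smoothing_kernel N t.
Proof. apply pow_le. generalize (COS_bound t). lra. Qed.

Lemma smoothing_mass_nonneg (N : nat) : 0 <= smoothing_mass N.
Proof.
  apply RInt_ge_0; [exact twoPI_pos|apply ex_RInt_cont, smoothing_kernel_cont|intros;
    apply smoothing_kernel_nonneg].
Qed.

Lemma smoothed_eq_trig_moment (N : nat) (u : R -> C) (tau : R) :
  (forall t, continuous u t) -> (forall t, u (t + 2 * PI) = u t) ->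
  smoothed N u tau = trig_moment 0 0 N (cis tau) u.
Proof.
  intros Hu Hp. unfold smoothed, trig_moment.
  rewrite <- (CInt_periodic_shift (fun s => RtoC (trig_weight 0 0 N (cis tau) s) * u s)%C tau).
  - apply CInt_ext. intros s. do 2 f_equal. unfold trig_weight, smoothing_kernel. simpl.
  rewrite !Rmult_1_l.
    do 3 f_equal.
    replace (cos tau * cos (s + tau) + sin tau * sin (s + tau)) with (cos (s + tau - tau)).
    + f_equal; ring.
    + rewrite cos_minus. ring.
  - cts.
  - intros t. rewrite Hp. f_equal. f_equal. unfold trig_weight.
    now rewrite cos_plus, sin_plus, cos_2PI, sin_2PI, !Rmult_1_r, !Rmult_0_r, Rminus_0_r, Rplus_0_r.
Qed.

Lemma smoothed_bound (N : nat) (u : R -> C) (tau S : R) :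
  (forall t, continuous u t) -> (forall t, Cmod (u t) <= S) ->
  Cmod (smoothed N u tau) <= smoothing_mass N * S.
Proof.
  intros Hu HS. unfold smoothed, smoothing_mass. rewrite (Rmult_comm (RInt _ _ _)).
  rewrite <- RInt_Rmult by apply smoothing_kernel_cont.
  apply Cmod_CInt_le.
  - exact twoPI_pos.
  - cts.
  - apply ex_RInt_cont. cts.
  - intros t _. rewrite Cmod_mult, Cmod_R, Rabs_pos_eq by apply smoothing_kernel_nonneg.
    rewrite Rmult_comm. apply Rmult_le_compat_r; [apply smoothing_kernel_nonneg|apply HS].
Qed.

Lemma smoothed_mean_zero (N : nat) (u : R -> C) (tau : R) :
  (forall t, continuous u t) -> (forall t, u (t + 2 * PI) = u t) ->
  CInt u 0 (2 * PI) = RtoC 0 ->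
  CInt (fun th => smoothed N u (tau + th)%R) 0 (2 * PI) = RtoC 0.
Proof.
  intros Hu Hp H0. unfold smoothed.
  rewrite (CInt_fubini (fun th s => RtoC (smoothing_kernel N s) * u (s + (tau + th))%R)%C);
    [|exact twoPI_pos|exact twoPI_pos|].
  - rewrite (CInt_ext _ (fun _ => RtoC 0)).
    + rewrite CInt_const. ring.
    + intros s. rewrite CInt_cmul.
      * rewrite (CInt_ext _ (fun x => u (x + (s + tau))%R)) by (intros; f_equal; ring).
        rewrite CInt_periodic_shift by assumption. rewrite H0. ring.
      * cts.
  - cts.
Qed.

Lemma continuous_bounded (u : R -> C) (a b : R) : a <= b -> (forall t, continuous u t) ->
  exists M, 0 <= M /\ forall t, a <= t <= b -> Cmod (u t) <= M.
Proof.
  intros Hab Hu.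
  destruct (continuity_ab_maj (fun t => Cmod (u t)) a b Hab) as [m [Hm _]].
  - intros c _. apply continuity_pt_filterlim. apply continuous_Cmod_fun, Hu.
  - exists (Cmod (u m)). split; [apply Cmod_ge_0|exact Hm].
Qed.

(** The normalised kernels are an approximate identity: with a = (1 + cos d) / 2 < b = (1 + cos
    (d / 2)) / 2, they are at most a^N off the interval |s| < d before normalisation, while
    their mass is at least (d / 2) b^N. *)
Lemma bound_from_smoothed (u : R -> C) (B : R) :
  (forall t, continuous u t) -> (forall t, u (t + 2 * PI) = u t) ->
  (forall N, Cmod (smoothed N u 0) <= smoothing_mass N * B) -> Cmod (u 0) <= B.
Proof.
  intros Hu Hp HB. assert (HPI := PI_RGT_0).
  destruct (continuous_bounded u 0 (2 * PI) ltac:(lra) Hu) as [M [HM0 HM]].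
  apply le_epsilon. intros eps Heps.
  assert (Hd : exists d, 0 < d < PI /\ forall s, Rabs s < d -> Cmod (u s - u 0)%C < eps / 2).
  { destruct (continuous_Cmod_small u 0 (eps / 2) (Hu 0) ltac:(lra)) as [d Hd].
  exists (Rmin d (PI / 2)). split.
    - split; [apply Rmin_pos; [apply cond_pos|lra]|].
      generalize (Rmin_r d (PI / 2)). lra.
    - intros s Hs. apply Hd. change (Rabs (s - 0) < d). rewrite Rminus_0_r.
      generalize (Rmin_l d (PI / 2)). lra. }
  destruct Hd as [d [Hd1 Hd2]].
  set (a := (1 + cos d) / 2). set (b := (1 + cos (d / 2)) / 2).
  assert (Hcd : cos d < cos (d / 2)) by (apply cos_decreasing_1; lra).
  assert (Hca := COS_bound d).
  assert (Hab : 0 <= a < b) by (unfold a, b; lra).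
  assert (Hbpos : 0 < b) by lra.
  assert (HcN : forall N, d / 2 * b ^ N <= smoothing_mass N).
  { intros N. unfold smoothing_mass.
    assert (Ex : forall x y, ex_RInt (smoothing_kernel N) x y) by (intros;
      apply ex_RInt_cont, smoothing_kernel_cont).
    rewrite <- (RInt_Chasles _ 0 (d / 2) (2 * PI)) by apply Ex.
    assert (H1 : 0 <= RInt (smoothing_kernel N) (d / 2) (2 * PI)).
    { apply RInt_ge_0; [lra|apply Ex|]. intros; apply smoothing_kernel_nonneg. }
    assert (H2 : d / 2 * b ^ N <= RInt (smoothing_kernel N) 0 (d / 2)).
    { replace (d / 2 * b ^ N) with (RInt (fun _ => b ^ N) 0 (d / 2)).
      - apply RInt_le; [lra|apply ex_RInt_const|apply Ex|].
        intros x Hx. unfold smoothing_kernel. apply pow_incr. split; [lra|]. unfold b.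
        assert (cos (d / 2) <= cos x) by (apply cos_decr_1; lra). lra.
      - rewrite RInt_const_R. toR. ring. }
    unfold plus; simpl. lra. }
  assert (Hest : forall N, smoothing_mass N * Cmod (u 0) <=
    smoothing_mass N * B + (smoothing_mass N * (eps / 2) + 4 * PI * M * a ^ N)).
  { intros N.
    assert (E : (RtoC (smoothing_mass N) * u 0)%C = (smoothed N u 0 - CInt (fun s => RtoC
      (smoothing_kernel N s) * (u s - u 0)) 0 (2 * PI))%C).
    { rewrite (CInt_ext (fun s => RtoC (smoothing_kernel N s) * (u s - u 0))%C
        (fun s => RtoC (smoothing_kernel N s) * u s - u 0 * RtoC (smoothing_kernel N s))%C) by
          (intros; ring).
      rewrite CInt_minus by cts. rewrite CInt_cmul by cts.
      replace (CInt (fun t => RtoC (smoothing_kernel N t)) 0 (2 * PI)) with (RtoC (smoothing_mass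
        N)).
      - unfold smoothed. rewrite (CInt_ext (fun s => RtoC (smoothing_kernel N s) * u (s + 0)%R)%C
          (fun s => RtoC (smoothing_kernel N s) * u s)%C) by (intros; now rewrite Rplus_0_r). ring.
      - unfold CInt, RtoC, smoothing_mass. simpl. f_equal. symmetry. rewrite RInt_const_R. ring. }
    rewrite <- (Rabs_pos_eq (smoothing_mass N)) at 1 by apply smoothing_mass_nonneg.
    rewrite <- Cmod_R, <- Cmod_mult, E.
    eapply Rle_trans; [apply Cmod_minus_le|].
    apply Rplus_le_compat; [apply HB|].
    replace (smoothing_mass N * (eps / 2) + 4 * PI * M * a ^ N) with
      (RInt (fun s => eps / 2 * smoothing_kernel N s + 2 * M * a ^ N) 0 (2 * PI)).
    2:{ rewrite RInt_Rplus, RInt_Rmult, RInt_const_R by cts. fold (smoothing_mass N). toR. ring. }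
    apply Cmod_CInt_le.
    - lra.
    - cts.
    - apply ex_RInt_cont. cts.
    - intros s Hs. rewrite Cmod_mult, Cmod_R, Rabs_pos_eq by apply smoothing_kernel_nonneg.
      assert (Hk := smoothing_kernel_nonneg N s). assert (HaN : 0 <= a ^ N) by (apply pow_le; lra).
      destruct (Rle_dec (cos s) (cos d)) as [Hc|Hc].
      + assert (K : smoothing_kernel N s <= a ^ N).
        { apply pow_incr. generalize (COS_bound s). unfold a. lra. }
        assert (HU : Cmod (u s - u 0)%C <= 2 * M).
        { eapply Rle_trans; [apply Cmod_minus_le|].
          generalize (HM s Hs) (HM 0 ltac:(lra)). lra. }
        assert (H := Rmult_le_compat _ _ _ _ Hk (Cmod_ge_0 _) K HU).
        assert (0 <= eps / 2 * smoothing_kernel N s) by (apply Rmult_le_pos; lra).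
        lra.
      + assert (HU : Cmod (u s - u 0)%C < eps / 2).
        { destruct (Rlt_dec s d) as [H1|H1].
          - apply Hd2. rewrite Rabs_pos_eq; lra.
          - destruct (Rlt_dec (2 * PI - d) s) as [H2|H2].
            + replace (u s) with (u (s - 2 * PI)) by (rewrite <- (Hp (s - 2 * PI)); f_equal; ring).
              apply Hd2. apply Rabs_def1; lra.
            + exfalso. apply Hc. destruct (Rle_dec s PI).
              * apply cos_decr_1; lra.
              * replace (cos s) with (cos (2 * PI - s)).
                -- apply cos_decr_1; lra.
                -- rewrite cos_minus, cos_2PI, sin_2PI. ring. }
        assert (H := Rmult_le_compat_l _ _ _ Hk (Rlt_le _ _ HU)).
        assert (0 <= 2 * M * a ^ N) by (apply Rmult_le_pos; lra). lra. }
  assert (Hq : Rabs (a / b) < 1).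
  { rewrite Rabs_pos_eq by (apply Rdiv_le_0_compat; lra).
    apply Rmult_lt_reg_r with b; [lra|]. unfold Rdiv. rewrite Rmult_assoc, Rinv_l by lra. lra. }
  set (Q := 4 * PI * M + 1).
  assert (HQ : 0 < Q) by (unfold Q; assert (0 <= 4 * PI * M) by (apply Rmult_le_pos; lra); lra).
  destruct (pow_lt_1_zero _ Hq (d / 2 * (eps / 2) / Q)) as [N HN].
  { apply Rdiv_lt_0_compat; [|exact HQ]. apply Rmult_lt_0_compat; lra. }
  specialize (HN N (Nat.le_refl N)). specialize (HcN N). specialize (Hest N).
  assert (HbN : 0 < b ^ N) by (apply pow_lt; lra).
  assert (HaN : 0 <= a ^ N) by (apply pow_le; lra).
  unfold Rdiv at 1 in HN. rewrite Rpow_mult_distr, pow_inv in HN.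
  rewrite Rabs_pos_eq in HN by (apply Rmult_le_pos; [exact HaN|left; now apply Rinv_0_lt_compat]).
  assert (H1 : Q * a ^ N <= d / 2 * b ^ N * (eps / 2)).
  { apply Rmult_lt_compat_r with (r := Q * b ^ N) in HN; [|now apply Rmult_lt_0_compat].
    replace (a ^ N * / b ^ N * (Q * b ^ N)) with (Q * a ^ N) in HN by (field; lra).
    replace (d / 2 * (eps / 2) / Q * (Q * b ^ N)) with (d / 2 * b ^ N * (eps / 2)) in HN by
      (field; lra).
    lra. }
  assert (HcNp : 0 < smoothing_mass N).
  { eapply Rlt_le_trans; [|exact HcN]. apply Rmult_lt_0_compat; lra. }
  assert (H2 : d / 2 * b ^ N * (eps / 2) <= smoothing_mass N * (eps / 2)) by (apply
    Rmult_le_compat_r; lra).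
  apply Rmult_le_reg_l with (smoothing_mass N); [exact HcNp|].
  unfold Q in H1. lra.
Qed.

(** * The integral over the unit circle *)

Lemma polar_unit (w : C) : Cmod w = 1 -> exists t, - PI <= t <= PI /\ w = cis t.
Proof.
  intros Hw. assert (E := Cmod2_alt w). rewrite Hw in E.
  destruct w as [x y]. simpl in E.
  assert (Hx : -1 <= x <= 1) by nra.
  assert (Hs : sin (acos x) = sqrt (1 - x ^ 2)).
  { rewrite sin_acos by exact Hx. f_equal. unfold Rsqr. ring. }
  assert (Ey : y ^ 2 = 1 - x ^ 2) by (simpl; lra).
  destruct (Rle_dec 0 y) as [Hy|Hy].
  - exists (acos x). generalize (acos_bound x) PI_RGT_0; intros. split; [lra|]. unfold cis.
  rewrite cos_acos, Hs, <- Ey, sqrt_pow2 by assumption. reflexivity.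
  - exists (- acos x). generalize (acos_bound x) PI_RGT_0; intros. split; [lra|]. unfold cis.
  rewrite cos_neg, sin_neg, cos_acos, Hs, <- Ey by assumption.
    f_equal. replace (y ^ 2) with ((- y) ^ 2) by ring. rewrite sqrt_pow2 by lra. ring.
Qed.

Lemma cis_plus (s t : R) : cis (s + t) = (cis s * cis t)%C.
Proof.
  unfold cis, Cmult; simpl. rewrite cos_plus, sin_plus. f_equal; ring.
Qed.

Lemma Cmod_pos_neq (z : C) : 0 < Cmod z -> z <> 0%C.
Proof. intros H E. rewrite E, Cmod_0 in H. lra. Qed.

Lemma cis_2atan (A B : R) : 0 < A ->
  cis (2 * atan (B / A)) = ((A, B) * (A, B) / RtoC (A ^ 2 + B ^ 2))%C.
Proof.
  intros HA. set (x := B / A).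
  assert (Hc : cos (atan x) = / sqrt (1 + x²)) by (rewrite cos_atan; unfold Rdiv; ring).
  assert (Hs : sin (atan x) = x / sqrt (1 + x²)) by apply sin_atan.
  assert (Hn : 0 < 1 + x²) by (generalize (Rle_0_sqr x); lra).
  assert (Hq := sqrt_lt_R0 _ Hn). assert (Hqq := sqrt_sqrt _ (Rlt_le _ _ Hn)).
  assert (Hq2 : / sqrt (1 + x²) * / sqrt (1 + x²) = / (1 + x²)).
  { rewrite <- Rinv_mult, Hqq. reflexivity. }
  assert (Ex : 1 + x² = (A ^ 2 + B ^ 2) / A ^ 2) by (unfold x, Rsqr; field; lra).
  assert (HD : 0 < A ^ 2 + B ^ 2) by nra.
  assert (C2 : cos (2 * atan x) = (A ^ 2 - B ^ 2) / (A ^ 2 + B ^ 2)).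
  { rewrite cos_2a, Hc, Hs.
    transitivity ((1 - x * x) * (/ sqrt (1 + x²) * / sqrt (1 + x²))); [unfold Rdiv; ring|].
    rewrite Hq2, Ex. unfold x. field. lra. }
  assert (S2 : sin (2 * atan x) = 2 * A * B / (A ^ 2 + B ^ 2)).
  { rewrite sin_2a, Hc, Hs.
    transitivity (2 * x * (/ sqrt (1 + x²) * / sqrt (1 + x²))); [unfold Rdiv; ring|].
    rewrite Hq2, Ex. unfold x. field. lra. }
  unfold cis. rewrite C2, S2. unfold Cdiv, Cmult, Cinv, RtoC; simpl.
  f_equal; field; nra.
Qed.

Lemma Cmult_reg_l (a x y : C) : a <> 0%C -> (a * x = a * y)%C -> x = y.
Proof.
  intros Ha H. transitivity (/ a * (a * x))%C; [field; exact Ha|]. rewrite H. field. exact Ha.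
Qed.

Lemma mobius_at_mobius_angle (r th : R) : 0 <= r < 1 ->
  mobius_den r (cis (mobius_angle r th)) = mobius_factor r th /\ mobius r (cis (mobius_angle r
    th)) = cis th.
Proof.
  intros Hr. assert (HD := poisson_den_pos r th Hr). assert (HA := one_minus_rcos r th Hr).
  assert (E : (1 - r * cos th) ^ 2 + (r * sin th) ^ 2 = poisson_den r th).
  { unfold poisson_den. rewrite Rpow_mult_distr, sin2_eq. ring. }
  assert (Es := sin2_eq th).
  assert (E1 : mobius_den r (cis (mobius_angle r th)) = mobius_factor r th).
  { unfold mobius_den, mobius_angle. rewrite cis_plus, cis_2atan, E by exact HA.
    unfold mobius_factor, cis, Cdiv, Cmult, Cinv, RtoC, Cplus; simpl.
    apply injective_projections; simpl.
    - transitivity ((poisson_den r th + r * (cos th * ((1 - r * cos th) ^ 2 - (r * sin th) ^ 2)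
        - sin th * (2 * (1 - r * cos th) * (r * sin th)))) / poisson_den r th); [field; lra|].
      f_equal. unfold poisson_den.
      replace (cos th * ((1 - r * cos th) ^ 2 - (r * sin th) ^ 2)
        - sin th * (2 * (1 - r * cos th) * (r * sin th))) with
        (cos th * ((1 - r * cos th) ^ 2 - r ^ 2 * sin th ^ 2) - 2 * r * (1 - r * cos th) * sin th
          ^ 2)
        by ring.
      rewrite Es. ring.
    - transitivity ((r * (cos th * (2 * (1 - r * cos th) * (r * sin th))
        + sin th * ((1 - r * cos th) ^ 2 - (r * sin th) ^ 2))) / poisson_den r th); [field; lra|].
      f_equal.
      replace (r * (cos th * (2 * (1 - r * cos th) * (r * sin th))
        + sin th * ((1 - r * cos th) ^ 2 - (r * sin th) ^ 2))) with
        (r * sin th * (2 * r * cos th * (1 - r * cos th) + (1 - r * cos th) ^ 2 - r ^ 2 * sin th ^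
          2))
        by ring.
      rewrite Es. ring. }
  split; [exact E1|].
  unfold mobius. rewrite E1.
  assert (Hw : mobius_factor r th <> 0%C) by (apply Re_pos_neq_0; now apply mobius_factor_Re_pos).
  assert (E2 : (cis (mobius_angle r th) + RtoC r)%C = (cis th * mobius_factor r th)%C).
  { destruct (Req_dec r 0) as [->|Hr0].
    - unfold mobius_den in E1. rewrite Cmult_0_l, Cplus_0_r in E1. rewrite <- E1.
      unfold mobius_angle. rewrite Rmult_0_l. unfold Rdiv.
      rewrite Rmult_0_l, atan_0, Rmult_0_r, Rplus_0_r. ring.
    - assert (Hrc : RtoC r <> 0%C) by (intros F; apply Hr0; now injection F).
      apply (Cmult_reg_l (RtoC r)); [exact Hrc|].
      transitivity (mobius_factor r th + RtoC (r ^ 2 - 1))%C.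
      + rewrite <- E1. unfold mobius_den. rewrite RtoC_minus, RtoC_pow. ring.
      + unfold mobius_factor, cis, Cmult, Cplus, RtoC; simpl. apply injective_projections; simpl.
        * transitivity (((1 - r ^ 2) * (1 - r * cos th) + (r ^ 2 - 1) * poisson_den r th) /
          poisson_den r th); [field; lra|].
          transitivity (((1 - r ^ 2) * r * (cos th - r * (cos th ^ 2 + sin th ^ 2))) / poisson_den
            r th); [|field; lra].
          f_equal. rewrite Es. unfold poisson_den. ring.
        * field. lra. }
  rewrite E2. field. exact Hw.
Qed.

Lemma CInt_comp (u : R -> C) (g dg : R -> R) (a b : R) :
  (forall t, continuous u t) -> (forall t, is_derive g t (dg t)) -> (forall t, continuous dg t) ->
  CInt (fun t => RtoC (dg t) * u (g t))%C a b = CInt u (g a) (g b).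
Proof.
  intros Hu Hg Hdg. unfold CInt. f_equal.
  - rewrite <- (RInt_comp (fun t => Re (u t)) g dg).
    + apply RInt_ext. intros t _. rewrite Re_scal. reflexivity.
    + intros t _. apply continuous_Re_fun, Hu.
    + intros t _. split; [apply Hg|apply Hdg].
  - rewrite <- (RInt_comp (fun t => Im (u t)) g dg).
    + apply RInt_ext. intros t _.
      unfold scal; simpl; unfold mult; simpl. unfold Im. toR. ring.
    + intros t _. apply continuous_Im_fun, Hu.
    + intros t _. split; [apply Hg|apply Hdg].
Qed.

(** The substitution t = [mobius_angle r th] turns the integral into that of [boundary_kernel]
    times a function of mean zero bounded by smoothing_mass N * S, to which [kernel_L1] applies. *)
Lemma boundary_integral_bound (alpha r tau S : R) (N : nat) (u : R -> C) :
  0 <= alpha -> 0 <= r < 1 ->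
  (forall t, continuous u t) -> (forall t, u (t + 2 * PI) = u t) ->
  (forall t, Cmod (u t) <= S) -> CInt u 0 (2 * PI) = RtoC 0 ->
  Cmod (CInt (fun t => Cpow_rhp alpha (mobius_den r (cis t)) * trig_moment 0 0 N (cis tau * mobius
    r (cis t)) u)%C 0 (2 * PI))
  <= smoothing_mass N * S * (8 * (Rpower 2 alpha * atan r)).
Proof.
  intros Hal Hr Hu Hp HS H0.
  destruct (kernel_L1 alpha r Hal Hr) as [c Hc].
  assert (HPI := PI_RGT_0).
  assert (Hcis : forall t, Cmod (cis t) <= 1) by (intros; rewrite Cmod_cis; lra).
  assert (Cm : forall t, continuous (fun t => Cpow_rhp alpha (mobius_den r (cis t)) * trig_moment
    0 0 N (cis tau * mobius r (cis t)) u)%C t).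
  { intros t. assert (Hre := mobius_den_pos r (cis t) Hr (Hcis t)).
    assert (Hmob := mobius_cont r (cis t) (Re_pos_neq_0 _ Hre)).
    assert (HP := Cpow_rhp_continuous alpha _ Hre). apply continuous_Cmult_fun; [cts|].
    apply (continuous_comp (fun t => cis tau * mobius r (cis t))%C (fun w => trig_moment 0 0 N w
      u));
      [cts|now apply trig_moment_cont]. }
  set (V := fun th => smoothed N u (tau + th)%R).
  assert (CV : forall t, continuous V t).
  { intros t. apply continuous_ext with (fun th => trig_moment 0 0 N (cis tau * cis th)%C u).
    - intros th. unfold V. rewrite smoothed_eq_trig_moment by assumption. now rewrite cis_plus.
    - apply (continuous_comp (fun th => cis tau * cis th)%C (fun w => trig_moment 0 0 N w u));
        [cts|now apply trig_moment_cont]. }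
  assert (E : CInt (fun t => Cpow_rhp alpha (mobius_den r (cis t)) * trig_moment 0 0 N (cis tau *
    mobius r (cis t)) u)%C 0 (2 * PI)
     = CInt (fun th => boundary_kernel alpha r th * V th)%C 0 (2 * PI)).
  { assert (T0 : mobius_angle r 0 = 0).
    { unfold mobius_angle. rewrite sin_0, Rmult_0_r. unfold Rdiv. rewrite Rmult_0_l, atan_0. ring. }
    assert (T1 : mobius_angle r (2 * PI) = 2 * PI).
    { unfold mobius_angle. rewrite sin_2PI, Rmult_0_r. unfold Rdiv. rewrite Rmult_0_l, atan_0.
    ring. }
    match goal with |- CInt ?U _ _ = _ =>
      transitivity (CInt U (mobius_angle r 0) (mobius_angle r (2 * PI))); [now rewrite T0, T1|] end.
    rewrite <- (CInt_comp _ (mobius_angle r) (poisson r)).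
    - apply CInt_ext. intros th. destruct (mobius_at_mobius_angle r th Hr) as [-> ->].
      unfold V, boundary_kernel. rewrite smoothed_eq_trig_moment by assumption. rewrite cis_plus.
      ring.
    - exact Cm.
    - intros t; now apply mobius_angle_derive.
    - intros t; now apply poisson_cont. }
  rewrite E.
  assert (Ck : forall t, continuous (boundary_kernel alpha r) t) by (intros;
    now apply boundary_kernel_cont).
  assert (E2 : CInt (fun th => boundary_kernel alpha r th * V th)%C 0 (2 * PI)
     = CInt (fun th => (boundary_kernel alpha r th - RtoC c) * V th)%C 0 (2 * PI)).
  { rewrite (CInt_ext (fun th => (boundary_kernel alpha r th - RtoC c) * V th)%C
      (fun th => boundary_kernel alpha r th * V th - RtoC c * V th)%C) by (intros; ring).
    rewrite CInt_minus.
    - rewrite CInt_cmul by exact CV.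
      assert (EV : CInt V 0 (2 * PI) = RtoC 0) by exact (smoothed_mean_zero N u tau Hu Hp H0).
      rewrite EV. ring.
    - clearbody V. cts.
    - clearbody V. cts. }
  rewrite E2.
  assert (HcN := smoothing_mass_nonneg N).
  assert (HS0 : 0 <= S) by (eapply Rle_trans; [apply Cmod_ge_0|apply (HS 0)]).
  apply Rle_trans with (RInt (fun th => smoothing_mass N * S * Cmod (boundary_kernel alpha r th -
    RtoC c)%C) 0 (2 * PI)).
  - apply Cmod_CInt_le.
    + lra.
    + clearbody V. cts.
    + apply ex_RInt_cont. cts.
    + intros t _. rewrite Cmod_mult, Rmult_comm. apply Rmult_le_compat_r; [apply Cmod_ge_0|].
      exact (smoothed_bound N u (tau + t) S Hu HS).
  - rewrite RInt_Rmult by cts.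
    apply Rmult_le_compat_l; [now apply Rmult_le_pos|exact Hc].
Qed.

(** * Letting the radius of the circles tend to 1 *)

(** On the circle |z| = R this is a smoothing of the dilate of f by R, expressed without
    choosing an angle for z. *)
Definition rotation_average (N : nat) (f : C -> C) (z : C) : C :=
  CInt (fun s => RtoC (smoothing_kernel N s) * f (cis s * z)%C)%C 0 (2 * PI).

Lemma rotation_average_eq_trig_moment (N : nat) (f : C -> C) (z : C) :
  (forall z, unit_disc z -> continuous f z) -> unit_disc z -> 0 < Cmod z ->
  rotation_average N f z = trig_moment 0 0 N (z / RtoC (Cmod z))%C (fun s => f (polar (Cmod z) s)).
Proof.
  intros Cf Hz Hz0. set (R := Cmod z) in *.
  assert (HR : RtoC R <> 0%C) by (intros E; injection E; lra).
  destruct (polar_unit (z / RtoC R)%C) as [t [_ Ht]].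
  { rewrite Cmod_div, Cmod_R, Rabs_pos_eq by (assumption || lra). fold R. field. lra. }
  rewrite Ht. rewrite <- smoothed_eq_trig_moment.
  - unfold rotation_average, smoothed. apply CInt_ext. intros s. do 2 f_equal. unfold polar.
    rewrite cis_plus, <- Ht. field. exact HR.
  - cts. apply Cf, polar_disc. rewrite Rabs_pos_eq by lra. exact Hz.
  - intros s. unfold polar. now rewrite cis_2PI.
Qed.

(** The boundary values are attained as distributions only. Therefore [interior_estimate] is
    averaged over rotations with the smoothing kernel before the radius rho tends to 1. Here I
    rho is the averaged mean over the circle of radius rho and I1 rho the same integral with the
    boundary function in place of f. I1 is continuous at rho = 1, the difference I rho - I1 rho
    tends to 0 by [trig_moment_uniform], and I1 1 is bounded by [boundary_integral_bound]. *)
Section DiscBound.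
Variables (alpha G S : R) (fs f fz fzb H g Hb : C -> C).
Hypothesis Ha : 0 <= alpha.
Hypothesis HG : 0 <= G.
Hypothesis Wf : forall z, unit_disc z -> is_wirtinger f z (fz z) (fzb z).
Hypothesis EH : forall z, unit_disc z ->
  H z = (RtoC (Rpower (1 - Cmod z ^ 2) (- alpha)) * fzb z)%C.
Hypothesis WH : forall z, unit_disc z -> is_wirtinger H z (g z) (Hb z).
Hypothesis Cf : forall z, unit_disc z -> continuous f z.
Hypothesis Cfz : forall z, unit_disc z -> continuous fz z.
Hypothesis Cfzb : forall z, unit_disc z -> continuous fzb z.
Hypothesis CH : forall z, unit_disc z -> continuous H z.
Hypothesis Cg : forall z, unit_disc z -> continuous g z.
Hypothesis CHb : forall z, unit_disc z -> continuous Hb z.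
Hypothesis Bg : forall z, unit_disc z -> Cmod (g z) <= G.
Hypothesis Cfs : forall t, continuous (fun s => fs (cis s)) t.
Hypothesis BS : forall t, Cmod (fs (cis t)) <= S.
Hypothesis Mfs : CInt (fun t => fs (cis t)) 0 (2 * PI) = RtoC 0.
Hypothesis BV : boundary_values f fs.

Variables (r tau : R) (N : nat).
Hypothesis Hr : 0 <= r < 1.

Let u (s : R) : C := f (cis s * (cis tau * RtoC r))%C.
Let E : R := Rpower 2 alpha * (G * Rpower (1 - r ^ 2) (alpha + 1)).
Let eta (s : R) : C := (cis s * cis tau)%C.
Let I (rho : R) : C :=
  CInt (fun s => RtoC (smoothing_kernel N s) * circle_mean (pullback alpha r (eta s) f) rho)%C 0
    (2 * PI).
Let Zr (rho t : R) : C := (cis tau * mobius r (polar rho t))%C.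

Lemma rotation_unit (s : R) : Cmod (eta s) = 1.
Proof. unfold eta. rewrite Cmod_mult, !Cmod_cis. ring. Qed.

Lemma rotated_point_disc (s : R) : unit_disc (cis s * (cis tau * RtoC r))%C.
Proof.
  unfold unit_disc. rewrite !Cmod_mult, !Cmod_cis, Cmod_R, Rabs_pos_eq; lra.
Qed.

Lemma rotated_solution_cont (t : R) : continuous u t.
Proof. assert (Cu := Cf _ (rotated_point_disc t)). unfold u. cts. Qed.

Lemma rotated_pullback_cont (rho s t : R) : 0 <= rho < 1 ->
  continuous (fun p : R * R => pullback alpha r (eta (fst p)) f (polar rho (snd p))) (s, t).
Proof.
  intros Hrho. assert (Hd : unit_disc (polar rho t)) by (apply polar_disc; rewrite Rabs_pos_eq;
    lra).
  assert (Hre : 0 < Re (mobius_den r (polar rho t))) by (apply mobius_den_pos; [exact Hr|left;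
    exact Hd]).
  assert (HP := Cpow_rhp_continuous alpha _ Hre).
  assert (Hm := mobius_cont r _ (Re_pos_neq_0 _ Hre)).
  assert (HF : continuous f (eta s * mobius r (polar rho t))%C).
  { apply Cf. unfold unit_disc. rewrite Cmod_mult, rotation_unit, Rmult_1_l.
  exact (mobius_disc r _ Hr Hd). }
  unfold pullback, eta in *. cts.
Qed.

Lemma averaged_interior_estimate (rho : R) : 0 <= rho < 1 ->
  Cmod (I rho - RtoC (2 * PI) * smoothed N u 0)%C <= smoothing_mass N * (2 * PI * E).
Proof.
  intros Hrho.
  assert (Cm : forall s, continuous (fun s => circle_mean (pullback alpha r (eta s) f) rho) s).
  { intros s. apply (CInt_param_cont (fun s t => pullback alpha r (eta s) f (polar rho t))).
    - exact twoPI_pos.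
    - apply filter_forall. intros y t.
      apply (continuous_slice (fun s t => pullback alpha r (eta s) f (polar rho t))).
      now apply rotated_pullback_cont.
    - intros t. now apply rotated_pullback_cont. }
  assert (C1 : forall s, continuous (fun s => RtoC (smoothing_kernel N s) * circle_mean (pullback
    alpha r (eta s) f) rho)%C s).
  { cts. }
  assert (Cu := rotated_solution_cont).
  assert (C2 : forall s, continuous (fun s => RtoC (smoothing_kernel N s) * u s)%C s).
  { clearbody u. cts. }
  assert (C3 : forall s, continuous (fun s => RtoC (2 * PI) * (RtoC (smoothing_kernel N s) * u
    s))%C s).
  { clearbody u. cts. }
  assert (EE : (I rho - RtoC (2 * PI) * smoothed N u 0)%C =
    CInt (fun s => RtoC (smoothing_kernel N s) * (circle_mean (pullback alpha r (eta s) f) rho -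
      RtoC (2 * PI) * u s))%C 0 (2 * PI)).
  { rewrite (CInt_ext _ (fun s => RtoC (smoothing_kernel N s) * circle_mean (pullback alpha r (eta
    s) f) rho
      - RtoC (2 * PI) * (RtoC (smoothing_kernel N s) * u s))%C) by (intros; ring).
    rewrite CInt_minus by assumption. rewrite CInt_cmul by exact C2.
    unfold I, smoothed. rewrite (CInt_ext (fun s => RtoC (smoothing_kernel N s) * u (s + 0)%R)%C
      (fun s => RtoC (smoothing_kernel N s) * u s)%C) by (intros s; now rewrite Rplus_0_r).
    reflexivity. }
  rewrite EE. unfold smoothing_mass. rewrite (Rmult_comm (RInt _ _ _)).
  rewrite <- RInt_Rmult by apply smoothing_kernel_cont.
  apply Cmod_CInt_le.
  - exact twoPI_pos.
  - clearbody u. cts.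
  - apply ex_RInt_cont. cts.
  - intros s _. rewrite Cmod_mult, Cmod_R, Rabs_pos_eq by apply smoothing_kernel_nonneg.
    rewrite Rmult_comm. apply Rmult_le_compat_r; [apply smoothing_kernel_nonneg|].
    assert (HI := interior_estimate alpha r G (eta s) f fz fzb H g Hb Ha Hr (rotation_unit s) HG
      Wf EH WH Cf Cfz Cfzb CH Cg CHb Bg rho Hrho).
    unfold u. rewrite Cmult_assoc. exact HI.
Qed.

Lemma averaged_mean_fubini (rho : R) : 0 <= rho < 1 ->
  I rho = CInt (fun t => Cpow_rhp alpha (mobius_den r (polar rho t)) * rotation_average N f (Zr
    rho t))%C 0 (2 * PI).
Proof.
  intros Hrho.
  transitivity (CInt (fun s => CInt (fun t => RtoC (smoothing_kernel N s) *
     pullback alpha r (eta s) f (polar rho t))%C 0 (2 * PI)) 0 (2 * PI)).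
  - apply CInt_ext. intros s. unfold circle_mean. rewrite CInt_cmul; [reflexivity|].
    intros t. apply (continuous_slice (fun s t => pullback alpha r (eta s) f (polar rho t))).
    now apply rotated_pullback_cont.
  - rewrite (CInt_fubini (fun s t => RtoC (smoothing_kernel N s) * pullback alpha r (eta s) f
    (polar rho t))%C);
      [|exact twoPI_pos|exact twoPI_pos|].
    + apply CInt_ext. intros t. unfold rotation_average. rewrite <- CInt_cmul.
      * apply CInt_ext. intros s. unfold pullback, eta, Zr. rewrite !Cmult_assoc.
        rewrite (Cmult_comm (RtoC (smoothing_kernel N s))). reflexivity.
      * assert (Hd : unit_disc (polar rho t)) by (apply polar_disc; rewrite Rabs_pos_eq; lra).
        cts. apply Cf. unfold unit_disc, Zr. rewrite !Cmod_mult, !Cmod_cis, !Rmult_1_l.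
        exact (mobius_disc r _ Hr Hd).
    + intros s t. apply continuous_Cmult_fun; [cts|now apply rotated_pullback_cont].
Qed.

Let us (s : R) : C := fs (cis s).
Let I1 (rho : R) : C :=
  CInt (fun t => Cpow_rhp alpha (mobius_den r (polar rho t)) *
    trig_moment 0 0 N (Zr rho t / RtoC (Cmod (Zr rho t))) us)%C 0 (2 * PI).

Lemma mobius_den_polar_pos (rho t : R) : 0 <= rho -> r * rho < 1 ->
  0 < Re (mobius_den r (polar rho t)).
Proof.
  intros H1 H2.
  replace (Re (mobius_den r (polar rho t))) with (1 + r * rho * cos t)
    by (unfold mobius_den, polar, cis; simpl; ring).
  generalize (COS_bound t) (Rmult_le_pos r rho (proj1 Hr) H1). intros. nra.
Qed.

Lemma rotated_mobius_neq_0 (rho t : R) : r < rho -> r * rho < 1 -> Zr rho t <> 0%C.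
Proof.
  intros H1 H2. apply Cmod_pos_neq. unfold Zr. rewrite Cmod_mult, Cmod_cis, Rmult_1_l.
  apply Cmod_gt_0. unfold mobius.
  assert (Hm : 0 < Re (mobius_den r (polar rho t))).
  { apply mobius_den_polar_pos; lra. }
  intros F. assert (F2 : (polar rho t + RtoC r)%C = 0%C).
  { apply (Cmult_reg_l (/ mobius_den r (polar rho t))).
    - intros F3. apply (Re_pos_neq_0 _ Hm).
      rewrite <- (Cmult_1_l (mobius_den r (polar rho t))).
      rewrite <- (Cinv_l (mobius_den r (polar rho t))) at 1 by now apply Re_pos_neq_0.
      rewrite F3. ring.
    - rewrite Cmult_0_r, <- F. unfold Cdiv. ring. }
  assert (F4 : Cmod (polar rho t) = r).
  { replace (polar rho t) with (- RtoC r)%C.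
    - rewrite Cmod_opp, Cmod_R. apply Rabs_pos_eq; lra.
    - transitivity (- RtoC r + (polar rho t + RtoC r))%C; [rewrite F2|]; ring. }
  rewrite Cmod_polar, Rabs_pos_eq in F4; lra.
Qed.

Lemma limit_integrand_cont (rho t : R) : r < rho -> r * rho < 1 ->
  continuous (fun p : R * R => Cpow_rhp alpha (mobius_den r (polar (fst p) (snd p))) *
    trig_moment 0 0 N (Zr (fst p) (snd p) / RtoC (Cmod (Zr (fst p) (snd p)))) us)%C (rho, t).
Proof.
  intros H1 H2.
  assert (Hm : 0 < Re (mobius_den r (polar rho t))).
  { apply mobius_den_polar_pos; lra. }
  assert (Cp := polar_continuous_2d rho t).
  assert (CZ : continuous (fun p : R * R => Zr (fst p) (snd p)) (rho, t)).
  { assert (C := mobius_cont r _ (Re_pos_neq_0 _ Hm)). unfold Zr. cts. }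
  apply continuous_Cmult_fun.
  - assert (C := Cpow_rhp_continuous alpha _ Hm). cts.
  - apply (continuous_comp (fun p : R * R => Zr (fst p) (snd p) / RtoC (Cmod (Zr (fst p) (snd
    p))))%C
      (fun w => trig_moment 0 0 N w us)).
    + clearbody Zr. cts. intros F. apply (rotated_mobius_neq_0 rho t H1 H2). apply Cmod_eq_0.
    simpl in F. now injection F.
    + apply trig_moment_cont. exact Cfs.
Qed.

Lemma limit_integral_cont : continuous I1 1.
Proof.
  refine (CInt_param_cont (fun rho t => Cpow_rhp alpha (mobius_den r (polar rho t)) *
    trig_moment 0 0 N (Zr rho t / RtoC (Cmod (Zr rho t))) us)%C 0 (2 * PI) 1 twoPI_pos _ _).
  - assert (HL : locally 1 (fun y => r < y /\ r * y < 1)).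
    { apply filter_and.
      - apply (open_gt r). lra.
      - assert (Hc : continuous (fun y => r * y) 1) by cts. apply (Hc (fun x => x < 1)).
      apply (open_lt 1). lra. }
    revert HL. apply filter_imp. intros y [H1 H2] t.
    apply (continuous_slice (fun rho t => Cpow_rhp alpha (mobius_den r (polar rho t)) *
      trig_moment 0 0 N (Zr rho t / RtoC (Cmod (Zr rho t))) us)%C).
    now apply limit_integrand_cont.
  - intros t. apply limit_integrand_cont; lra.
Qed.

Lemma limit_integral_bound : Cmod (I1 1) <= smoothing_mass N * S * (8 * (Rpower 2 alpha * atan r)).
Proof.
  unfold I1.
  assert (EP : forall t, polar 1 t = cis t) by (intros; unfold polar; ring).
  rewrite (CInt_ext _ (fun t => Cpow_rhp alpha (mobius_den r (cis t)) *
    trig_moment 0 0 N (cis tau * mobius r (cis t)) us)%C).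
  - apply boundary_integral_bound; try assumption.
    intros t. unfold us. now rewrite cis_2PI.
  - intros t. rewrite EP. do 2 f_equal. unfold Zr. rewrite EP.
    assert (EM : Cmod (mobius r (cis t)) = 1).
    { assert (HM := mobius_pseudo_distance r (cis t) Hr ltac:(rewrite Cmod_cis; lra)).
      rewrite Cmod_cis in HM.
      replace ((1 - r ^ 2) * (1 - 1 ^ 2) / Cmod (mobius_den r (cis t)) ^ 2) with 0 in HM
        by (unfold Rdiv; ring).
      assert (HC := Cmod_ge_0 (mobius r (cis t))). nra. }
    rewrite Cmod_mult, Cmod_cis, EM, Rmult_1_r. apply Cdiv_1_r.
Qed.

Lemma averaged_mean_near_limit (e : R) : 0 < e -> exists d, 0 < d /\
  forall rho, 1 - d < rho < 1 -> Cmod (I rho - I1 rho)%C <= 2 * PI * (Rpower 2 alpha * e).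
Proof.
  intros He. destruct (trig_moment_uniform f fs Cf Cfs BV N 0 0 e He) as [d0 [Hd0 HU]].
  set (d1 := Rmin d0 (1 / 2)).
  assert (Hd1 : 0 < d1 <= 1 / 2) by (split; [apply Rmin_pos; lra|apply Rmin_r]).
  assert (Hd10 : d1 <= d0) by apply Rmin_l.
  (* This distance keeps |Zr rho t| above 1 - d1, by [mobius_pseudo_distance]. *)
  exists (Rmin (1 - r) (d1 * (1 - r) / 4)). split.
  { apply Rmin_pos; [lra|]. apply Rdiv_lt_0_compat; [apply Rmult_lt_0_compat; lra|lra]. }
  intros rho Hrho.
  assert (M1 := Rmin_l (1 - r) (d1 * (1 - r) / 4)).
  assert (M2 := Rmin_r (1 - r) (d1 * (1 - r) / 4)).
  assert (Hrr : r < rho) by lra. assert (Hrho1 : 0 <= rho < 1) by lra.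
  assert (Hr1 : r * rho < 1) by nra.
  rewrite averaged_mean_fubini by exact Hrho1. unfold I1.
  assert (Hd : forall t, unit_disc (polar rho t)) by (intros; apply polar_disc;
    rewrite Rabs_pos_eq; lra).
  assert (Hre : forall t, 0 < Re (mobius_den r (polar rho t))).
  { intros t. apply mobius_den_pos; [exact Hr|left; apply Hd]. }
  assert (HZ : forall t, 1 - d1 < Cmod (Zr rho t) < 1).
  { intros t. unfold Zr. rewrite Cmod_mult, Cmod_cis, Rmult_1_l.
    assert (Hm := mobius_disc r _ Hr (Hd t)). unfold unit_disc in Hm. split; [|exact Hm].
    assert (HM := mobius_pseudo_distance r _ Hr (Rlt_le _ _ (Hd t))).
    assert (HR := mobius_den_Re r (polar rho t) Hr (Rlt_le _ _ (Hd t))).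
    assert (HR2 := re_le_Cmod (mobius_den r (polar rho t))). apply Rabs_le_between in HR2.
    rewrite Cmod_polar, Rabs_pos_eq in HM by lra. rewrite Cmod_polar, Rabs_pos_eq in HR by lra.
    assert (HC := Cmod_ge_0 (mobius r (polar rho t))).
    set (m := Cmod (mobius_den r (polar rho t))) in *.
    set (x := Cmod (mobius r (polar rho t))) in *.
    assert (Hm1 : 1 - r <= m) by nra.
    assert (Hle : (1 - r ^ 2) * (1 - rho ^ 2) / m ^ 2 <= (1 - r ^ 2) * (1 - rho ^ 2) / (1 - r) ^ 2).
    { apply Rmult_le_compat_l; [apply Rmult_le_pos; nra|].
      apply Rinv_le_contravar; [apply pow_lt; lra|]. apply pow_incr; lra. }
    assert (Heq : (1 - r ^ 2) * (1 - rho ^ 2) / (1 - r) ^ 2 = (1 + r) * (1 - rho ^ 2) / (1 - r))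
      by (field; lra).
    assert (Hlt : (1 + r) * (1 - rho ^ 2) / (1 - r) < d1).
    { apply Rmult_lt_reg_r with (1 - r); [lra|]. unfold Rdiv. rewrite Rmult_assoc, Rinv_l by lra.
      nra. }
    nra. }
  assert (Hnz : forall t, Zr rho t <> 0%C) by (intros; now apply rotated_mobius_neq_0).
  assert (C2 : forall t, continuous (fun t => Cpow_rhp alpha (mobius_den r (polar rho t)) *
    trig_moment 0 0 N (Zr rho t / RtoC (Cmod (Zr rho t))) us)%C t).
  { intros t. apply (continuous_slice (fun rho t => Cpow_rhp alpha (mobius_den r (polar rho t)) *
      trig_moment 0 0 N (Zr rho t / RtoC (Cmod (Zr rho t))) us)%C).
      now apply limit_integrand_cont. }
  assert (CZ : forall t, continuous (Zr rho) t).
  { intros t. assert (C := mobius_cont r _ (Re_pos_neq_0 _ (Hre t))). unfold Zr. cts. }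
  assert (CZf : forall t s, continuous f (cis s * Zr rho t)%C).
  { intros t s. apply Cf. unfold unit_disc. rewrite Cmod_mult, Cmod_cis. generalize (HZ t). lra. }
  assert (C1 : forall t, continuous (fun t => Cpow_rhp alpha (mobius_den r (polar rho t)) *
    rotation_average N f (Zr rho t))%C t).
  { intros t. apply continuous_Cmult_fun.
    - assert (C := Cpow_rhp_continuous alpha _ (Hre t)). cts.
    - apply (CInt_param_cont (fun t s => RtoC (smoothing_kernel N s) * f (cis s * Zr rho t)%C)%C).
      + exact twoPI_pos.
      + apply filter_forall. intros y s.
        assert (C := CZf y s). cts.
      + intros s. assert (C := CZf t s). clearbody Zr. cts. }
  rewrite <- CInt_minus by assumption.
  replace (2 * PI * (Rpower 2 alpha * e)) with (RInt (fun _ => Rpower 2 alpha * e) 0 (2 * PI)).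
  2:{ rewrite RInt_const_R. toR. ring. }
  apply Cmod_CInt_le.
  - exact twoPI_pos.
  - intros t. exact (continuous_Cplus_fun _ _ _ (C1 t) (continuous_Copp_fun _ _ (C2 t))).
  - apply ex_RInt_const.
  - intros t _. specialize (HZ t).
    rewrite rotation_average_eq_trig_moment; [|exact Cf|unfold unit_disc; lra|lra].
    match goal with |- Cmod (?k * ?A - ?k * ?B)%C <= _ =>
      replace (k * A - k * B)%C with (k * (A - B))%C by ring end.
    rewrite Cmod_mult, Cmod_Cpow_rhp by apply Hre.
    apply Rmult_le_compat.
    + left; apply exp_pos.
    + apply Cmod_ge_0.
    + apply Rle_Rpower_l; [exact Ha|]. split; [apply Cmod_gt_0, Re_pos_neq_0, Hre|].
      unfold mobius_den. eapply Rle_trans; [apply Cmod_triangle|].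
      rewrite Cmod_1, Cmod_mult, Cmod_R, Cmod_polar, !Rabs_pos_eq by lra. nra.
    + apply HU; [lra|lra|].
      rewrite Cmod_div, Cmod_R, Rabs_pos_eq by (try (intros F; injection F); lra).
      right. field. lra.
Qed.

Lemma smoothed_solution_bound : Cmod (smoothed N u 0) <= smoothing_mass N * (Rpower 2 alpha *
   (4 / PI * S * atan r + G * Rpower (1 - r ^ 2) (alpha + 1))).
Proof.
  assert (HPI := PI_RGT_0). apply le_epsilon. intros eps Heps.
  assert (HP2 : 0 < Rpower 2 alpha) by apply exp_pos.
  assert (He : 0 < eps / (2 * Rpower 2 alpha)) by (apply Rdiv_lt_0_compat; lra).
  destruct (averaged_mean_near_limit _ He) as [d [Hd Hclose]].
  destruct (continuous_Cmod_small I1 1 (PI * eps) limit_integral_cont ltac:(nra)) as [d2 Hd2].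
  assert (Hm : 0 < Rmin 1 (Rmin d d2)).
  { apply Rmin_pos; [lra|]. apply Rmin_pos; [lra|apply cond_pos]. }
  assert (L1 := Rmin_l 1 (Rmin d d2)). assert (L2 := Rmin_r 1 (Rmin d d2)).
  assert (L3 := Rmin_l d d2). assert (L4 := Rmin_r d d2).
  set (m := Rmin 1 (Rmin d d2)) in *.
  set (rho := 1 - m / 2).
  assert (Hrho : 0 <= rho < 1) by (unfold rho; lra).
  assert (B1 := averaged_interior_estimate rho Hrho).
  assert (B2 := Hclose rho ltac:(unfold rho; lra)).
  assert (B3 : Cmod (I1 rho - I1 1)%C < PI * eps).
  { apply Hd2. change (Rabs (rho - 1) < d2). unfold rho. apply Rabs_def1; lra. }
  assert (B4 := limit_integral_bound).
  replace (2 * PI * (Rpower 2 alpha * (eps / (2 * Rpower 2 alpha)))) with (PI * eps) in B2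
    by (field; lra).
  assert (HX : 2 * PI * Cmod (smoothed N u 0) <=
     smoothing_mass N * (2 * PI * E) + (PI * eps + (PI * eps + smoothing_mass N * S * (8 * (Rpower
       2 alpha * atan r))))).
  { rewrite <- (Rabs_pos_eq (2 * PI)) at 1 by lra. rewrite <- Cmod_R, <- Cmod_mult.
    replace (RtoC (2 * PI) * smoothed N u 0)%C with
      (- (I rho - RtoC (2 * PI) * smoothed N u 0) + ((I rho - I1 rho) + ((I1 rho - I1 1) + I1
        1)))%C by ring.
    eapply Rle_trans; [apply Cmod_triangle|]. rewrite Cmod_opp. apply Rplus_le_compat; [exact B1|].
    eapply Rle_trans; [apply Cmod_triangle|]. apply Rplus_le_compat; [exact B2|].
    eapply Rle_trans; [apply Cmod_triangle|]. apply Rplus_le_compat; [lra|exact B4]. }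
  apply Rmult_le_reg_l with (2 * PI); [lra|].
  eapply Rle_trans; [exact HX|]. right. unfold E. field. lra.
Qed.
End DiscBound.

(** * The bound inside the disc *)

(** Uniform continuity: going up from the lower edge, every step of length d / 2 adds at most 1
    to the bound. *)
Lemma bounded_square (h : R -> R -> R) (l : R) : 0 <= l ->
  (forall x y, continuous (fun p : R * R => h (fst p) (snd p)) (x, y)) ->
  exists M, forall x y, -l <= x <= l -> -l <= y <= l -> Rabs (h x y) <= M.
Proof.
  intros Hl Hh.
  destruct (uniform_continuity_2d h (- l) l (- l) l) with (eps := mkposreal 1 Rlt_0_1)
    as [d Hd].
  { intros x y _ _. apply continuity_2d_pt_filterlim, Hh. }
  simpl in Hd.
  destruct (continuity_ab_maj (fun x => Rabs (h x (- l))) (- l) l ltac:(lra)) as [m [Hm _]].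
  { intros c _. apply continuity_pt_filterlim. apply (continuous_Rabs_fun (fun x => h x (- l))).
    exact (continuous_slice_l h c (- l) (Hh c (- l))). }
  set (M0 := Rabs (h m (- l))). assert (Hdp := cond_pos d).
  assert (Hstep : forall (k : nat) x y, -l <= x <= l -> -l <= y <= l ->
     y <= - l + INR k * (d / 2) -> Rabs (h x y) <= M0 + INR k).
  { induction k as [|k IH]; intros x y Hx Hy Hk.
    - simpl in *. replace y with (- l) by lra. rewrite Rplus_0_r. now apply Hm.
    - rewrite S_INR in *. destruct (Rle_dec y (- l + INR k * (d / 2))) as [H|H].
      + generalize (IH x y Hx Hy H). lra.
      + destruct (Rle_dec (- l) (y - d / 2)) as [H1|H1].
        * assert (A := IH x (y - d / 2) Hx ltac:(lra) ltac:(lra)).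
          assert (B : Rabs (h x y - h x (y - d / 2)) < 1).
          { apply Hd; try lra.
            - rewrite Rminus_diag, Rabs_R0. lra.
            - apply Rabs_def1; lra. }
          assert (Ctr := Rabs_triang (h x (y - d / 2)) (h x y - h x (y - d / 2))).
          replace (h x (y - d / 2) + (h x y - h x (y - d / 2))) with (h x y) in Ctr by ring. lra.
        * assert (A := Hm x Hx). fold M0 in A.
          assert (B : Rabs (h x y - h x (- l)) < 1).
          { apply Hd; try lra.
            - rewrite Rminus_diag, Rabs_R0. lra.
            - apply Rabs_def1; lra. }
          assert (Ctr := Rabs_triang (h x (- l)) (h x y - h x (- l))).
          replace (h x (- l) + (h x y - h x (- l))) with (h x y) in Ctr by ring.
          generalize (pos_INR k). lra. }
  destruct (INR_unbounded (2 * l / (d / 2))) as [n Hn].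
  exists (M0 + INR n). intros x y Hx Hy. apply Hstep; try assumption.
  assert (2 * l < INR n * (d / 2)).
  { apply Rmult_lt_compat_r with (r := d / 2) in Hn; [|lra].
    unfold Rdiv at 1 in Hn. rewrite Rmult_assoc, Rinv_l in Hn by lra. lra. }
  lra.
Qed.

(** Composing with the retraction z / max 1 |z| of the plane onto the closed disc gives a
    function that is continuous on the whole plane. *)
Lemma bounded_closed_disc (g : C -> C) :
  continuous_within closed_unit_disc g ->
  exists M, forall z, closed_unit_disc z -> Cmod (g z) <= M.
Proof.
  intros Hg.
  (* This is the maximum of 1 and |z|, in a form that shows its continuity. *)
  set (m := fun z : C => (1 + Cmod z + Rabs (1 - Cmod z)) / 2).
  assert (Hm1 : forall z, 1 <= m z /\ Cmod z <= m z).
  { intros z. unfold m. generalize (Rle_abs (1 - Cmod z)) (Rle_abs (- (1 - Cmod z))).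
    rewrite Rabs_Ropp. lra. }
  set (pr := fun z : C => (RtoC (/ m z) * z)%C).
  assert (Hpr : forall z, closed_unit_disc (pr z)).
  { intros z. unfold closed_unit_disc, pr. destruct (Hm1 z) as [A B].
    rewrite Cmod_mult, Cmod_R, Rabs_pos_eq by (left; apply Rinv_0_lt_compat; lra).
    apply Rmult_le_reg_l with (m z); [lra|]. rewrite <- Rmult_assoc, Rinv_r by lra. lra. }
  assert (Cpr : forall z, continuous pr z).
  { intros z. destruct (Hm1 z) as [A _].
    assert (Cm : continuous m z) by (unfold m; cts; lra). clearbody m. unfold pr. cts. lra. }
  assert (Cgp : forall z, continuous (fun w => g (pr w)) z).
  { intros z P HP. assert (H1 := Hg (pr z) (Hpr z) P HP). unfold filtermap, within in H1.
    assert (H2 := Cpr z _ H1). unfold filtermap in H2.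
    apply (filter_imp (F := locally z) (fun w => closed_unit_disc (pr w) -> P (g (pr w)))).
    - intros w Hw. apply Hw, Hpr.
    - exact H2. }
  destruct (bounded_square (fun x y => Cmod (g (pr (x, y)))) 1 ltac:(lra)) as [M HM].
  { intros x y. apply continuous_ext with (fun p : C => Cmod (g (pr p))).
    - intros [a b]; reflexivity.
    - apply continuous_Cmod_fun. apply Cgp. }
  exists M. intros z Hz. unfold closed_unit_disc in Hz.
  assert (E : pr z = z).
  { unfold pr, m. rewrite Rabs_pos_eq by lra.
    replace ((1 + Cmod z + (1 - Cmod z)) / 2) with 1 by field. rewrite Rinv_1. ring. }
  destruct (Cmod_proj_bounds z) as [A B].
  apply Rabs_le_between in A. apply Rabs_le_between in B.
  destruct z as [x y]. assert (H := HM x y). rewrite E in H.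
  rewrite Rabs_pos_eq in H by apply Cmod_ge_0. apply H; simpl in *; lra.
Qed.

Lemma sup_norm_ub (A : C -> Prop) (h : C -> C) (M : R) :
  (forall z, A z -> Cmod (h z) <= M) -> forall z, A z -> Cmod (h z) <= sup_norm A h.
Proof.
  intros HM z Hz. unfold sup_norm.
  set (E := fun x : R => exists z : C, A z /\ x = Cmod (h z)).
  destruct (Lub_Rbar_correct E) as [H1 H2].
  assert (U : is_ub_Rbar E (Finite M)).
  { intros x [w [Hw ->]]. simpl. now apply HM. }
  assert (L := H1 (Cmod (h z)) (ex_intro _ z (conj Hz eq_refl))).
  assert (K := H2 _ U). destruct (Lub_Rbar E); simpl in *; [exact L|contradiction|contradiction].
Qed.

Lemma disc_weight_wirtinger (a : R) (z : C) : unit_disc z ->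
  is_wirtinger (fun w => RtoC (Rpower (1 - Cmod w ^ 2) a)) z
   (RtoC (- a * Rpower (1 - Cmod z ^ 2) (a - 1)) * Cconj z)%C
   (RtoC (- a * Rpower (1 - Cmod z ^ 2) (a - 1)) * z)%C.
Proof.
  intros Hz c t l Hc [H1 H2]. subst z. assert (Hw := disc_weight_pos _ Hz).
  apply is_Cderive_ext with (fun s => RtoC (Rpower (1 - (Re (c s) ^ 2 + Im (c s) ^ 2)) a)).
  { intros s. now rewrite Cmod2_alt. }
  eapply is_Cderive_val.
  - apply is_Cderive_RtoC. unfold Rpower.
    apply (is_derive_comp exp (fun s => a * ln (1 - (Re (c s) ^ 2 + Im (c s) ^ 2)))).
    + apply is_derive_exp.
    + apply is_derive_scal_l.
      apply (is_derive_comp ln (fun s => 1 - (Re (c s) ^ 2 + Im (c s) ^ 2))).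
      * apply is_derive_ln. rewrite <- Cmod2_alt. exact Hw.
      * apply @is_derive_minus; [apply @is_derive_const|].
        apply @is_derive_plus; apply is_derive_pow; eassumption.
  - rewrite Cmod2_alt in *. set (x := Re (c t)) in *. set (y := Im (c t)) in *.
    set (w := 1 - (x ^ 2 + y ^ 2)) in *.
    change (exp (a * ln w)) with (Rpower w a).
    replace (Rpower w a) with (Rpower w (a - 1) * w).
    2:{ rewrite <- (Rpower_1 w) at 2 by exact Hw. rewrite <- Rpower_plus. f_equal. ring. }
    unfold scal, minus, plus, opp, zero, mult; simpl. unfold mult; simpl.
    replace (c t) with ((x, y) : C) by (unfold x, y; now destruct (c t)).
    unfold Cconj, Cmult, Cplus, RtoC; simpl. unfold Re, Im.
    apply injective_projections; simpl.
    + field. lra.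
    + ring.
Qed.

Lemma disc_weight_cont (a : R) (z : C) : unit_disc z ->
  continuous (fun w => Rpower (1 - Cmod w ^ 2) a) z.
Proof. intros Hz. cts. now apply disc_weight_pos. Qed.

Lemma d_z_cont (f : C -> C) (z : C) :
  continuous (dx f) z -> continuous (dy f) z -> continuous (d_z f) z.
Proof. unfold d_z. cts. Qed.

Lemma d_zbar_cont (f : C -> C) (z : C) :
  continuous (dx f) z -> continuous (dy f) z -> continuous (d_zbar f) z.
Proof. unfold d_zbar. cts. Qed.

Lemma Cm1_wirtinger (f : C -> C) (z : C) : Cm_on 1 unit_disc f -> unit_disc z ->
  is_wirtinger f z (d_z f z) (d_zbar f z) /\ continuous (d_z f) z /\ continuous (d_zbar f) z.
Proof.
  intros [_ [Hd [[Hx _] [Hy _]]]] Hz. split; [|split].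
  - apply wirtinger_of_C1; auto.
  - apply d_z_cont; auto.
  - apply d_zbar_cont; auto.
Qed.

Lemma Cpowr_1 (a : R) : Cpowr (RtoC 1) a = RtoC 1.
Proof.
  unfold Cpowr, Carg. rewrite Cmod_1. simpl. replace (0 / (1 + 1)) with 0 by field.
  rewrite atan_0, Rmult_0_r, Rmult_0_r. unfold Rpower. rewrite ln_1, Rmult_0_r, exp_0.
  unfold cis, Cmult. rewrite cos_0, sin_0. unfold RtoC; simpl. f_equal; ring.
Qed.

Lemma poisson_integral_0 (alpha : R) (fs : C -> C) :
  poisson_integral alpha fs (RtoC 0) = (RtoC (/ (2 * PI)) * CInt (fun t => fs (cis t)) 0 (2 *
    PI))%C.
Proof.
  unfold poisson_integral. f_equal. apply CInt_ext. intros t.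
  rewrite Cmult_0_l. unfold poisson_kernel.
  replace (Cconj (RtoC 0)) with (RtoC 0) by (unfold Cconj, RtoC; simpl; f_equal; ring).
  replace (RtoC 1 - RtoC 0)%C with (RtoC 1) by ring. rewrite Cpowr_1, Cmod_0.
  replace (1 - 0 ^ 2) with 1 by ring.
  unfold Rpower. rewrite ln_1, Rmult_0_r, exp_0. rewrite Cmult_1_r, Cdiv_1_r. ring.
Qed.

Lemma continuous_within_interior (g : C -> C) (z : C) :
  continuous_within closed_unit_disc g -> unit_disc z -> continuous g z.
Proof.
  intros Hg Hz P HP. assert (H := Hg z (Rlt_le _ _ Hz) P HP). unfold filtermap, within in H.
  assert (Hl := disc_open z Hz).
  apply (filter_imp (F := locally z)
    (fun w => unit_disc w /\ (closed_unit_disc w -> P (g w)))).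
  - intros w [A B]. apply B. left; exact A.
  - now apply filter_and.
Qed.

(** The equation says that H = (1 - |w|^2)^(- alpha) f_zbar has z-derivative g. Writing z = e^{i
    tau} r puts f z in the form u 0 required by [bound_from_smoothed], and the hypothesis of
    that lemma is [smoothed_solution_bound]. *)
Theorem interior_bound (alpha : R) (g fs f : C -> C) :
  0 <= alpha ->
  continuous_within closed_unit_disc g ->
  (forall t, continuous (fun s => fs (cis s)) t) ->
  Cm_on 2 unit_disc f ->
  dirichlet_problem alpha g fs f ->
  CInt (fun t => fs (cis t)) 0 (2 * PI) = RtoC 0 ->
  forall S, (forall t, Cmod (fs (cis t)) <= S) ->
  forall z, unit_disc z ->
    Cmod (f z) <= Rpower 2 alpha * (4 / PI * S * atan (Cmod z) +
      sup_norm unit_disc g * Rpower (1 - Cmod z ^ 2) (alpha + 1)).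
Proof.
  intros Ha Hg Cfs HC2 [HL BV] M0 S BS z Hz.
  set (G := sup_norm unit_disc g).
  assert (Bg : forall w, unit_disc w -> Cmod (g w) <= G).
  { destruct (bounded_closed_disc g Hg) as [M HM].
    apply (sup_norm_ub unit_disc g M). intros w Hw. apply HM. left; exact Hw. }
  assert (HG : 0 <= G).
  { eapply Rle_trans; [apply Cmod_ge_0|]. apply (Bg (RtoC 0)).
    unfold unit_disc. rewrite Cmod_0. lra. }
  destruct HC2 as [Cf [Hd [Hx1 Hy1]]].
  assert (Cx : forall w, unit_disc w -> continuous (dx f) w) by apply Hx1.
  assert (Cy : forall w, unit_disc w -> continuous (dy f) w) by apply Hy1.
  set (W := fun w : C => RtoC (Rpower (1 - Cmod w ^ 2) (- alpha))).
  set (Wa := fun w : C => RtoC (- - alpha * Rpower (1 - Cmod w ^ 2) (- alpha - 1))).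
  set (H := fun w : C => (W w * d_zbar f w)%C).
  set (fba := fun w : C => (RtoC (/ 2) * (d_z (dx f) w + Ci * d_z (dy f) w))%C).
  set (fbb := fun w : C => (RtoC (/ 2) * (d_zbar (dx f) w + Ci * d_zbar (dy f) w))%C).
  set (Hb := fun w : C => (Wa w * w * d_zbar f w + W w * fbb w)%C).
  assert (Wf : forall w, unit_disc w -> is_wirtinger f w (d_z f w) (d_zbar f w)).
  { intros w Hw. apply wirtinger_of_C1; auto. }
  assert (Wfb : forall w, unit_disc w -> is_wirtinger (d_zbar f) w (fba w) (fbb w)).
  { intros w Hw. destruct (Cm1_wirtinger _ w Hx1 Hw) as [A _].
  destruct (Cm1_wirtinger _ w Hy1 Hw) as [B _].
    unfold d_zbar. eapply wirtinger_val.
    - apply wirtinger_mult; [apply wirtinger_const|]. apply wirtinger_plus; [exact A|].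
      apply wirtinger_mult; [apply wirtinger_const|exact B].
    - unfold fba. ring.
    - unfold fbb. ring. }
  assert (WH0 : forall w, unit_disc w -> is_wirtinger H w
     (Wa w * Cconj w * d_zbar f w + W w * fba w)%C (Hb w)).
  { intros w Hw. apply wirtinger_mult; [|now apply Wfb].
  exact (disc_weight_wirtinger (- alpha) w Hw). }
  assert (WH : forall w, unit_disc w -> is_wirtinger H w (g w) (Hb w)).
  { intros w Hw. eapply wirtinger_val; [now apply WH0| |reflexivity].
    destruct (wirtinger_d_z_d_zbar _ _ _ _ (WH0 w Hw)) as [E _]. rewrite <- E. now apply HL. }
  assert (Cfb : forall w, unit_disc w -> continuous (d_zbar f) w)
    by (intros; apply d_zbar_cont; auto).
  assert (CW : forall w, unit_disc w -> continuous W w).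
  { intros w Hw. assert (C := disc_weight_cont (- alpha) w Hw). unfold W. cts. }
  assert (Cfbb : forall w, unit_disc w -> continuous fbb w).
  { intros w Hw. destruct (Cm1_wirtinger _ w Hx1 Hw) as [_ [_ A]].
    destruct (Cm1_wirtinger _ w Hy1 Hw) as [_ [_ B]].
    unfold fbb. cts. }
  assert (CHb : forall w, unit_disc w -> continuous Hb w).
  { intros w Hw. assert (CWa := disc_weight_cont (- alpha - 1) w Hw).
    assert (Cw : continuous Wa w) by (unfold Wa; cts).
    specialize (CW w Hw). specialize (Cfb w Hw). specialize (Cfbb w Hw).
    clearbody Wa W fbb. unfold Hb. cts. }
  assert (CH : forall w, unit_disc w -> continuous H w).
  { intros w Hw. specialize (CW w Hw). specialize (Cfb w Hw). clearbody W. unfold H. cts. }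
  assert (Cg : forall w, unit_disc w -> continuous g w).
  { intros w Hw. now apply continuous_within_interior. }
  assert (Cfz : forall w, unit_disc w -> continuous (d_z f) w)
    by (intros; apply d_z_cont; auto).
  assert (Hpol : exists tau, z = (cis tau * RtoC (Cmod z))%C).
  { destruct (Req_dec (Cmod z) 0) as [E|E].
    - exists 0. rewrite E. apply Cmod_eq_0 in E. rewrite E. ring.
    - assert (Hzc : RtoC (Cmod z) <> 0%C) by (intros F; injection F; exact E).
      destruct (polar_unit (z / RtoC (Cmod z))%C) as [tau [_ Ht]].
      + rewrite Cmod_div, Cmod_R, Rabs_pos_eq by (assumption || apply Cmod_ge_0). field. exact E.
      + exists tau. rewrite <- Ht. field. exact Hzc. }
  destruct Hpol as [tau Hpol].
  assert (Hr : 0 <= Cmod z < 1) by (split; [apply Cmod_ge_0|exact Hz]).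
  set (r := Cmod z) in *.
  set (u := fun s : R => f (cis s * (cis tau * RtoC r))%C).
  assert (Eu : f z = u 0).
  { unfold u. rewrite Hpol. f_equal.
    replace (cis 0) with (RtoC 1) by (unfold cis; now rewrite cos_0, sin_0). ring. }
  rewrite Eu. apply bound_from_smoothed.
  - intros t. exact (rotated_solution_cont f Cf r tau Hr t).
  - intros t. unfold u. now rewrite cis_2PI.
  - intros N.
    exact (smoothed_solution_bound alpha G S fs f (d_z f) (d_zbar f) H g Hb Ha HG Wf (fun w _ =>
      eq_refl) WH
      Cf Cfz Cfb CH Cg CHb Bg Cfs BS M0 BV r tau N Hr).
Qed.

(** * The extremal function and the theorem *)

Lemma partials_of_Cderive (f a b : C -> C) :
  (forall x y, is_Cderive (fun s => f (s, y)) x (a (x, y))) ->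
  (forall x y, is_Cderive (fun s => f (x, s)) y (b (x, y))) ->
  dx f = a /\ dy f = b /\ forall z, ex_dx f z /\ ex_dy f z.
Proof.
  intros Ha Hb. repeat split.
  - apply functional_extensionality. intros [x y]. destruct (Ha x y) as [A1 A2].
    apply injective_projections; apply is_derive_unique; assumption.
  - apply functional_extensionality. intros [x y]. destruct (Hb x y) as [A1 A2].
    apply injective_projections; apply is_derive_unique; assumption.
  - destruct z as [x y]. destruct (Ha x y) as [A1 A2]. eexists; exact A1.
  - destruct z as [x y]. destruct (Ha x y) as [A1 A2]. eexists; exact A2.
  - destruct z as [x y]. destruct (Hb x y) as [A1 A2]. eexists; exact A1.
  - destruct z as [x y]. destruct (Hb x y) as [A1 A2]. eexists; exact A2.
Qed.

Lemma is_Cderive_real (g : R -> R) (h : R -> C) (t l : R) :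
  (forall s, h s = RtoC (g s)) -> is_derive g t l -> is_Cderive h t (RtoC l).
Proof.
  intros E H. apply is_Cderive_ext with (fun s => RtoC (g s)); [intros; now rewrite E|].
  now apply is_Cderive_RtoC.
Qed.

Lemma Cm_const (m : nat) (k : R) (Om : C -> Prop) : Cm_on m Om (fun _ => RtoC k).
Proof.
  revert k. induction m as [|m IH]; intros k; (split; [intros; apply continuous_const|]);
    [exact I|].
  destruct (partials_of_Cderive (fun _ => RtoC k) (fun _ => RtoC 0) (fun _ => RtoC 0)) as [E1 [E2
    E3]].
  - intros x y. apply is_Cderive_const.
  - intros x y. apply is_Cderive_const.
  - rewrite E1, E2. split; [|split]; auto.
Qed.

Lemma Cm_linear (k l : R) (Om : C -> Prop) : Cm_on 1 Om (fun z => RtoC (k * Re z + l * Im z)).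
Proof.
  split.
  - cts.
  - destruct (partials_of_Cderive (fun z => RtoC (k * Re z + l * Im z)) (fun _ => RtoC k) (fun _
    => RtoC l))
      as [E1 [E2 E3]].
    + intros x y. eapply is_Cderive_real; [intros; reflexivity|]. simpl.
    auto_derive; [trivial|ring].
    + intros x y. eapply is_Cderive_real; [intros; reflexivity|]. simpl.
    auto_derive; [trivial|ring].
    + rewrite E1, E2. split; [|split]; auto; apply (Cm_const 0).
Qed.

Definition extremal (c : R) (z : C) : C := RtoC (c * (1 - Cmod z ^ 2)).

Lemma extremal_partials (c : R) :
  dx (extremal c) = (fun z => RtoC (- 2 * c * Re z + 0 * Im z)) /\
  dy (extremal c) = (fun z => RtoC (0 * Re z + - 2 * c * Im z)) /\
  forall z, ex_dx (extremal c) z /\ ex_dy (extremal c) z.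
Proof.
  apply partials_of_Cderive.
  - intros x y. apply is_Cderive_real with (fun s => c * (1 - (s ^ 2 + y ^ 2))).
    + intros s. unfold extremal. now rewrite Cmod2_alt.
    + simpl. auto_derive; [trivial|ring].
  - intros x y. apply is_Cderive_real with (fun s => c * (1 - (x ^ 2 + s ^ 2))).
    + intros s. unfold extremal. now rewrite Cmod2_alt.
    + simpl. auto_derive; [trivial|ring].
Qed.

Lemma extremal_C2 (c : R) : Cm_on 2 unit_disc (extremal c).
Proof.
  destruct (extremal_partials c) as [E1 [E2 E3]]. split.
  - unfold extremal. cts.
  - rewrite E1, E2. split; [intros z _; apply E3|]. split; apply Cm_linear.
Qed.

Lemma extremal_laplacian (c : R) (z : C) :
  weighted_laplacian 0 (extremal c) z = RtoC (- c).
Proof.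
  unfold weighted_laplacian.
  replace (fun w : C => (RtoC (Rpower (1 - Cmod w ^ 2) (- 0)) * d_zbar (extremal c) w)%C)
    with (fun w : C => (RtoC (- c) * w)%C).
  - destruct (wirtinger_d_z_d_zbar (fun w : C => (RtoC (- c) * w)%C) z (RtoC (- c)) (RtoC 0)) as
    [E _]; [|exact E].
    eapply wirtinger_val; [apply wirtinger_mult; [apply wirtinger_const|apply wirtinger_id]| |];
      cbv beta; ring.
  - apply functional_extensionality. intros w. destruct (extremal_partials c) as [E1 [E2 _]].
    unfold d_zbar. rewrite E1, E2.
    replace (Rpower (1 - Cmod w ^ 2) (- 0)) with 1
      by (unfold Rpower; rewrite Ropp_0, Rmult_0_l, exp_0; reflexivity).
    destruct w as [x y]. unfold Ci, RtoC, Cmult, Cplus; simpl. f_equal; field.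
Qed.

Lemma Cm_circle_cont (m : nat) (h : C -> C) : Cm_circle m h ->
  forall t, continuous (fun s => h (cis s)) t.
Proof.
  intros [H1 H2] t.
  destruct (H1 0%nat ltac:(lia) t) as [_ A]. destruct (H2 0%nat ltac:(lia) t) as [_ B].
  simpl in A, B. apply continuous_ext with (fun s => (Re (h (cis s)), Im (h (cis s))) : C).
  - intros s. now destruct (h (cis s)).
  - now apply continuous_pairC.
Qed.

Lemma extremal_boundary (c : R) : boundary_values (extremal c) (fun _ => RtoC 0).
Proof.
  split.
  - intros phi Hphi. assert (Cphi := Cm_circle_cont 0 phi (Hphi 0%nat)).
    set (X := CInt (fun t => phi (cis t)) 0 (2 * PI)).
    assert (E : forall r, circle_pairing (fun w => extremal c (RtoC r * w)%C) phi =
       (RtoC (/ (2 * PI)) * (RtoC (c * (1 - r ^ 2)) * X))%C).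
    { intros r. unfold circle_pairing. f_equal. unfold X. rewrite <- CInt_cmul by exact Cphi.
      apply CInt_ext. intros t. unfold extremal.
      now rewrite Cmod_mult, Cmod_cis, Cmod_R, Rmult_1_r, pow2_abs. }
    assert (E0 : circle_pairing (fun _ => RtoC 0) phi = (RtoC (/ (2 * PI)) * (RtoC (c * (1 - 1 ^
      2)) * X))%C).
    { unfold circle_pairing. rewrite (CInt_ext _ (fun _ => RtoC 0)) by (intros; ring).
      rewrite CInt_const. replace (c * (1 - 1 ^ 2)) with 0 by ring. ring. }
    rewrite E0. apply filterlim_ext with (fun r => (RtoC (/ (2 * PI)) * (RtoC (c * (1 - r ^ 2)) *
      X))%C).
    { intros r. now rewrite E. }
    assert (Cc : continuous (fun r : R => (RtoC (/ (2 * PI)) * (RtoC (c * (1 - r ^ 2)) * X))%C) 1)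
      by cts.
    intros P HP. assert (H := Cc P HP). unfold filtermap in *. unfold at_left, within.
    revert H. apply filter_imp. intros r Hr _. exact Hr.
  - intros z Hz. unfold extremal. rewrite Hz. f_equal. ring.
Qed.

Lemma sup_norm_const (A : C -> Prop) (k : C) : (exists z, A z) -> sup_norm A (fun _ => k) = Cmod k.
Proof.
  intros [z0 Hz0]. unfold sup_norm.
  rewrite (is_lub_Rbar_unique _ (Finite (Cmod k))); [reflexivity|]. split.
  - intros x [z [_ ->]]. simpl. lra.
  - intros b Hb. apply Hb. now exists z0.
Qed.

Theorem theorem2p1 :
  (forall (alpha : R) (g fs f : C -> C),
     0 <= alpha ->
     continuous_within closed_unit_disc g ->
     Cm_circle 1 fs ->
     Cm_on 2 unit_disc f ->
     dirichlet_problem alpha g fs f ->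
     poisson_integral alpha fs (RtoC 0) = RtoC 0 ->
     forall z : C, closed_unit_disc z ->
       Cmod (f z) <=
         Rpower 2 alpha *
         (4 / PI * sup_norm unit_circle fs * atan (Cmod z) +
          sup_norm unit_disc g * Rpow_nonneg (1 - Cmod z ^ 2) (alpha + 1)))
  /\
  (forall c : R, 0 < c ->
     let g : C -> C := fun _ => RtoC (- c) in
     let f : C -> C := fun z => RtoC (c * (1 - Cmod z ^ 2)) in
     let fs : C -> C := fun _ => RtoC 0 in
     continuous_within closed_unit_disc g /\
     Cm_circle 1 fs /\
     Cm_on 2 unit_disc f /\
     dirichlet_problem 0 g fs f /\
     poisson_integral 0 fs (RtoC 0) = RtoC 0 /\
     forall z : C, closed_unit_disc z ->
       Cmod (f z) =
         Rpower 2 0 *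
         (4 / PI * sup_norm unit_circle fs * atan (Cmod z) +
          sup_norm unit_disc g * Rpow_nonneg (1 - Cmod z ^ 2) (0 + 1))).
Proof.
  assert (HPI := PI_RGT_0). split.
  - intros alpha g fs f Ha Hg Hfs HC2 HD HP z Hz.
    assert (Cfs := Cm_circle_cont 1 fs Hfs).
    assert (BS : forall w, unit_circle w -> Cmod (fs w) <= sup_norm unit_circle fs).
    { destruct (continuous_bounded (fun t => fs (cis t)) (- PI) PI ltac:(lra) Cfs) as [M [_ HM]].
      apply (sup_norm_ub unit_circle fs M). intros w Hw.
      destruct (polar_unit w Hw) as [t [Ht ->]]. now apply HM. }
    set (S := sup_norm unit_circle fs) in *.
    destruct (Rle_lt_or_eq_dec _ _ Hz) as [Hlt|Heq].
    + assert (H0 : CInt (fun t => fs (cis t)) 0 (2 * PI) = RtoC 0).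
      { rewrite poisson_integral_0 in HP. apply (Cmult_reg_l (RtoC (/ (2 * PI)))).
        - intros F. injection F. apply Rgt_not_eq, Rinv_0_lt_compat. lra.
        - rewrite HP. ring. }
      assert (Hw := disc_weight_pos z Hlt). unfold Rpow_nonneg.
      destruct (Rlt_dec 0 (1 - Cmod z ^ 2)) as [_|n]; [|contradiction].
      apply (interior_bound alpha g fs f Ha Hg Cfs HC2 HD H0 S); [|exact Hlt].
      intros t. apply BS. apply Cmod_cis.
    (* On the circle the values are those of [fs], and the right side is 2^alpha S. *)
    + destruct HD as [_ [_ HB]]. rewrite HB by exact Heq.
      assert (HS := BS z Heq). rewrite Heq, atan_1.
      replace (1 - 1 ^ 2) with 0 by ring. unfold Rpow_nonneg.
      destruct (Rlt_dec 0 0) as [n|_]; [lra|]. rewrite Rmult_0_r, Rplus_0_r.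
      replace (4 / PI * S * (PI / 4)) with S by (field; lra).
      assert (H2 : 1 <= Rpower 2 alpha).
      { rewrite <- (Rpower_O 2) by lra. apply Rle_Rpower; lra. }
      assert (0 <= S) by (eapply Rle_trans; [apply Cmod_ge_0|exact HS]). nra.
  - intros c Hc g f fs. split; [|split; [|split; [|split; [|split]]]].
    + intros z _ P HP. unfold filtermap, within. apply filter_forall. intros w _.
      exact (locally_singleton _ _ HP).
    + split; apply trig_Cm; exact (trig_const 0).
    + exact (extremal_C2 c).
    + split; [|exact (extremal_boundary c)]. intros z _. exact (extremal_laplacian c z).
    + rewrite poisson_integral_0. unfold fs. rewrite CInt_const. ring.
    + intros z Hz. unfold fs, g, f.
      rewrite (sup_norm_const unit_circle) by (exists (RtoC 1); apply Cmod_1).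
      rewrite (sup_norm_const unit_disc) by (exists (RtoC 0); unfold unit_disc; rewrite Cmod_0; lra).
      rewrite Cmod_0, Rpower_O by lra. rewrite !Cmod_R, Rabs_Ropp, (Rabs_pos_eq c) by lra.
      unfold closed_unit_disc in Hz. assert (Hm := Cmod_ge_0 z).
      assert (Hn : 0 <= 1 - Cmod z ^ 2) by nra.
      rewrite Rabs_pos_eq by nra. unfold Rpow_nonneg.
      destruct (Rlt_dec 0 (1 - Cmod z ^ 2)) as [H|H].
      * rewrite Rplus_0_l, Rpower_1 by exact H. ring.
      * replace (1 - Cmod z ^ 2) with 0 by lra. ring.
Qed.
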